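(* There is a 1-1 correspondence between transversal $\mathbb{Z}$-projective lattices and transversal $\mathbb{Z}$-projective structures on a foliated manifold $(N,\mathcal{F})$. In this 1-1 correspondence, locally $$\Sigma:=\mathbb{Z}\langle j^1x_1,\dots,j^1x_{l+1}\rangle,$$ where $[x_1:\dots:x_{l+1}]$ are local transversal $\mathbb{Z}$-projective coordinates.
   Context: Let $(N,\mathcal{F})$ be a foliated manifold whose foliation has codimension $l\ge 0$. **Transversal $\mathbb{Z}$-projective lattice.** Fix a (real) line bundle $L\to N$, with first jet bundle $J^1L\to N$. A transversal $\mathbb{Z}$-projective lattice on $(N,\mathcal{F})$ is a choice of embedded smooth submanifold $\Sigma\subset J^1L$ satisfying: (T1) the composite $\Sigma\hookrightarrow J^1L\to N$ is a $\mathbb{Z}^{l+1}$-bundle, i.e. it has fibre $\mathbb{Z}^{l+1}$ and structure group $\mathrm{GL}(l+1;\mathbb{Z})$; (T2) $\Sigma^{\mathbb{R}}:=\Sigma\otimes_{\mathbb{Z}}\mathbb{R}$ fits in a short exact sequence of vector bundles $0\to\nu^*\otimes L\to\Sigma^{\mathbb{R}}\to L\to 0$, where $\nu^*\subset T^*N$ is the conormal bundle to $\mathcal{F}$ and $\Sigma^{\mathbb{R}}\to L$ is the restriction of the canonical projection $J^1L\to L$; (T3) any local section of $\Sigma$ is holonomic, i.e. of the form $j^1u$ for some local section $u$ of $L$. **Transversal $\mathbb{Z}$-projective structure.** A transversal $\mathbb{Z}$-projective structure on $(N,\mathcal{F})$ is an atlas $\mathcal{A}:=\{(U_i,\chi_i)\}$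 of submersions $\chi_i\colon U_i\to\mathbb{R}\mathrm{P}^l$ locally defining $\mathcal{F}$ such that, for all $i,j$ with $U_{ij}:=U_i\cap U_j\neq\varnothing$, there exists a smooth map $A_{ij}\colon U_{ij}\to\mathrm{GL}(l+1;\mathbb{Z})$ satisfying: $\chi_j=[A_{ij}]\circ\chi_i$ on $U_{ij}$, where $[A_{ij}]\colon\mathbb{R}\mathrm{P}^l\to\mathbb{R}\mathrm{P}^l$ is the map induced by $A_{ij}$; and $\{A_{ij}\}$ satisfies the cocycle condition. The components of $\chi_j$ are called local transversal $\mathbb{Z}$-projective coordinates on $(N,\mathcal{F})$. **Notation.** The standard coordinates $x_1,\dots,x_{l+1}$ on $\mathbb{R}^{l+1}$ define global sections of $O(1)\to\mathbb{R}\mathrm{P}^l$, the dual of the tautological line bundle; in the displayed local formula, $x_r$ is viewed as a local section of $L$ by pulling back along $\chi_i$, with $L|_{U_i}=\chi_i^*O(1)$. *)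

(* Defs.v *)
From HB Require Import structures.
From mathcomp Require Import all_boot all_order all_algebra.
From mathcomp Require Import all_classical all_reals all_analysis.
Set Implicit Arguments.
Unset Strict Implicit.
Unset Printing Implicit Defensive.
Import Order.TTheory GRing.Theory Num.Theory numFieldNormedType.Exports.
Local Open Scope classical_set_scope.
Local Open Scope ring_scope.

Section SmoothRn.
Variables (R : realType) (n : nat).
Implicit Types (U : set 'rV[R]_n) (f g : 'rV[R]_n -> R).

Definition partial (j : 'I_n) f : 'rV[R]_n -> R :=
  fun y => 'D_(delta_mx 0 j : 'rV[R]_n) f y.

(* Meaningful only for open U. *)
Fixpoint Ck (k : nat) U f : Prop :=
  match k with
  | 0%N => forall y, U y -> {for y, continuous f}
  | k'.+1 => (forall y, U y -> differentiable f y) /\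
             forall j, Ck k' U (partial j f)
  end.

Definition smooth U f : Prop := forall k, Ck k U f.

Lemma differentiable_near_eq f g y :
  (\forall z \near y, f z = g z) -> differentiable f y -> differentiable g y.
Proof.
move=> fg df; have fgy : f y = g y := nbhs_singleton fg.
have fg0 : \forall z \near (0 : 'rV[R]_n), f (z + y) = g (z + y).
  by move: fg; rewrite (near_shift 0 y) /= subr0.
have [cdf /eqaddoP E] := (diff_locallyP y f).1 df.
have gE : g \o shift y = cst (g y) + 'd f y +o_ (0 : 'rV[R]_n) id.
  apply/eqaddoP => e e0; apply: filterS2 fg0 (E e e0) => z fgz.
  by rewrite !fctE /= fgz fgy.
by apply/diff_locallyP; rewrite (diff_unique cdf gE).
Qed.

Lemma Ck_ext k U f g : open U -> (forall y, U y -> f y = g y) ->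
  Ck k U f -> Ck k U g.
Proof.
move=> oU; elim: k f g => [|k IH] f g fg /= Cf.
  have nfg y : U y -> \forall z \near y, f z = g z.
    by move=> Uy; apply: filterS (open_nbhs_nbhs (conj oU Uy)).
  move=> y Uy; have := Cf y Uy; rewrite /prop_for /continuous_at (fg y Uy).
  apply: cvg_trans.
  by have /near_eq_cvg := nfg y Uy; apply.
have nfg y : U y -> \forall z \near y, f z = g z.
  by move=> Uy; apply: filterS (open_nbhs_nbhs (conj oU Uy)).
case: Cf => df Cf; split=> [y Uy|j].
  by apply: differentiable_near_eq (df y Uy); exact: nfg.
apply: IH (Cf j) => y Uy; apply: near_eq_derive; exact: nfg.
Qed.

Lemma partial_lin j a f g y : differentiable f y -> differentiable g y ->
  partial j (fun z => a * f z + g z) y = a * partial j f y + partial j g y.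
Proof.
move=> df dg; set e : 'rV[R]_n := delta_mx 0 j.
have df' : derivable f y e by exact: diff_derivable.
have dg' : derivable g y e by exact: diff_derivable.
have E := deriveD (derivableZ (k := a) df') dg'.
by rewrite (deriveZ a df') in E.
Qed.

Lemma Ck_lin k U a f g : open U -> Ck k U f -> Ck k U g ->
  Ck k U (fun y => a * f y + g y).
Proof.
move=> oU; elim: k f g => [|k IH] f g /=.
  by move=> cf cg y Uy; apply: cvgD (cg y Uy); apply: cvgMr (cf y Uy).
move=> [df Cf] [dg Cg]; split=> [y Uy|j].
  have -> : (fun z => a * f z + g z) = a *: f + g by [].
  by apply: differentiableD; [apply: differentiableZ; exact: df|exact: dg].
apply: Ck_ext (IH _ _ (Cf j) (Cg j)) => // y Uy.
by rewrite partial_lin //; [exact: df|exact: dg].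
Qed.

Lemma smooth0 U : smooth U (fun=> 0).
Proof.
have p0 j : partial j (fun=> 0) = (fun=> 0).
  by apply/funext => y; exact: (derive_cst (0 : R)).
elim=> [|k IH] /=; first by move=> y _; exact: cst_continuous.
by split=> [y _|j]; [exact: differentiable_cst|rewrite p0].
Qed.

Lemma smooth_lin U a f g : open U -> smooth U f -> smooth U g ->
  smooth U (fun y => a * f y + g y).
Proof. by move=> oU Sf Sg k; apply: Ck_lin. Qed.

Lemma smooth_subset U V f : U `<=` V -> smooth V f -> smooth U f.
Proof.
move=> UV Sf k; elim: k f {Sf}(Sf k) => [|k IH] f /=.
  by move=> cf y /UV; exact: cf.
by move=> [df Cf]; split=> [y /UV|j]; [exact: df|exact: IH].
Qed.

End SmoothRn.

Section Charts.
Variable R : realType.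

(* The values of [ccoord] outside [cdom] are irrelevant. *)
Record chart (T : Type) (n : nat) := Chart {
  cdom : set T;
  ccoord :> T -> 'rV[R]_n }.

Definition chart_inv T n (c : chart T n) (y : 'rV[R]_n) : option T :=
  if pselect (exists x, cdom c x /\ c x = y) is left ex
  then Some (projT1 (cid ex)) else None.

(* f \o c^-1, extended by 0 outside the image of c. *)
Definition in_chart T n (c : chart T n) (f : T -> R) : 'rV[R]_n -> R :=
  fun y => oapp f 0 (chart_inv c y).

Definition transition_smooth T n (c c' : chart T n) : Prop :=
  open (c @` (cdom c `&` cdom c')) /\
  forall i : 'I_n, smooth (c @` (cdom c `&` cdom c'))
                          (in_chart c (fun x => c' x 0 i)).

(* c belongs to the maximal smooth atlas generated by A. *)
Definition in_maximal_atlas T n (A : set (chart T n)) (c : chart T n) : Prop :=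
  [/\ set_inj (cdom c) c, open (c @` cdom c)
    & forall a, A a -> transition_smooth a c /\ transition_smooth c a].

(* T carries no topology of its own here: its open sets are those given by A. *)
Definition atlas_open T n (A : set (chart T n)) (O : set T) : Prop :=
  forall c, A c -> open (c @` (cdom c `&` O)).

Definition smooth_on T n (A : set (chart T n)) (U : set T) (f : T -> R) : Prop :=
  forall c, A c -> smooth (c @` (cdom c `&` U)) (in_chart c f).

Definition smooth_map T n (A : set (chart T n)) (U : set T)
    T' n' (B : set (chart T' n')) (f : T -> T') : Prop :=
  forall b, B b -> atlas_open A (U `&` f @^-1` cdom b) /\
    forall i : 'I_n', smooth_on A (U `&` f @^-1` cdom b) (fun x => b (f x) 0 i).

Definition submersion_on T n (A : set (chart T n)) (U : set T)
    T' n' (B : set (chart T' n')) (f : T -> T') : Prop :=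
  smooth_map A U B f /\
  forall p a b, U p -> A a -> B b -> cdom a p -> cdom b (f p) ->
    \rank (\matrix_(j < n, i < n')
             partial j (in_chart a (fun x => b (f x) 0 i)) (a p)) = n'.

Definition embedded_submanifold T m (A : set (chart T m)) (S : set T) : Prop :=
  exists d : nat, forall a, S a -> exists c : chart T m,
    [/\ in_maximal_atlas A c, cdom c a &
      c @` (cdom c `&` S) =
      c @` cdom c `&` [set y | forall i : 'I_m, (d <= i)%N -> y 0 i = 0]].

Record manifold (n : nat) := Manifold {
  points :> topologicalType;
  points_hausdorff : hausdorff_space points;
  points_second_countable : @second_countable points;
  charts : set (chart points n);
  charts_cover : forall p, exists2 c, charts c & cdom c p;
  charts_open : forall c, charts c -> open (cdom c);
  charts_inj : forall c, charts c -> set_inj (cdom c) c;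
  charts_homeo : forall c U, charts c -> U `<=` cdom c ->
    (open U <-> open (c @` U));
  charts_smooth : forall c c', charts c -> charts c' -> transition_smooth c c' }.

Arguments charts {n} _ _.

(* A foliation of dimension k and codimension l, given by a foliated atlas:
   the last l coordinates of a foliated chart are transversal. *)
Record foliation (k l : nat) (N : manifold (k + l)) := Foliation {
  fcharts : set (chart N (k + l));
  fcharts_maximal : forall c, fcharts c -> in_maximal_atlas (charts N) c;
  fcharts_cover : forall p, exists2 c, fcharts c & cdom c p;
  fcharts_plaques : forall c c' p, fcharts c -> fcharts c' ->
    cdom c p -> cdom c' p ->
    exists2 W, nbhs p W & forall x y, W x -> W y ->
      rsubmx (c x) = rsubmx (c y) -> rsubmx (c' x) = rsubmx (c' y) }.

End Charts.

Arguments charts {R n} _ _.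
Arguments fcharts {R k l N} _ _.

Section LineBundles.
Variables (R : realType) (n : nat) (N : manifold R n).

Record trivialization (L : N -> lmodType R) := Trivialization {
  tdom : set N;
  tmap :> forall x, {scalar L x} }.

Record line_bundle := LineBundle {
  fiber :> N -> lmodType R;
  trivs : set (trivialization fiber);
  trivs_cover : forall p, exists2 t, trivs t & tdom t p;
  trivs_open : forall t, trivs t -> open (tdom t);
  trivs_bij : forall t p, trivs t -> tdom t p -> bijective (t p);
  trivs_smooth : forall t t', trivs t -> trivs t' ->
    exists2 g : N -> R, smooth_on (charts N) (tdom t `&` tdom t') g &
      forall p v, tdom t p -> tdom t' p -> t' p v = g p * t p v }.

Variable L : line_bundle.

(* Sections are total functions; only their values near the points of
   interest matter. *)
Definition section := forall x, L x.

Definition smooth_sec (U : set N) (s : section) : Prop :=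
  forall t, trivs t -> smooth_on (charts N) (U `&` tdom t) (fun x => t x (s x)).

Definition smooth_at (p : N) (s : section) : Prop :=
  exists U, [/\ open U, U p & smooth_sec U s].

Definition local_rep (c : chart R N n) (t : trivialization L) (s : section) :
  'rV[R]_n -> R := in_chart c (fun x => t x (s x)).

(* s vanishes to first order at p: s(p) = 0 and ds(p) = 0. *)
Definition vanish1 (p : N) (s : section) : Prop :=
  forall c t, charts N c -> trivs t -> cdom c p -> tdom t p ->
    local_rep c t s (c p) = 0 /\ forall j, partial j (local_rep c t s) (c p) = 0.

Definition jet_class (p : N) (u : section) : set section :=
  [set v | smooth_at p v /\ vanish1 p (fun x => v x - u x)].

(* The fibre of J^1 L at p: classes of local sections near p. *)
Record J1 (p : N) := MkJ1 {
  jet_set : set section;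
  jet_setP : exists2 u, smooth_at p u & jet_set = jet_class p u }.

Definition sec0 : section := fun x => 0.
Definition sec_lin (a : R) (u v : section) : section := fun x => a *: u x + v x.

Lemma local_rep_lin c t a u v y :
  local_rep c t (sec_lin a u v) y = a * local_rep c t u y + local_rep c t v y.
Proof.
rewrite /local_rep /in_chart; case: (chart_inv c y) => [x|] /=.
  by rewrite /sec_lin linearP.
by rewrite mulr0 addr0.
Qed.

Lemma local_rep0 c t y : local_rep c t sec0 y = 0.
Proof.
by rewrite /local_rep /in_chart; case: (chart_inv c y) => [x|] //=; rewrite linear0.
Qed.

Lemma image_chart_open c (U : set N) : charts N c -> open U ->
  open (c @` (cdom c `&` U)).
Proof.
move=> Ac oU; apply/(charts_homeo Ac (@subIsetl _ _ _)).
by apply: openI => //; exact: charts_open.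
Qed.

Lemma smooth_at0 p : smooth_at p sec0.
Proof.
exists setT; split=> //; first exact: openT.
move=> t At c Ac; have -> : in_chart c (fun x => t x (sec0 x)) = fun=> 0.
  by apply/funext => y; exact: local_rep0.
exact: smooth0.
Qed.

Lemma smooth_at_lin p a u v : smooth_at p u -> smooth_at p v ->
  smooth_at p (sec_lin a u v).
Proof.
move=> [U [oU Up Su]] [V [oV Vp Sv]]; exists (U `&` V).
split=> //; first exact: openI.
move=> t At c Ac.
have -> : in_chart c (fun x => t x (sec_lin a u v x)) =
    (fun y => a * local_rep c t u y + local_rep c t v y).
  by apply/funext => y; exact: local_rep_lin.
apply: smooth_lin.
- apply: image_chart_open => //; apply: openI; first exact: openI.
  exact: trivs_open.
- by apply: smooth_subset (Su t At c Ac) => _ [x [? [[? ?] ?]] <-]; exists x.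
- by apply: smooth_subset (Sv t At c Ac) => _ [x [? [[? ?] ?]] <-]; exists x.
Qed.

Lemma differentiable_local_rep p s c t : smooth_at p s -> charts N c ->
  trivs t -> cdom c p -> tdom t p -> differentiable (local_rep c t s) (c p).
Proof.
move=> [U [oU Up Ss]] Ac At cp tp; have [ds _] := Ss t At c Ac 1%N.
by apply: ds; exists p.
Qed.

Lemma vanish1_0 p : vanish1 p sec0.
Proof.
move=> c t Ac At cp tp; split=> [|j]; first exact: local_rep0.
have -> : local_rep c t sec0 = fun=> 0 by apply/funext => y; exact: local_rep0.
exact: (derive_cst (0 : R)).
Qed.

Lemma vanish1_lin p a u v : smooth_at p u -> smooth_at p v ->
  vanish1 p u -> vanish1 p v -> vanish1 p (sec_lin a u v).
Proof.
move=> Su Sv Vu Vv c t Ac At cp tp.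
have [u0 du0] := Vu c t Ac At cp tp; have [v0 dv0] := Vv c t Ac At cp tp.
split=> [|j]; first by rewrite local_rep_lin u0 v0 mulr0 addr0.
have -> : local_rep c t (sec_lin a u v) =
    (fun y => a * local_rep c t u y + local_rep c t v y).
  by apply/funext => y; exact: local_rep_lin.
by rewrite partial_lin ?du0 ?dv0 ?mulr0 ?addr0 //; exact: differentiable_local_rep.
Qed.

Let subE u v : (fun x => v x - u x) = sec_lin (-1) u v.
Proof. by apply: functional_extensionality_dep => x; rewrite /sec_lin scaleN1r addrC. Qed.

Lemma smooth_at_sub p u v : smooth_at p u -> smooth_at p v ->
  smooth_at p (fun x => v x - u x).
Proof. by rewrite subE; exact: smooth_at_lin. Qed.

Lemma jet_class_eq p u v : smooth_at p u -> smooth_at p v ->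
  vanish1 p (fun x => v x - u x) -> jet_class p u = jet_class p v.
Proof.
move=> Su Sv Vuv; apply/seteqP; split=> w [Sw Vw]; split=> //.
- have -> : (fun x => w x - v x) = sec_lin (-1) (fun x => v x - u x) (fun x => w x - u x).
    apply: functional_extensionality_dep => x.
    by rewrite /sec_lin scaleN1r opprB [RHS]addrC addrA subrK.
  by apply: vanish1_lin => //; exact: smooth_at_sub.
- have -> : (fun x => w x - u x) = sec_lin 1 (fun x => v x - u x) (fun x => w x - v x).
    apply: functional_extensionality_dep => x.
    by rewrite /sec_lin scale1r [RHS]addrC addrA subrK.
  by apply: vanish1_lin => //; exact: smooth_at_sub.
Qed.

Lemma jet_class_refl p u : smooth_at p u -> jet_class p u u.
Proof.
move=> Su; split=> //; have -> : (fun x => u x - u x) = sec0.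
  by apply: functional_extensionality_dep => x; rewrite subrr.
exact: vanish1_0.
Qed.

Definition zero_jet (p : N) : J1 p :=
  MkJ1 (ex_intro2 _ _ sec0 (smooth_at0 p) erefl).

(* j^1_p u; the zero jet by convention if u is not smooth near p. *)
Definition j1 (p : N) (u : section) : J1 p :=
  if pselect (smooth_at p u) is left Su
  then MkJ1 (ex_intro2 _ _ u Su erefl) else zero_jet p.

Definition jet_repr (p : N) (a : J1 p) : section := projT1 (cid2 (jet_setP a)).

Definition jet_lin (p : N) (c : R) (a b : J1 p) : J1 p :=
  j1 p (sec_lin c (jet_repr a) (jet_repr b)).

Lemma jet_eq p (a b : J1 p) : jet_set a = jet_set b -> a = b.
Proof.
case: a b => [A hA] [B hB] /= AB; subst B; congr MkJ1; exact: Prop_irrelevance.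
Qed.

Lemma jet_repr_smooth p (a : J1 p) : smooth_at p (jet_repr a).
Proof. by rewrite /jet_repr; case: cid2. Qed.

Lemma jet_setE p (a : J1 p) : jet_set a = jet_class p (jet_repr a).
Proof. by rewrite /jet_repr; case: cid2. Qed.

Lemma jet_set_j1 p u : smooth_at p u -> jet_set (j1 p u) = jet_class p u.
Proof. by move=> Su; rewrite /j1; case: pselect. Qed.

Lemma jet_reprK p (a : J1 p) : j1 p (jet_repr a) = a.
Proof. by apply: jet_eq; rewrite jet_set_j1 ?jet_setE //; exact: jet_repr_smooth. Qed.

Lemma j1_repr p u : smooth_at p u -> vanish1 p (fun x => u x - jet_repr (j1 p u) x).
Proof.
move=> Su; have : jet_set (j1 p u) u by rewrite jet_set_j1 //; exact: jet_class_refl.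
by rewrite jet_setE => -[].
Qed.

Lemma j1_eq p u v : smooth_at p u -> smooth_at p v ->
  vanish1 p (fun x => v x - u x) -> j1 p u = j1 p v.
Proof.
by move=> Su Sv V; apply: jet_eq; rewrite !jet_set_j1 //; exact: jet_class_eq.
Qed.

Lemma j1_lin p c u v : smooth_at p u -> smooth_at p v ->
  j1 p (sec_lin c u v) = jet_lin c (j1 p u) (j1 p v).
Proof.
move=> Su Sv; apply/esym.
have Sru := jet_repr_smooth (j1 p u); have Srv := jet_repr_smooth (j1 p v).
apply: j1_eq; [exact: smooth_at_lin..|].
have -> : (fun x => sec_lin c u v x -
      sec_lin c (jet_repr (j1 p u)) (jet_repr (j1 p v)) x) =
    sec_lin c (fun x => u x - jet_repr (j1 p u) x)
              (fun x => v x - jet_repr (j1 p v) x).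
  apply: functional_extensionality_dep => x.
  by rewrite /sec_lin scalerBr opprD addrACA.
by apply: vanish1_lin; try exact: smooth_at_sub; exact: j1_repr.
Qed.

HB.instance Definition _ (p : N) := gen_eqMixin (J1 p).
HB.instance Definition _ (p : N) := gen_choiceMixin (J1 p).

Definition jet_add (p : N) : J1 p -> J1 p -> J1 p := jet_lin 1.
Definition jet_scale (p : N) (c : R) (a : J1 p) : J1 p := jet_lin c a (zero_jet p).
Definition jet_opp (p : N) : J1 p -> J1 p := jet_scale (-1).

Lemma zero_jetE p : zero_jet p = j1 p sec0.
Proof. by apply: jet_eq; rewrite jet_set_j1 //; exact: smooth_at0. Qed.

Lemma jet_ind p (P : J1 p -> Prop) :
  (forall u, smooth_at p u -> P (j1 p u)) -> forall a, P a.
Proof. by move=> H a; rewrite -(jet_reprK a); apply: H; exact: jet_repr_smooth. Qed.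

Lemma jet_addE p u v : smooth_at p u -> smooth_at p v ->
  jet_add (j1 p u) (j1 p v) = j1 p (fun x => u x + v x).
Proof.
move=> Su Sv; rewrite /jet_add -j1_lin //; congr j1.
by apply: functional_extensionality_dep => x; rewrite /sec_lin scale1r.
Qed.

Lemma jet_scaleE p c u : smooth_at p u ->
  jet_scale c (j1 p u) = j1 p (fun x => c *: u x).
Proof.
move=> Su; rewrite /jet_scale zero_jetE -j1_lin //; last exact: smooth_at0.
by congr j1; apply: functional_extensionality_dep => x; rewrite /sec_lin addr0.
Qed.

Lemma smooth_at_add p u v : smooth_at p u -> smooth_at p v ->
  smooth_at p (fun x => u x + v x).
Proof.
move=> Su Sv; have -> : (fun x => u x + v x) = sec_lin 1 u v.
  by apply: functional_extensionality_dep => x; rewrite /sec_lin scale1r.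
exact: smooth_at_lin.
Qed.

Lemma smooth_at_scale p c u : smooth_at p u -> smooth_at p (fun x => c *: u x).
Proof.
move=> Su; have -> : (fun x => c *: u x) = sec_lin c u sec0.
  by apply: functional_extensionality_dep => x; rewrite /sec_lin addr0.
by apply: smooth_at_lin => //; exact: smooth_at0.
Qed.

Let ext (u v : section) p : (forall x, u x = v x) -> j1 p u = j1 p v.
Proof. by move=> uv; congr j1; apply: functional_extensionality_dep. Qed.

Fact jet_addA p : associative (@jet_add p).
Proof.
elim/jet_ind => u Su; elim/jet_ind => v Sv; elim/jet_ind => w Sw.
rewrite !jet_addE; try by repeat (assumption || apply: smooth_at_add).
by apply: ext => x; rewrite addrA.
Qed.

Fact jet_addC p : commutative (@jet_add p).
Proof.
elim/jet_ind => u Su; elim/jet_ind => v Sv.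
by rewrite !jet_addE //; apply: ext => x; rewrite addrC.
Qed.

Fact jet_add0 p : left_id (zero_jet p) (@jet_add p).
Proof.
elim/jet_ind => u Su; rewrite zero_jetE jet_addE //; last exact: smooth_at0.
by apply: ext => x; rewrite add0r.
Qed.

Fact jet_addN p : left_inverse (zero_jet p) (@jet_opp p) (@jet_add p).
Proof.
elim/jet_ind => u Su; rewrite /jet_opp jet_scaleE // zero_jetE jet_addE //.
  by apply: ext => x; rewrite scaleN1r addNr.
exact: smooth_at_scale.
Qed.

HB.instance Definition _ (p : N) := GRing.isZmodule.Build (J1 p)
  (@jet_addA p) (@jet_addC p) (@jet_add0 p) (@jet_addN p).

Fact jet_scaleA p (c d : R) (a : J1 p) :
  jet_scale c (jet_scale d a) = jet_scale (c * d) a.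
Proof.
elim/jet_ind: a => u Su; rewrite !jet_scaleE //; last exact: smooth_at_scale.
by apply: ext => x; rewrite scalerA.
Qed.

Fact jet_scale1 p : left_id 1 (@jet_scale p).
Proof.
by elim/jet_ind => u Su; rewrite jet_scaleE //; apply: ext => x; rewrite scale1r.
Qed.

Fact jet_scaleDr p : right_distributive (@jet_scale p) +%R.
Proof.
move=> c; elim/jet_ind => u Su; elim/jet_ind => v Sv.
rewrite -![_ + _]/(jet_add _ _) jet_addE // !jet_scaleE ?jet_addE //;
  try by repeat (assumption || apply: smooth_at_add || apply: smooth_at_scale).
by apply: ext => x; rewrite scalerDr.
Qed.

Fact jet_scaleDl p (a : J1 p) : {morph (@jet_scale p)^~ a : c d / c + d}.
Proof.
elim/jet_ind: a => u Su c d.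
rewrite -[jet_scale c _ + _]/(jet_add _ _) !jet_scaleE // jet_addE;
  try exact: smooth_at_scale.
by apply: ext => x; rewrite scalerDl.
Qed.

HB.instance Definition _ (p : N) := GRing.Zmodule_isLmodule.Build R (J1 p)
  (@jet_scaleA p) (@jet_scale1 p) (@jet_scaleDr p) (@jet_scaleDl p).

Definition jet_val (p : N) (a : J1 p) : L p := jet_repr a p.

Definition jet_partial (c : chart R N n) (t : trivialization L)
  (p : N) (a : J1 p) (j : 'I_n) : R := partial j (local_rep c t (jet_repr a)) (c p).

(* The total space of J^1 L and its charts (point, value, first derivatives). *)
Definition J1_total := {p : N & J1 p}.

Definition Jet (p : N) (a : J1 p) : J1_total := existT _ p a.

Definition jet_chart (c : chart R N n) (t : trivialization L) :
    chart R J1_total (n + (1 + n)) :=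
  Chart [set a : J1_total | cdom c (projT1 a) /\ tdom t (projT1 a)]
    (fun a : J1_total =>
       row_mx (c (projT1 a))
         (row_mx (const_mx (t _ (jet_val (projT2 a))) : 'rV[R]_1)
                 (\row_j jet_partial c t (projT2 a) j))).

Definition J1_charts : set (chart R J1_total (n + (1 + n))) :=
  [set jc | exists c t, [/\ charts N c, trivs t & jc = jet_chart c t]].

Definition smooth_jet_section (U : set N) (sigma : forall p, J1 p) : Prop :=
  smooth_map (charts N) U J1_charts (fun p => Jet (sigma p)).

End LineBundles.

Arguments trivs {R n N} _ _.

Section Lattices.
Variables (R : realType) (k l : nat) (N : manifold R (k + l)).
Variables (F : foliation N) (L : line_bundle N).

Definition jet_fiber (S : set (J1_total L)) (p : N) : set (J1 L p) :=
  [set a | S (Jet a)].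

Arguments jet_fiber _ _ _ : clear implicits.

Definition Zcomb (p : N) (m : 'rV[int]_l.+1) (b : 'I_l.+1 -> J1 L p) : J1 L p :=
  \sum_r b r *~ m 0 r.

Definition Zspan (p : N) (b : 'I_l.+1 -> J1 L p) : set (J1 L p) :=
  [set Zcomb m b | m in setT].

(* S -> N is locally U x Z^(l+1): over U, S is freely generated over Z by the
   smooth sections sigma_r, and each sheet is open in S; transition functions
   are then automatically (locally constant) GL(l+1;Z)-valued. *)
Definition Zbundle (S : set (J1_total L)) : Prop :=
  forall p : N, exists (U : set N) (sigma : 'I_l.+1 -> forall q, J1 L q),
    [/\ open U, U p,
        forall r, smooth_jet_section U (sigma r),
        forall q, U q -> jet_fiber S q = Zspan (sigma^~ q) /\
          forall m, Zcomb m (sigma^~ q) = 0 -> m = 0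
      & forall m, exists2 O, atlas_open (@J1_charts _ _ _ L) O &
          [set Jet (Zcomb m (sigma^~ q)) | q in U] = O `&` S].

Definition Rspan (p : N) (A : set (J1 L p)) : set (J1 L p) :=
  [set a | exists (d : nat) (c : 'I_d -> R) (b : 'I_d -> J1 L p),
     (forall i, A (b i)) /\ a = \sum_i c i *: b i].

(* nu^* (x) L inside J^1 L: jets with value 0 (hence in T^*N (x) L) whose
   derivative vanishes on the tangent space to the leaves. *)
Definition conormal_jet (p : N) (a : J1 L p) : Prop :=
  jet_val a = 0 /\
  forall c t, fcharts F c -> trivs L t -> cdom c p -> tdom t p ->
    forall j : 'I_k, jet_partial c t a (lshift l j) = 0.

(* Exactness of 0 -> nu^* (x) L -> S^R -> L -> 0, with S^R = Rspan in J^1 L;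
   by counting dimensions, exactness forces S (x) R -> J^1 L to be injective. *)
Definition jet_exact (S : set (J1_total L)) : Prop :=
  forall p : N,
    (forall a, Rspan (jet_fiber S p) a /\ jet_val a = 0 <-> conormal_jet a) /\
    (forall v : L p, exists2 a, Rspan (jet_fiber S p) a & jet_val a = v).

Definition holonomic (S : set (J1_total L)) : Prop :=
  forall (U : set N) (sigma : forall p, J1 L p), open U ->
    smooth_jet_section U sigma -> (forall p, U p -> S (Jet (sigma p))) ->
    exists2 u : section L, smooth_sec U u & forall p, U p -> sigma p = j1 p u.

Record Zlattice := MkZlattice {
  lattice_set :> set (J1_total L);
  lattice_submanifold : embedded_submanifold (@J1_charts _ _ _ L) lattice_set;
  lattice_T1 : Zbundle lattice_set;
  lattice_T2 : jet_exact lattice_set;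
  lattice_T3 : holonomic lattice_set }.

(* S' = j^1(f)(S) for an automorphism of L over the identity of N, that is,
   multiplication by a nowhere vanishing smooth function f. *)
Definition lattice_iso (S S' : Zlattice) : Prop :=
  exists f : N -> R,
    [/\ smooth_on (charts N) setT f, forall p, f p != 0 &
      forall p (u : section L), smooth_at p u ->
        (lattice_set S (Jet (j1 p u)) <->
         lattice_set S' (Jet (j1 p (fun x => f x *: u x))))].

End Lattices.

Arguments jet_fiber {R k l N L} _ _ _.

Section ProjectiveSpace.
Variables (R : realType) (l : nat).

(* A point of RP^l is a line through 0 in R^(l+1), i.e. the fibre of the
   tautological bundle. *)
Record RP := MkRP {
  line :> set 'cV[R]_l.+1;
  lineP : exists2 v, v != 0 & line = [set a *: v | a in setT] }.

Definition rp_vec (x : RP) : 'cV[R]_l.+1 := projT1 (cid2 (lineP x)).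

Definition rp_chart (r : 'I_l.+1) : chart R RP l :=
  Chart [set x | rp_vec x r 0 != 0]
        (fun x => \row_s (rp_vec x (lift r s) 0 / rp_vec x r 0)).

Definition rp_charts : set (chart R RP l) := range rp_chart.

Definition proj_act (A : 'M[int]_l.+1) (x : RP) : set 'cV[R]_l.+1 :=
  [set map_mx intr A *m v | v in line x].

Lemma proj_act1 (x : RP) : proj_act 1%:M x = line x.
Proof.
rewrite /proj_act map_mx1; apply/seteqP; split=> [_ [v xv <-]|v xv].
  by rewrite mul1mx.
by exists v; rewrite ?mul1mx.
Qed.

Lemma proj_actM (A B : 'M[int]_l.+1) (x y z : RP) :
  line y = proj_act A x -> line z = proj_act B y -> line z = proj_act (B *m A) x.
Proof.
rewrite /proj_act => -> ->; rewrite map_mxM; apply/seteqP.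
split=> [_ [_ [v xv <-] <-]|_ [v xv <-]]; first by exists v; rewrite ?mulmxA.
by exists (map_mx intr A *m v); [exists v|rewrite mulmxA].
Qed.

Lemma proj_actV (A : 'M[int]_l.+1) (x y : RP) : A \in unitmx ->
  line y = proj_act A x -> line x = proj_act (invmx A) y.
Proof.
move=> uA; rewrite /proj_act => ->; apply/seteqP; split=> [v xv|_ [_ [v xv <-] <-]].
  exists (map_mx intr A *m v); first by exists v.
  by rewrite mulmxA -map_mxM mulVmx // map_mx1 mul1mx.
by rewrite mulmxA -map_mxM mulVmx // map_mx1 mul1mx.
Qed.

End ProjectiveSpace.

Section ProjectiveStructures.
Variables (R : realType) (k l : nat) (N : manifold R (k + l)).
Variable F : foliation N.

(* The plaques of F are locally the level sets of chi. *)
Definition locally_defines (U : set N) (chi : N -> RP R l) : Prop :=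
  forall p c, U p -> fcharts F c -> cdom c p ->
    exists2 W, nbhs p W & forall x y, W x -> W y ->
      (rsubmx (c x) = rsubmx (c y) <-> chi x = chi y).

(* A map to the discrete group GL(l+1;Z) is smooth iff it is locally
   constant. *)
Definition smooth_GLZ (U : set N) (A : N -> 'M[int]_l.+1) : Prop :=
  forall p, U p -> A p \in unitmx /\ \forall q \near p, A q = A p.

Record Zprojective := MkZprojective {
  ix : Type;
  udom : ix -> set N;
  umap : ix -> N -> RP R l;
  udom_open : forall i, open (udom i);
  udom_cover : forall p, exists i, udom i p;
  umap_submersion : forall i,
    submersion_on (charts N) (udom i) (@rp_charts R l) (umap i);
  umap_defines : forall i, locally_defines (udom i) (umap i);
  umap_cocycle : exists A : ix -> ix -> N -> 'M[int]_l.+1,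
    [/\ forall i j, smooth_GLZ (udom i `&` udom j) (A i j),
        forall i j p, udom i p -> udom j p ->
          line (umap j p) = proj_act (A i j p) (umap i p)
      & forall i j h p, udom i p -> udom j p -> udom h p ->
          A i h p = A j h p *m A i j p] }.

(* Two atlases define the same structure when their charts are related,
   locally, by elements of GL(l+1;Z). No cocycle is required of the transition
   matrices between the two atlases: [B] determines B only up to sign, and
   the signs can always be adjusted after refining the atlases. *)
Definition same_structure (P Q : Zprojective) : Prop :=
  forall (i : ix P) (j : ix Q) p, udom i p -> udom j p ->
    exists2 B : 'M[int]_l.+1, B \in unitmx &
      \forall q \near p, line (umap j q) = proj_act B (umap i q).

Lemma same_structure_refl P : same_structure P P.
Proof.
case: (umap_cocycle P) => A [sA hA _] i j p pi pj.
have [uA cA] := sA i j p (conj pi pj); exists (A i j p) => //.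
have nij : nbhs p (udom i `&` udom j).
  by apply: open_nbhs_nbhs; split=> //; apply: openI; exact: udom_open.
by apply: filterS2 nij cA => q [qi qj] <-; exact: hA.
Qed.

Lemma same_structure_sym P Q : same_structure P Q -> same_structure Q P.
Proof.
move=> PQ j i p pj pi; have [B uB cB] := PQ i j p pi pj.
exists (invmx B); first by rewrite unitmx_inv.
by apply: filterS cB => q; exact: proj_actV.
Qed.

Lemma same_structure_trans P Q T :
  same_structure P Q -> same_structure Q T -> same_structure P T.
Proof.
move=> PQ QT i h p pi ph; have [j pj] := udom_cover Q p.
have [B uB cB] := PQ i j p pi pj; have [C uC cC] := QT j h p pj ph.
exists (C *m B); first by rewrite unitmx_mul uC.
by apply: filterS2 cB cC => q; exact: proj_actM.
Qed.

Variable L : line_bundle N.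

(* The pairing phi_q : L_q x chi(q) -> R is an isomorphism of L_q with
   O(1)_chi(q), the dual of the line chi(q); u_r is the section of L
   corresponding to the coordinate x_r. As the x_r generate O(1), smoothness
   of phi amounts to smoothness of the u_r. *)
Definition O1_coordinates (W : set N) (chi : N -> RP R l)
    (u : 'I_l.+1 -> section L) : Prop :=
  exists phi : forall q : N, L q -> 'cV[R]_l.+1 -> R,
    (forall q, W q ->
      [/\ forall a v v' w, line (chi q) w ->
            phi q (a *: v + v') w = a * phi q v w + phi q v' w,
          forall a v w w', line (chi q) w -> line (chi q) w' ->
            phi q v (a *: w + w') = a * phi q v w + phi q v w',
          forall v w, v != 0 -> line (chi q) w -> w != 0 -> phi q v w != 0
        & forall r w, line (chi q) w -> phi q (u r q) w = w r 0]) /\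
    forall r, smooth_sec W (u r).

(* x r is the coordinate x_r seen as a section of L, via a local isomorphism
   of L with the pullback of O(1). *)
Definition locally_generated (S : set (J1_total L)) (P : Zprojective) : Prop :=
  forall (i : ix P) p, udom i p ->
    exists (W : set N) (x : 'I_l.+1 -> section L),
      [/\ open W, W p, W `<=` udom i, O1_coordinates W (umap i) x
        & forall q, W q -> jet_fiber S q = Zspan (fun r => j1 q (x r))].

End ProjectiveStructures.

(* Main.v *)
(** A lattice is locally spanned by the jets of sections u_0, ..., u_l of L, which are
    unique up to a constant matrix in GL(l+1;Z); the maps [u_0 : ... : u_l] are the charts
    of the corresponding structure. Indeed, where u_r does not vanish, exactness of the
    jet sequence says that the ratios u_s / u_r have no derivative along the leaves and
    that their transversal Jacobian is invertible.

    If two lattices have the same structure, their local frames differ by a matrix in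
    GL(l+1;Z), a sign and a positive function g. This g is unique, hence global: a positive
    factor h preserving a lattice acts on it by an integral matrix h + x y with y x = 0, so
    that h^(l+1) is its determinant, which is 1 up to sign.

    Conversely, lift the charts of a structure to frames of L. On overlaps two lifts differ
    by a matrix in GL(l+1;Z) and a function; the absolute values of these functions form a
    positive cocycle, which a partition of unity trivializes. The rescaled lifts then agree
    up to GL(l+1;Z), and their jets span a lattice. *)
Require Import Defs.
From HB Require Import structures.
From mathcomp Require Import all_boot all_order all_algebra.
From mathcomp Require Import all_classical all_reals all_analysis.
From mathcomp Require Import ring lra.
Set Implicit Arguments.
Unset Strict Implicit.
Unset Printing Implicit Defensive.
Import Order.TTheory GRing.Theory Num.Theory numFieldNormedType.Exports.
Local Open Scope classical_set_scope.
Local Open Scope ring_scope.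

(** * Smooth functions on open sets of R^n *)

(** Coefficients of sections in a lattice are locally constant because its sheets are uniformly
    separated: if M is the matrix of a frame in jet coordinates and M G = 1 at a point, then
    [|v| <= 2 * |v M G|] at nearby points too, and a nonzero integer row v has norm at least 1. The
    same inequality, applied to a mean value matrix, gives the injectivity of projective charts on
    transversals; that is what matters, as defining the foliation means that level sets are plaques.

    The line bundle L is fixed in advance and need not be the one glued from the pullbacks of O(1)
    along the cocycle of a structure. Signs may distinguish the two even after positive factors are
    removed. They do no harm: -1 preserves every Z-span, so only absolute values have to form a
    coboundary, and every structure is realized on every L. For the same reason the factor comparing
    two lattices can be taken positive, which is what makes it unique.

    The passage from lattices to structures is a choice. The statements are therefore proved for the
    relation [adapted] between a lattice and a structure. *)

Section Calculus.
Variables (R : realType) (n : nat).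
Implicit Types (U V : set 'rV[R]_n) (f g : 'rV[R]_n -> R) (y : 'rV[R]_n).

Lemma partialE j f y : differentiable f y -> partial j f y = 'd f y (delta_mx 0 j).
Proof. exact: deriveE. Qed.

Lemma diff_partial f y v : differentiable f y ->
  'd f y v = \sum_j v 0 j * partial j f y.
Proof.
move=> df; rewrite {1}[v]row_sum_delta linear_sum; apply: eq_bigr => j _.
by rewrite linearZ partialE.
Qed.

Lemma smoothP U f : smooth U f <->
  (forall y, U y -> differentiable f y) /\ forall j, smooth U (partial j f).
Proof.
split=> [Sf|[df Sf] [|k]]; last by split=> // j; exact: Sf.
  by split=> [|j k]; [case: (Sf 1%N)|case: (Sf k.+1) => _; exact].
by move=> y Uy; apply: differentiable_continuous; exact: df.
Qed.

Lemma smooth_differentiable U f y : smooth U f -> U y -> differentiable f y.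
Proof. by move=> /smoothP[+ _]; exact. Qed.

Lemma smooth_partial U f j : smooth U f -> smooth U (partial j f).
Proof. by move=> /smoothP[]. Qed.

Lemma smooth_continuous U f y : smooth U f -> U y -> {for y, continuous f}.
Proof. by move=> Sf Uy; exact: (Sf 0%N). Qed.

Lemma Ck_leS k U f : Ck k.+1 U f -> Ck k U f.
Proof.
elim: k f => [|k IH] f [df Cf].
  by move=> y Uy; apply: differentiable_continuous; exact: df.
by split=> // j; apply: IH; exact: Cf.
Qed.

Lemma smooth_local U f :
  (forall y, U y -> exists2 V, V y & smooth V f) -> smooth U f.
Proof.
move=> H k; have {}H y : U y -> exists2 V, V y & Ck k V f.
  by move=> /H[V Vy Sf]; exists V => //; exact: Sf.
elim: k f H => [|k IH] f H /=; first by move=> y /H[V Vy]; exact.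
split=> [y /H[V Vy [+ _]]|j]; first exact.
by apply: IH => y /H[V Vy [_ /(_ j) ?]]; exists V.
Qed.

Lemma smooth_ext U f g : open U -> (forall y, U y -> f y = g y) ->
  smooth U f -> smooth U g.
Proof. by move=> oU fg Sf k; apply: Ck_ext (Sf k). Qed.

Lemma smooth_cst U (a : R) : smooth U (fun=> a).
Proof.
apply/smoothP; split=> [y _|j]; first exact: differentiable_cst.
have -> : partial j (fun=> a) = (fun=> 0); last exact: smooth0.
by apply/funext => y; exact: derive_cst.
Qed.

Lemma smoothD U f g : open U -> smooth U f -> smooth U g ->
  smooth U (fun y => f y + g y).
Proof.
move=> oU Sf Sg; apply: smooth_ext (smooth_lin 1 oU Sf Sg) => // y _.
by rewrite mul1r.
Qed.

Lemma smooth_sum U (I : Type) (r : seq I) (P : pred I) (F : I -> 'rV[R]_n -> R) :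
  open U -> (forall i, P i -> smooth U (F i)) ->
  smooth U (fun y => \sum_(i <- r | P i) F i y).
Proof.
move=> oU SF; elim: r => [|i r IH].
  by apply: smooth_ext (@smooth0 R n U) => // y _; rewrite big_nil.
case Pi: (P i).
  by apply: smooth_ext (smoothD oU (SF i Pi) IH) => // y _; rewrite big_cons Pi.
by apply: smooth_ext IH => // y _; rewrite big_cons Pi.
Qed.

Lemma partialM j f g y : differentiable f y -> differentiable g y ->
  partial j (fun z => f z * g z) y = f y * partial j g y + g y * partial j f y.
Proof. by move=> df dg; rewrite /partial [LHS]deriveM //; exact: diff_derivable. Qed.

Lemma CkM k U f g : open U -> Ck k U f -> Ck k U g -> Ck k U (fun y => f y * g y).
Proof.
move=> oU; elim: k f g => [|k IH] f g Cf Cg.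
  by move=> y Uy; exact: (continuousM (Cf y Uy) (Cg y Uy)).
have [[df Cdf] [dg Cdg]] := (Cf, Cg).
split=> [y Uy|j]; first by apply: differentiableM; [exact: df|exact: dg].
have C1 := IH _ _ (Ck_leS Cf) (Cdg j); have C2 := IH _ _ (Ck_leS Cg) (Cdf j).
apply: Ck_ext (Ck_lin 1 oU C1 C2) => // y Uy.
by rewrite mul1r partialM //; [exact: df|exact: dg].
Qed.

Lemma smoothM U f g : open U -> smooth U f -> smooth U g ->
  smooth U (fun y => f y * g y).
Proof. by move=> oU Sf Sg k; apply: CkM. Qed.

Lemma smoothN U f : open U -> smooth U f -> smooth U (fun y => - f y).
Proof.
move=> oU Sf; apply: smooth_ext (smoothM oU (smooth_cst U (-1)) Sf) => // y _.
by rewrite mulN1r.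
Qed.

Lemma smooth_prod U (I : Type) (r : seq I) (P : pred I) (F : I -> 'rV[R]_n -> R) :
  open U -> (forall i, P i -> smooth U (F i)) ->
  smooth U (fun y => \prod_(i <- r | P i) F i y).
Proof.
move=> oU SF; elim: r => [|i r IH].
  by apply: smooth_ext (@smooth_cst U 1) => // y _; rewrite big_nil.
case Pi: (P i).
  by apply: smooth_ext (smoothM oU (SF i Pi) IH) => // y _; rewrite big_cons Pi.
by apply: smooth_ext IH => // y _; rewrite big_cons Pi.
Qed.

Lemma smooth_coord U i : smooth U (fun y => y 0 i).
Proof.
apply/smoothP; split=> [y _|j]; first exact: differentiable_coord.
have -> : partial j (fun y => y 0 i) = fun=> (delta_mx 0 j : 'rV[R]_n) 0 i.
  apply/funext => y; rewrite /partial.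
  have /derive_mx := @derivable_id R 'rV[R]_n y (delta_mx 0 j).
  by rewrite derive_id => /matrixP/(_ 0 i); rewrite [in RHS]mxE => ->.
exact: smooth_cst.
Qed.

(** [phi i] plays the i-th derivative of [phi 0]. The induction treats all i at once, since a
    partial derivative of [phi i \o f] involves [phi i.+1]. *)
Lemma smooth_comp1 U f (D : set R) (phi : nat -> R -> R) : open U ->
  (forall i x, D x -> is_derive x 1 (phi i) (phi i.+1 x)) ->
  (forall y, U y -> D (f y)) -> smooth U f -> smooth U (fun y => phi 0%N (f y)).
Proof.
move=> oU Dphi UD Sf k.
suff H i : Ck k U (fun y => phi i (f y)) by exact: H.
elim: k i => [|k IH] i.
all: have dphi y : U y -> differentiable (phi i) (f y).
all: try by move=> /UD Dy; apply/derivable1_diffP; have [] := Dphi i _ Dy.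
  move=> y Uy; apply: continuous_comp; first exact: smooth_continuous Uy.
  exact: differentiable_continuous (dphi _ Uy).
have dphif y : U y -> differentiable (phi i \o f) y.
  by move=> Uy; apply: differentiable_comp (dphi _ Uy); exact: smooth_differentiable Uy.
split=> // j.
have C := CkM oU (IH i.+1) (smooth_partial j Sf k).
apply: Ck_ext C => // y Uy.
rewrite [RHS](partialE j (dphif y Uy)) diff_comp; last exact: dphi.
  rewrite /= -partialE; last exact: smooth_differentiable Uy.
  have [dv <-] := Dphi i _ (UD _ Uy).
  rewrite diff1E; last exact: dphi.
  by rewrite /= mulrC derive1E.
exact: smooth_differentiable Uy.
Qed.
End Calculus.

(** * Quotients, compositions and mean values *)

Section Composition.
Variable R : realType.

(** A partial derivative of 1/f is (1/f)(1/f)(- partial f), so one more order of regularity of 1/f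
    follows from the previous order of 1/f itself. *)
Lemma smoothV n (U : set 'rV[R]_n) f : open U -> (forall y, U y -> f y != 0) ->
  smooth U f -> smooth U (fun y => (f y)^-1).
Proof.
move=> oU f0 Sf; elim=> [|k IH].
  by move=> y Uy; apply: continuousV; [exact: f0|exact: smooth_continuous Uy].
split=> [y Uy|j].
  by apply: differentiableV; [exact: smooth_differentiable Uy|exact: f0].
have C := CkM oU (CkM oU IH IH) (smooth_partial j (smoothN oU Sf) k).
apply: Ck_ext C => // y Uy.
have df := smooth_differentiable Sf Uy.
rewrite {2}/partial [RHS]deriveV; [|exact: f0|exact: diff_derivable].
have -> : partial j (fun y => - f y) y = - partial j f y.
  by rewrite /partial; apply: deriveN; exact: diff_derivable.
by rewrite -exprVn /= expr2 mulrN scaleNr.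
Qed.

Lemma Ck_sum n (U : set 'rV[R]_n) k (I : Type) (r : seq I) (F : I -> 'rV[R]_n -> R) :
  open U -> (forall i, Ck k U (F i)) -> Ck k U (fun y => \sum_(i <- r) F i y).
Proof.
move=> oU CF; elim: r => [|i r IH].
  by apply: Ck_ext (@smooth0 R n U k) => // y _; rewrite big_nil.
by apply: Ck_ext (Ck_lin 1 oU (CF i) IH) => // y _; rewrite big_cons mul1r.
Qed.

Lemma differentiable_row m n (F : 'rV[R]_n -> 'rV[R]_m) y :
  (forall i, differentiable (fun y => F y 0 i) y) -> differentiable F y.
Proof.
move=> dF; have -> : F = \sum_i (fun y => F y 0 i *: (delta_mx 0 i : 'rV[R]_m)).
  by apply/funext => z; rewrite fct_sumE -row_sum_delta.
by apply: differentiable_sum => i; apply: differentiableZl.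
Qed.

Lemma partial_comp m n j (F : 'rV[R]_n -> 'rV[R]_m) (H : 'rV[R]_m -> R) y :
  (forall i, differentiable (fun y => F y 0 i) y) -> differentiable H (F y) ->
  partial j (H \o F) y = \sum_i partial j (fun y => F y 0 i) y * partial i H (F y).
Proof.
move=> dF dH; have dFy := differentiable_row dF.
rewrite partialE; last exact: differentiable_comp.
rewrite diff_comp //= diff_partial //; apply: eq_bigr => i _; congr (_ * _).
by rewrite -deriveE // derive_mx ?mxE //; exact: diff_derivable.
Qed.

Lemma smooth_comp m n (U : set 'rV[R]_n) (V : set 'rV[R]_m)
    (F : 'rV[R]_n -> 'rV[R]_m) (H : 'rV[R]_m -> R) :
  open U -> (forall i, smooth U (fun y => F y 0 i)) ->
  (forall y, U y -> V (F y)) -> smooth V H -> smooth U (H \o F).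
Proof.
move=> oU SF UV SH k; elim: k H SH => [|k IH] H SH.
all: have dF y : U y -> forall i, differentiable (fun y => F y 0 i) y.
all: try by move=> Uy i; exact: (smooth_differentiable (SF i) Uy).
all: have dH y : U y -> differentiable H (F y).
all: try by move=> /UV; exact: smooth_differentiable.
all: have dHF y : U y -> differentiable (H \o F) y.
all: try by move=> Uy; apply: differentiable_comp;
  [exact/differentiable_row/dF|exact: dH].
  by move=> y Uy; apply: differentiable_continuous; exact: dHF.
split=> [|j]; first exact: dHF.
have C : Ck k U (fun y => \sum_i partial j (fun y => F y 0 i) y * partial i H (F y)).
  apply: Ck_sum => // i; apply: CkM => //; first exact: (smooth_partial j (SF i) k).
  exact: IH (smooth_partial i SH).
by apply: Ck_ext C => // y Uy; rewrite partial_comp //; [exact: dF|exact: dH].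
Qed.

Lemma smooth_continuous_row m n (U : set 'rV[R]_n) (F : 'rV[R]_n -> 'rV[R]_m) y :
  (forall i, smooth U (fun y => F y 0 i)) -> U y -> {for y, continuous F}.
Proof.
move=> SF Uy; apply: differentiable_continuous; apply: differentiable_row => i.
exact: (smooth_differentiable (SF i) Uy).
Qed.

Lemma open_preim m n (U : set 'rV[R]_n) (V : set 'rV[R]_m) (F : 'rV[R]_n -> 'rV[R]_m) :
  open U -> (forall i, smooth U (fun y => F y 0 i)) -> open V ->
  open (U `&` F @^-1` V).
Proof.
move=> oU SF oV; rewrite openE => y [Uy VFy].
apply: filterI; first exact: open_nbhs_nbhs.
by apply: (smooth_continuous_row SF Uy); exact: open_nbhs_nbhs.
Qed.

Lemma partial_affine n j (a : R) (b w : 'I_n -> R) (y : 'rV[R]_n) :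
  partial j (fun y : 'rV[R]_n => a + \sum_i (y 0 i - b i) * w i) y = w j.
Proof.
apply/cvg_lim => //; apply: cvg_near_cst; near=> h.
have h0 : h != 0 by near: h; exact: nbhs_dnbhs_neq.
rewrite /=; have -> : \sum_i ((h *: delta_mx 0 j + y : 'rV[R]_n) 0 i - b i) * w i =
    \sum_i (y 0 i - b i) * w i + h * w j.
  transitivity (\sum_i ((y 0 i - b i) * w i + h * (i == j)%:R * w i)).
    by apply: eq_bigr => i _; rewrite !mxE /=; ring.
  rewrite big_split /=; congr (_ + _).
  rewrite (bigD1 j) //= eqxx mulr1 big1 ?addr0 // => i /negbTE ->.
  by rewrite mulr0 mul0r.
by rewrite addrA [X in X - _]addrC addrK /GRing.scale /= mulrA mulVf // mul1r.
Unshelve. all: by end_near. Qed.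

Lemma mean_value n (f : 'rV[R]_n -> R) (y y' : 'rV[R]_n) :
  (forall t : R, 0 <= t <= 1 -> differentiable f (y + t *: (y' - y))) ->
  exists2 t : R, 0 <= t <= 1 &
    f y' - f y = \sum_j (y' - y) 0 j * partial j f (y + t *: (y' - y)).
Proof.
move=> df; pose v : 'rV[R]_n := y' - y; pose g (t : R) : 'rV[R]_n := y + t *: v.
have dg (t : R) : is_derive t (1 : R) g v.
  have -> : g = cst y + (fun t => t *: v) by [].
  have dZ : is_derive t (1 : R) ( *:%R^~ v) v.
    have dt := @is_diff_scalel R _ t v.
    have df' : differentiable ( *:%R^~ v : R -> 'rV[R]_n) t by case: dt.
    by split; [exact: diff_derivable|rewrite deriveE // diff_val scale1r].
  by have := is_deriveD (is_derive_cst y t (1 : R)) dZ; rewrite add0r.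
have dfg (t : R) : 0 <= t <= 1 -> is_derive t (1 : R) (f \o g) (\sum_j v 0 j * partial j f (g t)).
  move=> t01; have dt : differentiable g t by apply/derivable1_diffP; case: (dg t).
  have dfg : differentiable (f \o g) t by apply: differentiable_comp => //; exact: df.
  split; first exact: diff_derivable.
  have dgt : 'd g t 1 = v by rewrite -deriveE //; case: (dg t).
  by rewrite deriveE // diff_comp //= ?dgt ?diff_partial //; exact: df.
have [||t t01 E] := @MVT_segment R (f \o g) (fun t => \sum_j v 0 j * partial j f (g t)) 0 1 ler01.
- by move=> t; rewrite in_itv/= => /andP[t0 t1]; apply: dfg; rewrite !ltW.
- apply: derivable_within_continuous => t; rewrite in_itv/= => t01.
  by case: (dfg t t01).
- exists t; first by move: t01; rewrite in_itv.
  move: E; rewrite subr0 mulr1 /= /g scale1r scale0r addr0 => <-.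
  by rewrite [y + v]addrC subrK.
Qed.

Lemma rV_norm_le n (v : 'rV[R]_n) r : 0 <= r -> (forall j, `|v 0 j| <= r) -> `|v| <= r.
Proof.
move=> r0 vr; rewrite /Num.norm/= mx_normrE; apply: bigmax_le => // -[i j] _ /=.
by rewrite (ord1 i).
Qed.

Lemma rV_coord_le n (v : 'rV[R]_n) j : `|v 0 j| <= `|v|.
Proof.
by rewrite [leRHS]/Num.norm/= mx_normrE; apply: (le_bigmax _ _ (0, j)).
Qed.

(** Since A G = 1, v = v B G + v (A - B) G, and the last term is at most |v| / 2 when B is entrywise
    close to A. The bound is uniform in B, so B may have its entries taken at different points. *)
Lemma row_free_perturb m n (A : 'M[R]_(m, n)) (G : 'M[R]_(n, m)) : A *m G = 1%:M ->
  exists2 e : R, 0 < e & forall B : 'M[R]_(m, n),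
    (forall i j, `|A i j - B i j| < e) ->
    forall v : 'rV[R]_m, `|v| <= 2 * `|v *m B *m G|.
Proof.
move=> AG; pose S : R := \sum_j \sum_k `|G j k|.
have S0 : 0 <= S by apply: sumr_ge0 => j _; exact: sumr_ge0.
(* This makes m e S less than 1/2; the added 1 keeps the divisor positive when m S = 0. *)
pose e := (2 * (1 + m%:R * S))^-1.
have d0 : 0 < 1 + m%:R * S by rewrite ltr_wpDr // mulr_ge0.
have e0 : 0 < e by rewrite invr_gt0 mulr_gt0.
exists e => // B ABe v.
have -> : v *m B *m G = v - v *m ((A - B) *m G).
  by rewrite mulmxBl AG mulmxBr mulmx1 opprB addrC subrK mulmxA.
have E i k : `|((A - B) *m G) i k| <= e * S.
  rewrite mxE (le_trans (ler_norm_sum _ _ _))// /S mulr_sumr; apply: ler_sum => j _.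
  rewrite normrM !mxE ler_pM ?(ltW (ABe _ _)) // (bigD1 k) //= lerDl.
  exact: sumr_ge0.
have vE : `|v *m ((A - B) *m G)| <= 2^-1 * `|v|.
  apply: rV_norm_le => [|k]; first by rewrite mulr_ge0 ?invr_ge0.
  rewrite mxE (le_trans (ler_norm_sum _ _ _))//.
  apply: (@le_trans _ _ (\sum_(i < m) `|v| * (e * S))).
    by apply: ler_sum => i _; rewrite normrM ler_pM // rV_coord_le.
  rewrite sumr_const card_ord [leRHS]mulrC -mulrnAr ler_wpM2l // -mulr_natr.
  have : e * (2 * (1 + m%:R * S)) = 1 by rewrite mulVf // gt_eqF // mulr_gt0.
  by move: e0; lra.
have := lerB_dist v (v *m ((A - B) *m G)); lra.
Qed.

End Composition.

(** * Bump functions *)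

Section Bump.
Variable R : realType.

(** With s = 1/x, the derivative in x of P(s) exp(-s) is s^2 (P(s) - P'(s)) exp(-s), whence the
    recursion. *)
Fixpoint flat_poly (i : nat) : {poly R} :=
  if i is i'.+1 then 'X^2 * (flat_poly i' - (flat_poly i')^`()) else 1.

(* [flat i] is the i-th derivative of the function exp(-1/x) extended by 0. *)
Definition flat (i : nat) (x : R) : R :=
  if 0 < x then (flat_poly i).[x^-1] * expR (- x^-1) else 0.

(** The decay needed at 0: for s = 1/h it gives [flat i h] = O(h^2), so the difference quotients of
    [flat i] at 0 tend to 0. *)
Lemma horner_expR_bound (Q : {poly R}) : exists2 C, 0 <= C &
  forall s, 1 <= s -> `|Q.[s]| * expR (- s) <= C / s ^+ 2.
Proof.
pose d := size Q; pose A : R := \sum_(i < d) `|Q`_i|.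
have A0 : 0 <= A by exact: sumr_ge0.
exists (A * (d.+2)`!%:R) => [|s s1]; first by rewrite mulr_ge0.
have s0 : 0 < s by exact: lt_le_trans s1.
have Qs : `|Q.[s]| <= A * s ^+ d.
  rewrite horner_coef (le_trans (ler_norm_sum _ _ _))// /A mulr_suml.
  apply: ler_sum => i _; rewrite normrM ler_wpM2l // normrX (ger0_norm (ltW s0)).
  by apply: ler_weXn2l => //; exact: ltnW (ltn_ord i).
(* One term of the exponential series bounds exp s from below; two powers beyond d leave the factor
   1/s^2. *)
have es : expR (- s) <= (d.+2)`!%:R / s ^+ d.+2.
  rewrite expRN -[leRHS]invrK lef_pV2 ?posrE ?expR_gt0 //; last first.
    by rewrite invr_gt0 divr_gt0 ?exprn_gt0 // ltr0n fact_gt0.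
  rewrite invf_div; apply: le_trans (expR_ge1Dxn d.+1 (ltW s0)).
  by rewrite lerDr.
apply: (@le_trans _ _ (A * s ^+ d * ((d.+2)`!%:R / s ^+ d.+2))).
  by rewrite ler_pM // expR_ge0.
rewrite -addn2 exprD invfM; set F := _%:R.
have sd : s ^+ d != 0 by rewrite expf_neq0 // gt_eqF.
have s2 : s ^+ 2 != 0 by rewrite expf_neq0 // gt_eqF.
by rewrite le_eqVlt; apply/orP; left; apply/eqP; field; rewrite gt_eqF.
Qed.

Lemma is_derive_flat i (x : R) : is_derive x 1 (flat i) (flat i.+1 x).
Proof.
have [x0|x0|->] := ltgtP x 0.
- have -> : flat i.+1 x = 0 by rewrite /flat ltNge (ltW x0).
  apply: (@near_eq_is_derive R R R (cst 0)).
  near=> y; rewrite /flat ltNge ifF //; apply/negbTE; rewrite negbK ltW //.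
  by near: y; exact: lt_nbhsl.
- have xn0 : x != 0 by rewrite gt_eqF.
  have dV : is_derive x (1 : R) (fun y : R => y^-1) (- x ^- 2).
    split; first by apply: derivableV => //; exact: derivable_id.
    by rewrite (@deriveV _ _ id) // derive_id [LHS]mulr1.
  have dP : is_derive x (1 : R) (fun y => (flat_poly i).[y^-1])
      ((flat_poly i)^`().[x^-1] * (- x ^- 2)).
    exact: (@is_derive1_comp _ (horner (flat_poly i)) (fun y : R => y^-1)).
  have dE : is_derive x (1 : R) (fun y => expR (- y^-1)) (expR (- x^-1) * x ^- 2).
    have dN : is_derive x (1 : R) (fun y : R => - y^-1) (x ^- 2).
      by have := is_deriveN dV; rewrite opprK.
    exact: (@is_derive1_comp _ expR (fun y : R => - y^-1)).
  have dM := is_deriveM dP dE; apply: near_eq_is_derive (is_derive_eq dM _).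
    by near=> y; rewrite /flat ifT //; near: y; exact: lt_nbhsr.
  rewrite /flat x0 /= hornerM hornerD hornerN hornerXn /GRing.scale/=.
  by rewrite exprVn; ring.
- have -> : flat i.+1 0 = 0 by rewrite /flat ltxx.
  have [C C0 HC] := horner_expR_bound (flat_poly i).
  have cv : h^-1 *: (flat i (h *: 1 + 0) - flat i 0) @[h --> (0:R)^'] --> (0 : R).
    apply/cvgr0Pnorm_le => e e0; near=> h.
    have hn0 : h != 0 by near: h; exact: nbhs_dnbhs_neq.
    have h1 : `|h| < 1 by near: h; apply: dnbhs0_lt.
    have he : `|h| < e / (1 + C).
      by near: h; apply: dnbhs0_lt; rewrite divr_gt0 // ltr_wpDr.
    rewrite addr0 [h *: 1]mulr1 [in X in _ - X]/flat ltxx subr0.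
    rewrite /flat; case: ltP => [h0|_]; last by rewrite scaler0 normr0 ltW.
    rewrite normrM normrV ?unitfE // gtr0_norm // normrM [`|expR _|]ger0_norm ?expR_ge0 //.
    have H : `|(flat_poly i).[h^-1]| * expR (- h^-1) <= C / h^-1 ^+ 2.
      by apply: HC; rewrite invf_ge1 // ltW // -[ltLHS]gtr0_norm.
    rewrite mulrC ler_pdivrMr //; apply: le_trans H _.
    rewrite exprVn invrK expr2 mulrA ler_pM2r //.
    move: he; rewrite gtr0_norm // ltr_pdivlMr ?ltr_wpDr // => /ltW; apply: le_trans.
    by rewrite mulrDr mulr1 [C * h]mulrC lerDr ltW.
  by split; [apply/cvg_ex; exists 0|exact/cvg_lim].
Unshelve. all: by end_near. Qed.

Lemma flat_ge0 x : 0 <= flat 0 x.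
Proof. by rewrite /flat; case: ifP => // _; rewrite hornerE mul1r expR_ge0. Qed.

Lemma flat_gt0 x : 0 < x -> 0 < flat 0 x.
Proof. by rewrite /flat => ->; rewrite hornerE mul1r expR_gt0. Qed.

Lemma flat_le0 x : x <= 0 -> flat 0 x = 0.
Proof. by rewrite /flat leNgt => /negbTE ->. Qed.

Definition smoothstep (x : R) : R := flat 0 x / (flat 0 x + flat 0 (1 - x)).

Lemma smoothstep_denom_gt0 x : 0 < flat 0 x + flat 0 (1 - x).
Proof.
have [x0|x0] := ltP 0 x; first by rewrite ltr_pwDl ?flat_gt0 ?flat_ge0.
by rewrite ltr_wpDl ?flat_ge0 // flat_gt0 // subr_gt0 (le_lt_trans x0).
Qed.

Lemma smoothstep01 x : 0 <= smoothstep x <= 1.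
Proof.
have d0 := smoothstep_denom_gt0 x.
rewrite /smoothstep divr_ge0 ?flat_ge0 ?(ltW d0) //= ler_pdivrMr // mul1r lerDl.
exact: flat_ge0.
Qed.

Lemma smoothstep_le0 x : x <= 0 -> smoothstep x = 0.
Proof. by move=> x0; rewrite /smoothstep flat_le0 // mul0r. Qed.

Lemma smoothstep_ge1 x : 1 <= x -> smoothstep x = 1.
Proof.
move=> x1; have := smoothstep_denom_gt0 x; rewrite /smoothstep.
by rewrite [flat 0 (1 - x)]flat_le0 ?subr_le0 // addr0 => d0; rewrite divff // gt_eqF.
Qed.

Lemma smooth_smoothstep n (U : set 'rV[R]_n) f : open U -> smooth U f ->
  smooth U (fun y => smoothstep (f y)).
Proof.
move=> oU Sf.
have S g : smooth U g -> smooth U (fun y => flat 0 (g y)).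
  by move=> Sg; apply: (@smooth_comp1 _ _ _ _ setT flat) => // i x _; exact: is_derive_flat.
have S1 : smooth U (fun y => flat 0 (1 - f y)).
  by apply: S; apply: smoothD => //; [exact: smooth_cst|exact: smoothN].
apply: smoothM => //; first exact: S.
apply: smoothV => //; first by move=> y _; rewrite gt_eqF // smoothstep_denom_gt0.
by apply: smoothD => //; exact: S.
Qed.

Lemma smooth_bump n (a : 'rV[R]_n) (r : R) : 0 < r -> exists b : 'rV[R]_n -> R,
  [/\ smooth setT b, forall y, 0 <= b y <= 1,
      forall y, b y != 0 -> `|y - a| <= r
    & exists2 e, 0 < e & forall y, `|y - a| < e -> b y = 1].
Proof.
move=> r0; pose q (y : 'rV[R]_n) j : R := 2 - 2 * ((y 0 j - a 0 j) / r) ^+ 2.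
exists (fun y => \prod_j smoothstep (q y j)); split.
- apply: smooth_prod => [|j _]; first exact: openT.
  apply: smooth_smoothstep; first exact: openT.
  rewrite /q.
  have Sc : smooth setT (fun y : 'rV[R]_n => (y 0 j - a 0 j) / r).
    apply: smoothM; [exact: openT| |exact: smooth_cst].
    by apply: smoothD; [exact: openT|exact: smooth_coord|exact: smooth_cst].
  apply: smoothD; [exact: openT|exact: smooth_cst|].
  apply: smoothN; first exact: openT.
  apply: smoothM; [exact: openT|exact: smooth_cst|].
  by apply: smoothM; first exact: openT.
- move=> y; apply: (big_ind (fun x : R => 0 <= x <= 1)) => [|u v|j _].
  + by rewrite ler01 lexx.
  + move=> /andP[u0 u1] /andP[v0 v1]; rewrite mulr_ge0 //=.
    by rewrite -[1]mulr1 ler_pM.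
  + exact: smoothstep01.
- move=> y b0; apply: rV_norm_le => [|j]; first exact: ltW.
  rewrite leNgt; apply: contra b0 => yr; rewrite (bigD1 j) //= smoothstep_le0 ?mul0r //.
  rewrite /q subr_le0 ler_pMr // -real_normK ?num_real // exprn_ege1 //.
  move: yr; rewrite !mxE normrM normfV (gtr0_norm r0) ler_pdivlMr // mul1r.
  exact: ltW.
- exists (r / 2) => [|y yr]; first by rewrite divr_gt0.
  apply: big1 => j _; apply: smoothstep_ge1; rewrite /q.
  have : `|(y 0 j - a 0 j) / r| <= 2^-1.
    rewrite normrM normfV (gtr0_norm r0) ler_pdivrMr // mulrC.
    by have := rV_coord_le (y - a) j; rewrite !mxE => /le_trans; apply; exact: ltW.
  by set u := (_ / r); rewrite ler_norml => /andP[u1 u2]; nra.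
Qed.

End Bump.

(** * Smooth functions on a manifold *)

Section ChartCalculus.
Variable R : realType.

Lemma open_union_nbhd (T : topologicalType) (U : set T) :
  (forall x, U x -> exists V, [/\ open V, V x & V `<=` U]) -> open U.
Proof.
move=> H; rewrite openE => x /H[V [oV Vx VU]].
by apply: filterS VU _; exact: open_nbhs_nbhs.
Qed.

Lemma near_open (T : topologicalType) (p : T) (P : set T) : nbhs p P ->
  exists W, [/\ open W, W p & W `<=` P].
Proof. by rewrite nbhsE => -[W [oW Wp] WP]; exists W. Qed.

(** T carries no topology here, so that one calculus serves for N, for the total space of J^1 L and
    for R^m. Openness and smoothness are tested in the single chart c. *)
Definition chart_open T n (c : chart R T n) (U : set T) := open (c @` (cdom c `&` U)).

Definition chart_smooth T n (c : chart R T n) (U : set T) (f : T -> R) :=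
  smooth (c @` (cdom c `&` U)) (in_chart c f).

Definition chart_partial T n (c : chart R T n) (j : 'I_n) (f : T -> R) (p : T) : R :=
  partial j (in_chart c f) (c p).

Section OneChart.
Variables (T : Type) (n : nat) (c : chart R T n).
Hypothesis ci : set_inj (cdom c) c.
Implicit Types (U V : set T) (f g : T -> R).

Lemma in_chartE f x : cdom c x -> in_chart c f (c x) = f x.
Proof.
move=> cx; rewrite /in_chart /chart_inv; case: pselect => [ex|]; last by case; exists x.
by case: cid => z [cz /= czx]; rewrite (ci _ _ czx) ?inE.
Qed.

Lemma chart_smooth_from U f (F : 'rV[R]_n -> R) : chart_open c U ->
  smooth (c @` (cdom c `&` U)) F ->
  (forall x, cdom c x -> U x -> F (c x) = f x) -> chart_smooth c U f.
Proof.
move=> oU SF Ff; apply: smooth_ext SF => // _ [x [cx Ux] <-].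
by rewrite in_chartE // Ff.
Qed.

Lemma chart_smooth_ext U f g : chart_open c U ->
  (forall x, cdom c x -> U x -> f x = g x) -> chart_smooth c U f -> chart_smooth c U g.
Proof.
by move=> oU fg Sf; apply: chart_smooth_from Sf _ => // x cx Ux; rewrite in_chartE // fg.
Qed.

Lemma chart_smooth_subset U V f : (forall x, cdom c x -> U x -> V x) ->
  chart_smooth c V f -> chart_smooth c U f.
Proof.
move=> UV; apply: smooth_subset => _ [x [cx Ux] <-].
by exists x => //; split => //; exact: UV.
Qed.

Lemma chart_smooth_cst U (a : R) : chart_open c U -> chart_smooth c U (fun=> a).
Proof. by move=> oU; apply: (chart_smooth_from (F := fun=> a)) => //; exact: smooth_cst. Qed.

Lemma chart_smoothD U f g : chart_open c U -> chart_smooth c U f -> chart_smooth c U g ->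
  chart_smooth c U (fun x => f x + g x).
Proof.
move=> oU Sf Sg; apply: chart_smooth_from (smoothD oU Sf Sg) _ => // x cx _.
by rewrite !in_chartE.
Qed.

Lemma chart_smoothM U f g : chart_open c U -> chart_smooth c U f -> chart_smooth c U g ->
  chart_smooth c U (fun x => f x * g x).
Proof.
move=> oU Sf Sg; apply: chart_smooth_from (smoothM oU Sf Sg) _ => // x cx _.
by rewrite !in_chartE.
Qed.

Lemma chart_smoothN U f : chart_open c U -> chart_smooth c U f ->
  chart_smooth c U (fun x => - f x).
Proof.
move=> oU Sf; apply: chart_smooth_from (smoothN oU Sf) _ => // x cx _.
by rewrite !in_chartE.
Qed.

Lemma chart_smoothV U f : chart_open c U -> (forall x, U x -> f x != 0) ->
  chart_smooth c U f -> chart_smooth c U (fun x => (f x)^-1).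
Proof.
move=> oU f0 Sf; have V := smoothV oU _ Sf.
apply: chart_smooth_from (V _) _ => //; last by move=> x cx _; rewrite !in_chartE.
by move=> _ [x [cx Ux] <-]; rewrite in_chartE // f0.
Qed.

Lemma chart_smooth_sum U (I : Type) (r : seq I) (P : pred I) (F : I -> T -> R) :
  chart_open c U -> (forall i, P i -> chart_smooth c U (F i)) ->
  chart_smooth c U (fun x => \sum_(i <- r | P i) F i x).
Proof.
move=> oU SF; have S := smooth_sum r oU SF.
apply: chart_smooth_from S _ => // x cx _.
by apply: eq_bigr => i _; rewrite in_chartE.
Qed.

Lemma chart_smooth_prod U (I : Type) (r : seq I) (P : pred I) (F : I -> T -> R) :
  chart_open c U -> (forall i, P i -> chart_smooth c U (F i)) ->
  chart_smooth c U (fun x => \prod_(i <- r | P i) F i x).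
Proof.
move=> oU SF; have S := smooth_prod r oU SF.
apply: chart_smooth_from S _ => // x cx _.
by apply: eq_bigr => i _; rewrite in_chartE.
Qed.

Lemma chart_smooth_coord U i : chart_open c U -> chart_smooth c U (fun x => c x 0 i).
Proof.
by move=> oU; apply: (chart_smooth_from (F := fun y => y 0 i)) => //; exact: smooth_coord.
Qed.

Lemma chart_smooth_partial U j f : chart_open c U -> chart_smooth c U f ->
  chart_smooth c U (chart_partial c j f).
Proof. by move=> oU /(smooth_partial j) S; exact: chart_smooth_from S _. Qed.

Lemma chart_smooth_diff U f p : chart_smooth c U f -> cdom c p -> U p ->
  differentiable (in_chart c f) (c p).
Proof. by move=> Sf cp Up; apply: smooth_differentiable Sf _; exists p. Qed.

Lemma chart_partial_ext U j f g p : chart_open c U -> cdom c p -> U p ->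
  (forall x, cdom c x -> U x -> f x = g x) -> chart_partial c j f p = chart_partial c j g p.
Proof.
move=> oU cp Up fg; apply: near_eq_derive.
apply: filterS (open_nbhs_nbhs (conj oU _)); last by exists p.
by move=> _ [x [cx Ux] <-]; rewrite !in_chartE // fg.
Qed.

Lemma in_chartD f g : in_chart c (fun x => f x + g x) = in_chart c f \+ in_chart c g.
Proof. by apply/funext => y; rewrite /in_chart /=; case: chart_inv => //=; rewrite addr0. Qed.

Lemma in_chartM f g : in_chart c (fun x => f x * g x) = in_chart c f \* in_chart c g.
Proof. by apply/funext => y; rewrite /in_chart /=; case: chart_inv => //=; rewrite mulr0. Qed.

Lemma in_chartZ a f : in_chart c (fun x => a * f x) = (fun y => a * in_chart c f y).
Proof. by apply/funext => y; rewrite /in_chart /=; case: chart_inv => //=; rewrite mulr0. Qed.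

Lemma chart_partialM j f g p : cdom c p -> differentiable (in_chart c f) (c p) ->
  differentiable (in_chart c g) (c p) ->
  chart_partial c j (fun x => f x * g x) p =
  f p * chart_partial c j g p + g p * chart_partial c j f p.
Proof.
by move=> cp df dg; rewrite /chart_partial in_chartM partialM // !in_chartE.
Qed.

Lemma chart_partial_lin j a f g p : differentiable (in_chart c f) (c p) ->
  differentiable (in_chart c g) (c p) ->
  chart_partial c j (fun x => a * f x + g x) p =
  a * chart_partial c j f p + chart_partial c j g p.
Proof.
by move=> df dg; rewrite /chart_partial in_chartD in_chartZ partial_lin.
Qed.

End OneChart.

(** * Maps between charted spaces *)

Section TwoCharts.
Variables (T T' : Type) (n n' : nat) (c : chart R T n) (c' : chart R T' n').
Hypotheses (ci : set_inj (cdom c) c) (ci' : set_inj (cdom c') c').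
Variables (F : T -> T') (U : set T).
Hypotheses (oU : chart_open c U) (UF : forall x, cdom c x -> U x -> cdom c' (F x)).
Hypothesis SF : forall i, chart_smooth c U (fun x => c' (F x) 0 i).

Let G y : 'rV[R]_n' := \row_i in_chart c (fun x => c' (F x) 0 i) y.

Let GE x : cdom c x -> G (c x) = c' (F x).
Proof. by move=> cx; apply/rowP => i; rewrite mxE in_chartE. Qed.

Let SG i : smooth (c @` (cdom c `&` U)) (fun y => G y 0 i).
Proof. by apply: smooth_ext (SF i) => // y _; rewrite mxE. Qed.

Lemma chart_smooth_comp (V : set T') h : (forall x, cdom c x -> U x -> V (F x)) ->
  chart_smooth c' V h -> chart_smooth c U (h \o F).
Proof.
move=> UV Sh; have S := smooth_comp oU SG _ Sh.
apply: chart_smooth_from (S _) _ => //.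
  by move=> _ [x [cx Ux] <-]; rewrite GE //; exists (F x) => //; split; [exact: UF|exact: UV].
by move=> x cx Ux; rewrite /= GE // in_chartE //; exact: UF.
Qed.

Lemma chart_open_preim (V : set T') : chart_open c' V -> chart_open c (U `&` F @^-1` V).
Proof.
move=> oV; rewrite /chart_open.
have -> : c @` (cdom c `&` (U `&` F @^-1` V)) =
    c @` (cdom c `&` U) `&` G @^-1` (c' @` (cdom c' `&` V)).
  apply/seteqP; split=> [_ [x [cx [Ux VFx]] <-]|_ [[x [cx Ux] <-]]] /=.
    split; first by exists x.
    by rewrite GE //; exists (F x) => //; split => //; exact: UF.
  rewrite GE // => -[z [cz Vz] zF]; exists x => //; split => //; split => //=.
  by rewrite -(ci' _ _ zF) ?inE //; exact: UF.
exact: open_preim.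
Qed.

Lemma chart_partial_comp (V : set T') j h p : chart_open c' V -> cdom c p -> U p ->
  V (F p) -> chart_smooth c' V h ->
  chart_partial c j (h \o F) p =
  \sum_i chart_partial c j (fun x => c' (F x) 0 i) p * chart_partial c' i h (F p).
Proof.
move=> oV cp Up Vp Sh.
have -> : chart_partial c j (h \o F) p = partial j (in_chart c' h \o G) (c p).
  apply: near_eq_derive; apply: filterS (open_nbhs_nbhs (conj oU _)); last by exists p.
  by move=> _ [x [cx Ux] <-]; rewrite /= GE // !in_chartE //; exact: UF.
have img : (c @` (cdom c `&` U)) (c p) by exists p.
rewrite partial_comp ?GE //; first last.
- by apply: (chart_smooth_diff Sh) => //; exact: UF.
- by move=> i; exact: (smooth_differentiable (SG i)).
apply: eq_bigr => i _; congr (_ * _); congr ('D_ _ _ _).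
by apply/funext => y; rewrite mxE.
Qed.

End TwoCharts.
End ChartCalculus.

(** * Smoothness tested in charts of the maximal atlas *)

Section ManifoldFunctions.
Variables (R : realType) (n : nat) (N : manifold R n).
Local Notation maximal := (in_maximal_atlas (charts N)).
Local Notation sm := (smooth_on (charts N)).
Implicit Types (U V : set N) (f g : N -> R) (c : chart R N n).

Lemma chart_maximal c : charts N c -> maximal c.
Proof.
move=> Ac; split; first exact: charts_inj.
  by apply/(charts_homeo Ac (@subset_refl _ _)); exact: charts_open.
by move=> a Aa; split; exact: charts_smooth.
Qed.

Lemma atlas_openP U : atlas_open (charts N) U <-> open U.
Proof.
split=> [oU|oU c Ac]; last exact: image_chart_open.
apply: open_union_nbhd => p Up; have [c Ac cp] := charts_cover p.
exists (cdom c `&` U); split=> //.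
by apply/(charts_homeo Ac (@subIsetl _ _ _)); exact: oU.
Qed.

Section Maximal.
Variable c : chart R N n.
Hypothesis mc : maximal c.

Lemma maximal_inj : set_inj (cdom c) c. Proof. by case: mc. Qed.
Local Notation ci := maximal_inj.

Lemma maximal_dom_open : open (cdom c).
Proof.
case: mc => _ _ tc; apply/atlas_openP => a Aa.
by have [[]] := tc a Aa.
Qed.

Lemma maximal_chart_open U : open U -> chart_open c U.
Proof.
move=> oU; apply: open_union_nbhd => _ [p [cp Up] <-].
have [a Aa ap] := charts_cover p; have [_ [oca Sca]] : transition_smooth a c /\ transition_smooth c a.
  by case: mc => _ _; exact.
exists (c @` (cdom c `&` (cdom a `&` U))); split.
- have := @chart_open_preim R _ _ _ _ c a ci (charts_inj Aa) id (cdom a) oca _ Sca U.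
  apply; first by [].
  exact: image_chart_open.
- by exists p.
- by move=> _ [x [cx [_ Ux]] <-]; exists x.
Qed.

Lemma smooth_on_chart U f : open U -> sm U f -> chart_smooth c U f.
Proof.
move=> oU Sf; apply: smooth_local => _ [p [cp Up] <-].
have [a Aa ap] := charts_cover p; have [_ [oca Sca]] : transition_smooth a c /\ transition_smooth c a.
  by case: mc => _ _; exact.
have oUa : open (U `&` cdom a) by apply: openI => //; exact: charts_open.
exists (c @` (cdom c `&` (U `&` cdom a))); first by exists p.
apply: (@chart_smooth_comp R _ _ _ _ c a ci (charts_inj Aa) id _ _ _ _ U) => //.
- exact: maximal_chart_open.
- by move=> x _ [].
- by move=> i; apply: chart_smooth_subset (Sca i) => x _ [].
- by move=> x _ [].
- exact: Sf.
Qed.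

Lemma chart_smooth_on U f : open U -> U `<=` cdom c -> chart_smooth c U f -> sm U f.
Proof.
move=> oU Uc Sf a Aa.
have [[oac Sac] _] : transition_smooth a c /\ transition_smooth c a by case: mc => _ _; exact.
apply: (@chart_smooth_comp R _ _ _ _ a c (charts_inj Aa) ci id _ _ _ _ U) => //.
- exact: image_chart_open.
- by move=> x _ /Uc.
- by move=> i; apply: chart_smooth_subset (Sac i) => x _ /Uc.
Qed.

Lemma smooth_on_coord i : sm (cdom c) (fun x => c x 0 i).
Proof.
apply: chart_smooth_on => //; first exact: maximal_dom_open.
by apply: chart_smooth_coord; [exact: ci|apply: maximal_chart_open; exact: maximal_dom_open].
Qed.

Lemma smooth_on_partial U j f : open U -> sm U f -> sm (U `&` cdom c) (chart_partial c j f).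
Proof.
move=> oU Sf; have oV : open (U `&` cdom c) by apply: openI => //; exact: maximal_dom_open.
apply: chart_smooth_on => //; apply: chart_smooth_partial; first exact: ci.
  exact: maximal_chart_open.
apply: chart_smooth_subset (smooth_on_chart oU Sf).
by move=> x _ [].
Qed.

Lemma smooth_on_diff U f p : open U -> sm U f -> U p -> cdom c p ->
  differentiable (in_chart c f) (c p).
Proof. by move=> oU Sf Up cp; exact: chart_smooth_diff (smooth_on_chart oU Sf) cp Up. Qed.

End Maximal.

Lemma maximal_partial_change c c' U j f p : maximal c -> maximal c' -> open U ->
  sm U f -> U p -> cdom c p -> cdom c' p ->
  chart_partial c j f p =
  \sum_i chart_partial c j (fun x => c' x 0 i) p * chart_partial c' i f p.
Proof.
move=> mc mc' oU Sf Up cp c'p.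
have oV : open (U `&` cdom c') by apply: openI => //; exact: maximal_dom_open.
apply: (@chart_partial_comp R _ _ _ _ c c' (maximal_inj mc) (maximal_inj mc')
  id (U `&` cdom c') _ _ _ U j f p) => //.
- exact: maximal_chart_open.
- by move=> x _ [].
- move=> i; apply: chart_smooth_subset (smooth_on_chart mc (maximal_dom_open mc')
    (smooth_on_coord mc' i)).
  by move=> x _ [].
- exact: maximal_chart_open.
- exact: smooth_on_chart.
Qed.

Lemma smooth_on_local U f :
  (forall p, U p -> exists2 V, V p & sm V f) -> sm U f.
Proof.
move=> H c Ac; apply: smooth_local => _ [p [cp Up] <-].
have [V Vp Sf] := H p Up.
by exists (c @` (cdom c `&` V)); [exists p|exact: Sf].
Qed.

Lemma smooth_on_subset U V f : U `<=` V -> sm V f -> sm U f.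
Proof. by move=> UV Sf c Ac; apply: chart_smooth_subset (Sf c Ac) => x _ /UV. Qed.

Section Open.
Variables (U : set N).
Hypothesis oU : open U.
Let oc c : charts N c -> chart_open c U. Proof. by move=> Ac; exact: image_chart_open. Qed.

Lemma smooth_on_ext f g : (forall x, U x -> f x = g x) -> sm U f -> sm U g.
Proof.
move=> fg Sf c Ac; apply: chart_smooth_ext (Sf c Ac); [exact: charts_inj|exact: oc|].
by move=> x _; exact: fg.
Qed.

Lemma smooth_on_cst (a : R) : sm U (fun=> a).
Proof. by move=> c Ac; apply: chart_smooth_cst; [exact: charts_inj|exact: oc]. Qed.

Lemma smooth_onD f g : sm U f -> sm U g -> sm U (fun x => f x + g x).
Proof.
by move=> Sf Sg c Ac; apply: chart_smoothD;
  [exact: charts_inj|exact: oc|exact: Sf|exact: Sg].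
Qed.

Lemma smooth_onM f g : sm U f -> sm U g -> sm U (fun x => f x * g x).
Proof.
by move=> Sf Sg c Ac; apply: chart_smoothM;
  [exact: charts_inj|exact: oc|exact: Sf|exact: Sg].
Qed.

Lemma smooth_onN f : sm U f -> sm U (fun x => - f x).
Proof.
by move=> Sf c Ac; apply: chart_smoothN; [exact: charts_inj|exact: oc|exact: Sf].
Qed.

Lemma smooth_onV f : (forall x, U x -> f x != 0) -> sm U f -> sm U (fun x => (f x)^-1).
Proof.
by move=> f0 Sf c Ac; apply: chart_smoothV;
  [exact: charts_inj|exact: oc|exact: f0|exact: Sf].
Qed.

Lemma smooth_on_sum (I : Type) (r : seq I) (P : pred I) (F : I -> N -> R) :
  (forall i, P i -> sm U (F i)) -> sm U (fun x => \sum_(i <- r | P i) F i x).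
Proof.
move=> SF c Ac; apply: chart_smooth_sum; [exact: charts_inj|exact: oc|].
by move=> i Pi; exact: SF.
Qed.

Lemma smooth_on_prod (I : Type) (r : seq I) (P : pred I) (F : I -> N -> R) :
  (forall i, P i -> sm U (F i)) -> sm U (fun x => \prod_(i <- r | P i) F i x).
Proof.
move=> SF c Ac; apply: chart_smooth_prod; [exact: charts_inj|exact: oc|].
by move=> i Pi; exact: SF.
Qed.

End Open.

Lemma chart_continuous c p : charts N c -> cdom c p -> {for p, continuous c}.
Proof.
move=> Ac cp; rewrite /prop_for /continuous_at => A /=; rewrite nbhsE => -[V [oV Vcp] VA].
have oc : open (cdom c `&` c @^-1` V).
  apply/(charts_homeo Ac (@subIsetl _ _ _)).
  have -> : c @` (cdom c `&` c @^-1` V) = c @` cdom c `&` V.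
    apply/seteqP; split=> [_ [x [cx Vx] <-]|_ [[x cx <-] Vx]]; last by exists x.
    by split => //; exists x.
  by apply: openI => //; case: (chart_maximal Ac).
apply: filterS (open_nbhs_nbhs (conj oc _)); last by split.
by move=> x [_ Vx]; exact: VA.
Qed.

Lemma smooth_on_continuous U f p : open U -> sm U f -> U p -> {for p, continuous f}.
Proof.
move=> oU Sf Up; have [c Ac cp] := charts_cover p.
have cf : {for p, continuous (in_chart c f \o c)}.
  apply: continuous_comp; first exact: chart_continuous.
  by apply: smooth_continuous (Sf c Ac) _; exists p.
move: cf; rewrite /prop_for /continuous_at /= in_chartE //; last exact: charts_inj.
apply: cvg_trans; apply: near_eq_cvg.
apply: filterS (open_nbhs_nbhs (conj (charts_open Ac) cp)) => x cx.
by rewrite /= in_chartE //; exact: charts_inj.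
Qed.

Lemma smooth_on_near_neq0 U f p : open U -> sm U f -> U p -> f p != 0 ->
  \forall q \near p, f q != 0.
Proof.
move=> oU Sf Up fp; have := smooth_on_continuous oU Sf Up.
by move=> /(_ [set x | x != 0]); apply; apply: open_nbhs_nbhs; split => //; exact: open_neq.
Qed.

Lemma smooth_on_near_gt0 U f p : open U -> sm U f -> U p -> 0 < f p ->
  \forall q \near p, 0 < f q.
Proof.
move=> oU Sf Up fp; have := smooth_on_continuous oU Sf Up.
by move=> /(_ [set x | 0 < x]); apply; apply: open_nbhs_nbhs; split => //; exact: open_gt.
Qed.

End ManifoldFunctions.

(** * Partitions of unity *)

Section PartitionOfUnity.
Variables (R : realType) (n : nat) (N : manifold R n).
Local Notation sm := (smooth_on (charts N)).

(** A bump function in a chart, extended by zero. Its support lies in the preimage K of a closed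
    ball, which is compact, hence closed since N is Hausdorff; so the extension is zero on an open
    set that covers everything outside the chart. *)
Lemma manifold_bump (W : set N) p : open W -> W p -> exists (rho : N -> R) (V K : set N),
  [/\ sm setT rho, forall x, 0 <= rho x <= 1, open V /\ V p, forall x, V x -> rho x = 1
    & [/\ closed K, K `<=` W & forall x, rho x != 0 -> K x]].
Proof.
move=> oW Wp; have [c Ac cp] := charts_cover p.
have mc := chart_maximal Ac; have ci := maximal_inj mc.
have ocW := image_chart_open Ac oW.
have : nbhs (c p) (c @` (cdom c `&` W)) by apply: open_nbhs_nbhs; split=> //; exists p.
(* Half the radius, so that the closed ball of radius d stays inside the image of W. *)
move=> /nbhs_ballP[d0 /= d0_gt0 dP]; pose d := d0 / 2.
have d_gt0 : 0 < d by rewrite divr_gt0.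
have [b [Sb b01 bsupp [e e0 b1]]] := smooth_bump (c p) d_gt0.
pose B := closed_ball_ Num.norm (c p) d.
have BW y : B y -> exists x, [/\ cdom c x, W x & c x = y].
  move=> By; have : ball (c p) d0 y.
    rewrite -ball_normE /= /ball_ /=; apply: le_lt_trans By _.
    by rewrite /d ltr_pdivrMr // ltr_pMr // ltr1n.
  by move=> /dP[x [cx Wx] <-]; exists x.
pose K := [set x | cdom c x /\ B (c x)].
pose phi y := odflt p (chart_inv c y).
have phiK x : cdom c x -> phi (c x) = x.
  move=> cx; rewrite /phi /chart_inv; case: pselect => [ex|]; last by case; exists x.
  by case: cid => z [cz /= czx]; apply: ci; rewrite ?inE.
have KE : K = phi @` B.
  apply/seteqP; split=> [x [cx Bx]|_ [y By <-]]; first by exists (c x); rewrite ?phiK.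
  by have [x [cx Wx xy]] := BW y By; rewrite -xy phiK //; split=> //; rewrite xy.
have Bcompact : compact B.
  apply: bounded_closed_compact; last exact: closed_closed_ball_.
  exists (`|c p| + d); split=> [|M HM y By]; first exact: num_real.
  apply: le_trans (ltW HM); rewrite -[y](subrKC (c p)).
  by rewrite (le_trans (ler_normD _ _)) // lerD2l distrC.
have Kclosed : closed K.
  apply: compact_closed; first exact: points_hausdorff.
  rewrite KE; apply: continuous_compact Bcompact; apply: continuous_in_subspaceT.
  move=> y /set_mem By; have [x [cx Wx <-]] := BW y By.
  move=> A; rewrite phiK // => /near_open[V [oV Vx VA]].
  apply: filterS (open_nbhs_nbhs (conj (image_chart_open Ac oV) _)); last by exists x.
  by move=> _ [z [cz Vz] <-]; rewrite /= phiK //; exact: VA.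
have KW : K `<=` W.
  by move=> x [cx /BW[z [cz Wz zx]]]; rewrite -(ci _ _ _ _ zx) ?inE.
pose rho x := if x \in cdom c then b (c x) else 0.
have rhoK x : rho x != 0 -> K x.
  rewrite /rho; case: ifPn => [/set_mem cx|_]; last by rewrite eqxx.
  by move=> /bsupp; rewrite distrC => bx; split.
exists rho, (cdom c `&` [set x | ball (c p) e (c x)]), K; split.
- apply: smooth_on_local => x _; case: (pselect (cdom c x)) => [cx|ncx].
    exists (cdom c) => //; apply: (chart_smooth_on mc) => //; first exact: charts_open.
    have oc := maximal_chart_open mc (charts_open Ac).
    apply: (chart_smooth_from ci oc (F := b)); first exact: smooth_subset Sb.
    by move=> z cz _; rewrite /rho mem_set.
  exists (~` K); first by case.
  apply: (smooth_on_ext _ (f := fun=> 0)) => [|z nKz|].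
  + exact: closed_openC.
  + by apply/esym/eqP; apply: contrapT => /negP/rhoK.
  + by apply: smooth_on_cst; exact: closed_openC.
- by move=> x; rewrite /rho; case: ifP => // _; rewrite lexx ler01.
- split; last by split=> //; exact: ballxx.
  apply/(charts_homeo Ac (@subIsetl _ _ _)).
  have -> : c @` (cdom c `&` [set x | ball (c p) e (c x)]) = c @` cdom c `&` ball (c p) e.
    apply/seteqP; split=> [_ [x [cx bx] <-]|_ [[x cx <-] bx]]; last by exists x.
    by split=> //; exists x.
  by apply: openI; [case: mc|exact: ball_open].
- move=> x [cx]; rewrite -ball_normE /ball_ /= => bx.
  by rewrite /rho mem_set //; apply: b1; rewrite distrC.
- by [].
Qed.

(** A countable basis is numbered by codes. A code of a basis set contained in some [V p] selects
    one such p, the other codes get the default [p0]; every q lies in a basis set contained in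
    [V q]. *)
Lemma lindelof_seq (V : N -> set N) (p0 : N) : (forall p, open (V p) /\ V p p) ->
  exists s : nat -> N, forall q, exists m, V (s m) q.
Proof.
move=> HV; have [B /countable_injP[f fi] [_ Bb]] := points_second_countable N.
pose P m p := exists b, [/\ B b, f b = m & b `<=` V p].
exists (fun m => xget p0 (P m)) => q; have [oV Vq] := HV q.
have [b [Bb' bq] bV] := Bb q (V q) (open_nbhs_nbhs (conj oV Vq)).
exists (f b); case: xgetP => [p -> [b' [Bb'' ff b'V]]|/(_ q)]; last by case; exists b.
by apply: b'V; rewrite (fi _ _ _ _ ff) ?inE.
Qed.

(** The weights of a partition of unity built by successive remainders: their partial sums reach 1
    as soon as some [rho j] is 1. *)
Lemma telescope_prod (rho : nat -> R) M :
  \sum_(m < M) rho m * \prod_(j < m) (1 - rho j) = 1 - \prod_(j < M) (1 - rho j).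
Proof.
elim: M => [|M IH]; first by rewrite !big_ord0 subrr.
by rewrite !big_ord_recr /= IH; ring.
Qed.

(* Average the [g i j] over the partition of unity
   [psi m = rho m * \prod_(j < m) (1 - rho j)], which is locally finite because each
   point has a neighbourhood where some [rho j] is 1. *)
Lemma positive_cocycle (I : Type) (W : I -> set N) (g : I -> I -> N -> R) :
  (forall i, open (W i)) -> (forall p, exists i, W i p) ->
  (forall i j, sm (W i `&` W j) (g i j)) ->
  (forall i j q, W i q -> W j q -> 0 < g i j q) ->
  (forall i j h q, W i q -> W j q -> W h q -> g i h q = g i j q * g j h q) ->
  exists h : I -> N -> R, [/\ forall i, sm (W i) (h i),
    forall i q, W i q -> 0 < h i q &
    forall i j q, W i q -> W j q -> h i q = g i j q * h j q].
Proof.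
move=> oW cov Sg g0 gg.
(* An empty N offers no default point to [lindelof_seq]; every claim about it is vacuous. *)
case: (pselect (exists p0 : N, True)) => [[p0 _]|noN]; last first.
  by exists (fun _ _ => 0); split=> [i|i q|i j q]; [apply: smooth_on_local => q _|..];
    case: noN; exists q.
have /choice[ip ipP] := cov.
have /choice[D HD] p : exists D : (N -> R) * set N * set N,
    [/\ sm setT D.1.1, forall x, 0 <= D.1.1 x <= 1, open D.1.2 /\ D.1.2 p,
        forall x, D.1.2 x -> D.1.1 x = 1
      & [/\ closed D.2, D.2 `<=` W (ip p) & forall x, D.1.1 x != 0 -> D.2 x]].
  by have [rho [V [K H]]] := manifold_bump (oW (ip p)) (ipP p); exists (rho, V, K).
have [|s sP] := @lindelof_seq (fun p => (D p).1.2) p0.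
  by move=> p; have [_ _ + _ _] := HD p.
pose rho m := (D (s m)).1.1; pose V m := (D (s m)).1.2; pose K m := (D (s m)).2.
pose ix m := ip (s m).
have Srho m : sm setT (rho m) by have [] := HD (s m).
have rho01 m x : 0 <= rho m x <= 1 by have [_ + _ _ _] := HD (s m); exact.
have oV m : open (V m) by have [_ _ [+ _] _ _] := HD (s m).
have rho1 m x : V m x -> rho m x = 1 by have [_ _ _ + _] := HD (s m); exact.
have cK m : closed (K m) by have [_ _ _ _ []] := HD (s m).
have KW m : K m `<=` W (ix m) by have [_ _ _ _ []] := HD (s m).
have rhoK m x : rho m x != 0 -> K m x by have [_ _ _ _ [_ _ +]] := HD (s m); exact.
pose psi m q := rho m q * \prod_(j < m) (1 - rho j q).
have psi_ge0 m q : 0 <= psi m q.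
  have /andP[r0 _] := rho01 m q; rewrite mulr_ge0 //; apply: prodr_ge0 => j _.
  by rewrite subr_ge0; case/andP: (rho01 j q).
have psi0 M m q : V M q -> (M < m)%N -> psi m q = 0.
  move=> VM Mm; rewrite /psi (bigD1 (Ordinal Mm)) //= (rho1 M q VM) subrr mul0r.
  by rewrite mulr0.
have psiK m q : psi m q != 0 -> W (ix m) q.
  by move=> H; apply/KW/rhoK; apply: contraNneq H => r0; rewrite /psi r0 mul0r.
have /choice[Mq MqP] := sP.
pose h i q := \sum_(m < (Mq q).+1) psi m q * g i (ix m) q.
(* The cut-off [Mq q] may jump with q. As [psi m] vanishes on [V M] for m > M, any M with [V M q]
   gives the same sum, and a fixed M can be used near a point. *)
have hE i M q : V M q -> h i q = \sum_(m < M.+1) psi m q * g i (ix m) q.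
  move=> VM.
  have H M1 M2 : V M1 q -> V M2 q -> (M1 <= M2)%N ->
      \sum_(m < M2.+1) psi m q * g i (ix m) q = \sum_(m < M1.+1) psi m q * g i (ix m) q.
    move=> V1 V2 M12.
    rewrite -!(big_mkord xpredT (fun m => psi m q * g i (ix m) q)).
    rewrite (big_cat_nat (n := M1.+1)) //= [X in _ + X](_ : _ = 0) ?addr0 //.
    rewrite big_nat_cond big1 // => m; rewrite andbT => /andP[M1m _].
    by rewrite (psi0 M1) // mul0r.
  rewrite /h; have VMq : V (Mq q) q by exact: MqP.
  by case: (leqP M (Mq q)) => [|/ltnW] MM; [|apply/esym]; exact: H.
have psi_sum M q : V M q -> \sum_(m < M.+1) psi m q = 1.
  move=> VM; apply: etrans (telescope_prod (rho^~ q) M.+1) _; rewrite (bigD1 ord_max) //= (rho1 M q VM) subrr.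
  by rewrite mul0r subr0.
exists h; split.
- move=> i; apply: smooth_on_local => q Wq; pose M := Mq q.
  have oU : open (W i `&` V M) by apply: openI.
  exists (W i `&` V M); first by split=> //; exact: MqP.
  apply: (smooth_on_ext oU (f := fun x => \sum_(m < M.+1) psi m x * g i (ix m) x)).
    by move=> x [_ Vx]; rewrite (hE i M).
  apply: smooth_on_sum => // m _; apply: smooth_on_local => x [Wx Vx].
  have Spsi U : open U -> sm U (psi m).
    move=> oU'; have Sr j : sm U (rho j) by apply: smooth_on_subset (Srho j).
    apply: smooth_onM => //; apply: smooth_on_prod => // j _.
    by apply: smooth_onD => //; [exact: smooth_on_cst|exact: smooth_onN].
  case: (pselect (W (ix m) x)) => [Wmx|nW].
    have oWW : open (W i `&` W (ix m)) by apply: openI.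
    exists (W i `&` W (ix m)) => //; apply: smooth_onM => //; exact: Spsi.
  (* Nothing is known of [g i (ix m)] outside [W (ix m)], but x lies in the open complement of
     [K m], where [psi m] is 0. *)
  exists (~` K m); first by move=> /KW.
  have oK : open (~` K m) by exact: closed_openC.
  apply: (smooth_on_ext oK (f := fun=> 0)); last exact: smooth_on_cst.
  move=> y nK; rewrite (_ : psi m y = 0) ?mul0r // /psi.
  have -> : rho m y = 0 by apply/eqP; apply: contrapT => /negP/rhoK.
  by rewrite mul0r.
- move=> i q Wq; have VM : V (Mq q) q by exact: MqP.
  have term_ge0 m : 0 <= psi m q * g i (ix m) q.
    have [->|/psiK Wm] := eqVneq (psi m q) 0; first by rewrite mul0r.
    by rewrite mulr_ge0 // ltW // g0.
  rewrite lt_def (_ : 0 <= h i q) ?andbT; last by apply: sumr_ge0 => m _.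
  (* If this sum of nonnegative terms vanished, every [psi m q] would vanish, although they add up
     to 1. *)
  apply/negP; rewrite psumr_eq0 => [/allP H|m _]; last exact: term_ge0.
  have /eqP := psi_sum _ _ VM; rewrite big1 => [|m _]; first by rewrite eq_sym oner_eq0.
  apply/eqP; have := H m (mem_index_enum m); rewrite mulf_eq0 => /orP[//|/eqP gE].
  apply: contrapT => /negP/psiK Wm.
  by have := g0 i (ix m) q Wq Wm; rewrite gE ltxx.
- move=> i j q Wi Wj; rewrite /h mulr_sumr; apply: eq_bigr => m _.
  have [->|/psiK Wm] := eqVneq (psi m q) 0; first by rewrite !mul0r mulr0.
  by rewrite (gg i j) // mulrCA.
Qed.

End PartitionOfUnity.

(** * Jets of sections of L *)

Section BundleJets.
Variables (R : realType) (n : nat) (N : manifold R n) (L : line_bundle N).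
Local Notation maximal := (in_maximal_atlas (charts N)).
Local Notation sm := (smooth_on (charts N)).
Implicit Types (U V : set N) (f : N -> R) (s u v : section L).

Definition triv_val (t : trivialization L) s : N -> R := fun x => t x (s x).

Lemma trivs_inj t p : trivs L t -> tdom t p -> injective (t p).
Proof. by move=> At tp; exact: bij_inj (trivs_bij At tp). Qed.

Lemma triv_eq0 t p (v : L p) : trivs L t -> tdom t p -> (t p v == 0) = (v == 0).
Proof.
move=> At tp; apply/eqP/eqP => [|->]; last exact: linear0.
by rewrite -[X in _ = X](linear0 (t p)) => /(trivs_inj At tp).
Qed.

Lemma smooth_sec_triv U s t : open U -> trivs L t -> smooth_sec U s ->
  sm (U `&` tdom t) (triv_val t s).
Proof. by move=> oU At; exact. Qed.

Lemma smooth_sec_local U s :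
  (forall p, U p -> exists2 V, V p & smooth_sec V s) -> smooth_sec U s.
Proof.
move=> H t At; apply: smooth_on_local => p [Up tp].
by have [V Vp /(_ t At) Sf] := H p Up; exists (V `&` tdom t).
Qed.

Lemma smooth_sec_subset U V s : U `<=` V -> smooth_sec V s -> smooth_sec U s.
Proof.
by move=> UV SV t At; apply: smooth_on_subset (SV t At) => x [Ux tx]; split => //; exact: UV.
Qed.

Lemma triv_smooth_sec U s t : open U -> trivs L t -> U `<=` tdom t ->
  sm U (triv_val t s) -> smooth_sec U s.
Proof.
move=> oU At Ut Ss t' At'; have [g Sg gE] := trivs_smooth At At'.
have oV : open (U `&` tdom t') by apply: openI => //; exact: trivs_open.
apply: (smooth_on_ext oV (f := fun x => g x * triv_val t s x)).
  by move=> x [/Ut tx t'x]; rewrite -gE.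
apply: smooth_onM => //; last by apply: smooth_on_subset Ss => x [].
by apply: smooth_on_subset Sg => x [/Ut].
Qed.

Lemma smooth_sec_ext U u v : open U -> (forall x, U x -> u x = v x) ->
  smooth_sec U u -> smooth_sec U v.
Proof.
move=> oU uv Su t At; apply: (smooth_on_ext _ _ (Su t At)).
  by apply: openI => //; exact: trivs_open.
by move=> x [/uv ->].
Qed.

Lemma smooth_secZ U f s : open U -> sm U f -> smooth_sec U s ->
  smooth_sec U (fun x => f x *: s x).
Proof.
move=> oU Sf Ss t At; have oV : open (U `&` tdom t) by apply: openI => //; exact: trivs_open.
apply: (smooth_on_ext oV (f := fun x => f x * triv_val t s x)).
  by move=> x _; rewrite linearZ.
apply: smooth_onM => //; last exact: Ss.
by apply: smooth_on_subset Sf => x [].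
Qed.

Lemma smooth_sec_sum U (I : Type) (r : seq I) (F : I -> section L) : open U ->
  (forall i, smooth_sec U (F i)) -> smooth_sec U (fun x => \sum_(i <- r) F i x).
Proof.
move=> oU SF t At; have oV : open (U `&` tdom t) by apply: openI => //; exact: trivs_open.
apply: (smooth_on_ext oV (f := fun x => \sum_(i <- r) triv_val t (F i) x)).
  by move=> x _; rewrite linear_sum.
by apply: smooth_on_sum => // i _; exact: SF.
Qed.

Lemma smooth_sec_comb U (d : nat) (a : 'I_d -> R) (u : 'I_d -> section L) : open U ->
  (forall i, smooth_sec U (u i)) -> smooth_sec U (fun x => \sum_i a i *: u i x).
Proof.
move=> oU Su; apply: smooth_sec_sum => // i.
by apply: smooth_secZ => //; exact: smooth_on_cst.
Qed.

Lemma smooth_sec_at U p s : open U -> U p -> smooth_sec U s -> smooth_at p s.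
Proof. by exists U. Qed.

Definition sec_of (t : trivialization L) f : section L :=
  fun x => xget 0 [set v : L x | t x v = f x].

Lemma sec_ofE t f x : trivs L t -> tdom t x -> t x (sec_of t f x) = f x.
Proof.
move=> At tx; rewrite /sec_of; case: xgetP => [v ->|] // /(_ _) H.
have [g _ gK] := trivs_bij At tx.
by case: (H (g (f x))); rewrite /= gK.
Qed.

Lemma sec_of_smooth U t f : open U -> trivs L t -> U `<=` tdom t -> sm U f ->
  smooth_sec U (sec_of t f).
Proof.
move=> oU At Ut Sf; apply: (triv_smooth_sec oU At Ut).
by apply: smooth_on_ext Sf => // x /Ut tx; rewrite /triv_val sec_ofE.
Qed.

Section AtPoint.
Variables (c : chart R N n) (t : trivialization L) (p : N).
Hypotheses (mc : maximal c) (At : trivs L t) (cp : cdom c p) (tp : tdom t p).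

Lemma smooth_at_diff s : smooth_at p s -> differentiable (in_chart c (triv_val t s)) (c p).
Proof.
move=> [U [oU Up Ss]]; apply: (@smooth_on_diff _ _ _ c mc (U `&` tdom t)) => //.
  by apply: openI => //; exact: trivs_open.
exact: Ss.
Qed.

Lemma smooth_at_triv s : smooth_at p s ->
  exists V, [/\ open V, V p, V `<=` tdom t & sm V (triv_val t s)].
Proof.
move=> [U [oU Up Ss]]; exists (U `&` tdom t); split=> //.
  by apply: openI => //; exact: trivs_open.
exact: Ss.
Qed.

(** Where s is 0, the Leibniz rule drops the derivative of the transition function of L, so
    vanishing to first order can be read in one trivialization. Taking c in the maximal atlas makes
    foliated charts available. *)
Lemma vanish1P s : smooth_at p s ->
  vanish1 p s <-> s p = 0 /\ forall j, chart_partial c j (triv_val t s) p = 0.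
Proof.
move=> Ss; have [V [oV Vp Vt SV]] := smooth_at_triv Ss.
split=> [V1|[s0 ds] c' t' Ac' At' c'p t'p].
  have [a Aa ap] := charts_cover p; have [s0 ds] := V1 a t Aa At ap tp.
  split=> [|j].
    move: s0; rewrite /local_rep in_chartE //; last exact: charts_inj.
    by move/eqP; rewrite triv_eq0 // => /eqP.
  rewrite (maximal_partial_change (U := V) j mc (chart_maximal Aa)) //.
  by apply: big1 => i _; rewrite [chart_partial a _ _ _]ds mulr0.
have mc' := chart_maximal Ac'.
split=> [|j].
  by rewrite /local_rep in_chartE ?s0 ?linear0 //; exact: charts_inj.
have [g Sg gE] := trivs_smooth At At'.
have oW : open (V `&` tdom t') by apply: openI => //; exact: trivs_open.
have Sg' : sm (V `&` tdom t') g by apply: smooth_on_subset Sg => x [/Vt].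
have Ss' : sm (V `&` tdom t') (triv_val t s) by apply: smooth_on_subset SV => x [].
rewrite -[LHS]/(chart_partial c' j (triv_val t' s) p).
rewrite (@chart_partial_ext _ _ _ _ (maximal_inj mc') (V `&` tdom t') _ _
  (fun x => g x * triv_val t s x)) //.
- rewrite chart_partialM //; [|exact: maximal_inj|exact: smooth_on_diff Sg' _ _|exact: smooth_on_diff Ss' _ _].
  rewrite /triv_val s0 linear0 mul0r addr0.
  rewrite (maximal_partial_change (U := V) j mc' mc) //.
  rewrite big1 ?mulr0 // => i _; rewrite -[X in chart_partial c i X p]/(triv_val t s).
  by rewrite ds mulr0.
- exact: maximal_chart_open.
- by move=> x _ [/Vt tx t'x]; rewrite -gE.
Qed.

Lemma triv_valB u v x : triv_val t (fun x => u x - v x) x = -1 * triv_val t v x + triv_val t u x.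
Proof. by rewrite /triv_val linearB mulN1r addrC. Qed.

Lemma chart_partialB u v j : smooth_at p u -> smooth_at p v ->
  chart_partial c j (triv_val t (fun x => u x - v x)) p =
  chart_partial c j (triv_val t u) p - chart_partial c j (triv_val t v) p.
Proof.
move=> Su Sv; have -> : triv_val t (fun x => u x - v x) =
    fun x => -1 * triv_val t v x + triv_val t u x.
  by apply/funext => x; exact: triv_valB.
by rewrite chart_partial_lin ?mulN1r 1?addrC //; exact: smooth_at_diff.
Qed.

Lemma jet_val_j1_in u : smooth_at p u -> jet_val (j1 p u) = u p.
Proof.
move=> Su; have Sr := jet_repr_smooth (j1 p u).
have /vanish1P[|+ _] := j1_repr Su; first exact: smooth_at_sub.
by move=> /eqP; rewrite subr_eq0 => /eqP.
Qed.

Lemma jet_partial_j1 u j : smooth_at p u ->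
  jet_partial c t (j1 p u) j = chart_partial c j (triv_val t u) p.
Proof.
move=> Su; have Sr := jet_repr_smooth (j1 p u).
have /vanish1P[|_ /(_ j)] := j1_repr Su; first exact: smooth_at_sub.
by rewrite chart_partialB // => /eqP; rewrite subr_eq0 => /eqP ->.
Qed.

(** The three lemmas that follow make it a linear isomorphism from the fibre of J^1 L at p onto
    R^(1+n), so that fibre computations become computations with rows. *)
Definition jet_coord (a : J1 L p) : 'rV[R]_(1 + n) :=
  row_mx (const_mx (t p (jet_val a))) (\row_j jet_partial c t a j).

Lemma jet_coord_val a : jet_coord a 0 (lshift n 0) = t p (jet_val a).
Proof. by rewrite row_mxEl mxE. Qed.

Lemma jet_coord_partial a j : jet_coord a 0 (rshift 1 j) = jet_partial c t a j.
Proof. by rewrite row_mxEr mxE. Qed.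

Lemma jet_coord_inj : injective jet_coord.
Proof.
move=> a b E; rewrite -(jet_reprK a) -(jet_reprK b).
have Sa := jet_repr_smooth a; have Sb := jet_repr_smooth b.
apply: j1_eq => //; apply/vanish1P; first exact: smooth_at_sub.
split=> [|j].
  apply/eqP; rewrite subr_eq0; apply/eqP; apply: (trivs_inj At tp).
  by rewrite -[RHS]jet_coord_val E jet_coord_val.
rewrite chart_partialB //; apply/eqP; rewrite subr_eq0; apply/eqP.
by rewrite -[RHS]jet_coord_partial E jet_coord_partial.
Qed.

Lemma jet_linE (k : R) u v : smooth_at p u -> smooth_at p v ->
  k *: j1 p u + j1 p v = j1 p (sec_lin k u v).
Proof.
move=> Su Sv; rewrite -[k *: _]/(jet_scale k _) -[LHS]/(jet_add _ _).
by rewrite jet_scaleE // jet_addE //; exact: smooth_at_scale.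
Qed.

Lemma jet_coord_linear : linear jet_coord.
Proof.
move=> k; elim/jet_ind => u Su; elim/jet_ind => v Sv; rewrite jet_linE //.
have Suv := smooth_at_lin k Su Sv.
apply/rowP => i; rewrite [in RHS]mxE [X in _ = X + _]mxE -(splitK i).
case: (fintype.split i) => j /=.
  rewrite ord1 !jet_coord_val (jet_val_j1_in Suv) (jet_val_j1_in Su) (jet_val_j1_in Sv).
  exact: linearP.
rewrite !jet_coord_partial (jet_partial_j1 _ Suv) (jet_partial_j1 _ Su) (jet_partial_j1 _ Sv).
rewrite -(chart_partial_lin j k (smooth_at_diff Su) (smooth_at_diff Sv)); congr chart_partial.
by apply/funext => x; exact: linearP.
Qed.

Lemma jet_coord_surj (y : 'rV[R]_(1 + n)) : exists a, jet_coord a = y.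
Proof.
(* Affine in the chart, with the value and the gradient at p prescribed by y. *)
pose f x := y 0 (lshift n 0) + \sum_j (c x 0 j - c p 0 j) * y 0 (rshift 1 j).
have oc := maximal_dom_open mc.
have oU : open (cdom c `&` tdom t) by apply: openI => //; exact: trivs_open.
have Sf : sm (cdom c `&` tdom t) f.
  apply: smooth_onD => //; first exact: smooth_on_cst.
  apply: smooth_on_sum => // j _; apply: smooth_onM => //; last exact: smooth_on_cst.
  apply: smooth_onD => //; last exact: smooth_on_cst.
  by apply: smooth_on_subset (smooth_on_coord mc j) => x [].
have Su : smooth_sec (cdom c `&` tdom t) (sec_of t f).
  by apply: sec_of_smooth => // x [].
have Sa : smooth_at p (sec_of t f) by exact: smooth_sec_at Su.
exists (j1 p (sec_of t f)).
apply/rowP => i; rewrite -(splitK i); case: (fintype.split i) => j /=.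
  rewrite ord1 jet_coord_val jet_val_j1_in // sec_ofE // /f big1 ?addr0 // => j' _.
  by rewrite subrr mul0r.
rewrite jet_coord_partial jet_partial_j1 //.
rewrite (@chart_partial_ext _ _ _ _ (maximal_inj mc) (cdom c `&` tdom t) _ _ f) //; first last.
- by move=> x cx [_ tx]; rewrite /triv_val sec_ofE.
- exact: maximal_chart_open.
pose F (y' : 'rV[R]_n) := y 0 (lshift n 0) + \sum_j (y' 0 j - c p 0 j) * y 0 (rshift 1 j).
have -> : chart_partial c j f p = partial j F (c p).
  apply: near_eq_derive; have occ := maximal_chart_open mc oc.
  apply: filterS (open_nbhs_nbhs (conj occ _)); last by exists p.
  by move=> _ [x [cx _] <-]; rewrite in_chartE //; exact: maximal_inj.
exact: partial_affine.
Qed.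

End AtPoint.

Lemma jet_val_j1 p u : smooth_at p u -> jet_val (j1 p u) = u p.
Proof.
have [c Ac cp] := charts_cover p; have [t At tp] := trivs_cover L p.
by move=> Su; exact: (jet_val_j1_in (chart_maximal Ac) At).
Qed.

End BundleJets.

Lemma linear_comb (R : pzRingType) (V W : lmodType R) (f : V -> W) (I : Type)
    (r : seq I) (a : I -> R) (b : I -> V) : linear f ->
  f (\sum_(i <- r) a i *: b i) = \sum_(i <- r) a i *: f (b i).
Proof.
move=> lin; elim: r => [|i r IH]; last by rewrite !big_cons lin IH.
by rewrite !big_nil -[0 in LHS](addNr 0) -scaleN1r lin scaleN1r addNr.
Qed.

(** * The total space of J^1 L as a manifold *)

Section JetBundle.
Variables (R : realType) (n : nat) (N : manifold R n) (L : line_bundle N).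
Local Notation maximal := (in_maximal_atlas (charts N)).
Local Notation sm := (smooth_on (charts N)).
Implicit Types (U V W : set N) (f : N -> R) (s u v : section L).

Lemma jet_coord_comb (c : chart R N n) t p d (a : 'I_d -> R) (b : 'I_d -> J1 L p) :
  maximal c -> trivs L t -> cdom c p -> tdom t p ->
  jet_coord c t (\sum_i a i *: b i) = (\row_i a i) *m (\matrix_i jet_coord c t (b i)).
Proof.
move=> mc At cp tp; rewrite (linear_comb _ _ _ (jet_coord_linear mc At cp tp)).
by rewrite mulmx_sum_row; apply: eq_bigr => i _; rewrite rowK mxE.
Qed.

Lemma j1_eq_on p U u v : open U -> U p -> smooth_at p u -> (forall x, U x -> u x = v x) ->
  j1 p u = j1 p v.
Proof.
move=> oU Up Su uv.
have Sv : smooth_at p v.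
  have [V [oV Vp SV]] := Su; exists (V `&` U); split=> //; first exact: openI.
  apply: (smooth_sec_ext (u := u)); [exact: openI|by move=> x [_ /uv]|].
  by apply: smooth_sec_subset SV => x [].
have [c Ac cp] := charts_cover p; have [t At tp] := trivs_cover L p.
have mc := chart_maximal Ac.
apply: (jet_coord_inj mc At cp tp); apply/rowP => i; rewrite -(splitK i).
case: (fintype.split i) => j /=.
  by rewrite ord1 !jet_coord_val !jet_val_j1 // uv.
rewrite !jet_coord_partial !jet_partial_j1 //.
apply: (@chart_partial_ext _ _ _ _ (maximal_inj mc) U) => //.
  exact: maximal_chart_open.
by move=> x _ Ux; rewrite /triv_val uv.
Qed.

Lemma j1_comb p d (a : 'I_d -> R) (u : 'I_d -> section L) :
  (forall i, smooth_at p (u i)) ->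
  smooth_at p (fun x => \sum_i a i *: u i x) /\
  \sum_i a i *: j1 p (u i) = j1 p (fun x => \sum_i a i *: u i x).
Proof.
move=> Su.
suff H (r : seq 'I_d) : smooth_at p (fun x => \sum_(i <- r) a i *: u i x) /\
  \sum_(i <- r) a i *: j1 p (u i) = j1 p (fun x => \sum_(i <- r) a i *: u i x) by exact: H.
elim: r => [|i r [IS IE]].
  have -> : (fun x => \sum_(i <- [::]) a i *: u i x) = (@sec0 R n N L).
    by apply: functional_extensionality_dep => x; rewrite big_nil.
  by rewrite big_nil -zero_jetE; split => //; exact: smooth_at0.
have -> : (fun x => \sum_(j <- i :: r) a j *: u j x) =
    sec_lin (a i) (u i) (fun x => \sum_(j <- r) a j *: u j x).
  by apply: functional_extensionality_dep => x; rewrite big_cons.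
by split; [exact: smooth_at_lin|rewrite big_cons IE jet_linE].
Qed.

Definition sec_coord (c : chart R N n) (t : trivialization L) s (q : N) : 'rV[R]_(1 + n) :=
  row_mx (const_mx (triv_val t s q)) (\row_j chart_partial c j (triv_val t s) q).

Lemma jet_coord_j1 c t p s : maximal c -> trivs L t -> cdom c p -> tdom t p ->
  smooth_at p s -> jet_coord c t (j1 p s) = sec_coord c t s p.
Proof.
move=> mc At cp tp Ss; congr row_mx; first by apply/rowP => i; rewrite !mxE jet_val_j1.
by apply/rowP => i; rewrite !mxE jet_partial_j1.
Qed.

Lemma sec_coord_smooth c t s U i : maximal c -> trivs L t -> open U ->
  U `<=` cdom c -> U `<=` tdom t -> smooth_sec U s ->
  sm U (fun q => sec_coord c t s q 0 i).
Proof.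
move=> mc At oU Uc Ut Ss.
have ST : sm U (triv_val t s).
  by apply: smooth_on_subset (smooth_sec_triv oU At Ss) => x Ux; split => //; exact: Ut.
rewrite -(splitK i); case: (fintype.split i) => j /=.
  by apply: smooth_on_ext ST => // x _; rewrite row_mxEl mxE.
have SP := smooth_on_partial mc j oU ST.
apply: (smooth_on_ext oU (f := chart_partial c j (triv_val t s))).
  by move=> x _; rewrite row_mxEr mxE.
by apply: smooth_on_subset SP => x Ux; split => //; exact: Uc.
Qed.

Definition jet_point (a : J1_total L) : N := projT1 a.

Section OneJetChart.
Variables (c : chart R N n) (t : trivialization L).
Hypotheses (mc : maximal c) (At : trivs L t).
Local Notation jc := (jet_chart c t).

Lemma jet_chartE (a : J1_total L) :
  jc a = row_mx (c (jet_point a)) (jet_coord c t (projT2 a)).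
Proof. by []. Qed.

Lemma jet_chart_inj : set_inj (cdom jc) jc.
Proof.
move=> [p x] [q y]; rewrite !inE !jet_chartE /= => -[cp tp] [cq tq].
move=> /eq_row_mx[pq xy]; have {}pq : p = q by apply: (maximal_inj mc); rewrite ?inE.
by subst q; rewrite (jet_coord_inj mc At cp tp xy).
Qed.

Lemma jet_chart_image U : U `<=` tdom t ->
  jc @` (cdom jc `&` jet_point @^-1` U) = [set y | (c @` (cdom c `&` U)) (lsubmx y)].
Proof.
move=> Ut; apply/seteqP; split=> [_ [a [[ca ta] Ua] <-]|y [q [cq Uq] qy]].
  by exists (jet_point a) => //; rewrite jet_chartE row_mxKl.
have [a aE] := jet_coord_surj mc At cq (Ut _ Uq) (rsubmx y).
exists (Jet a); first by split => //; split => //; exact: Ut.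
by rewrite jet_chartE /= aE qy hsubmxK.
Qed.

Lemma lsubmx_preim_open m1 m2 (B : set 'rV[R]_m1) : open B ->
  open [set y : 'rV[R]_(m1 + m2) | B (lsubmx y)].
Proof.
move=> oB; have := open_preim (F := @lsubmx R 1 m1 m2) openT _ oB.
rewrite setTI; apply => i; apply: (smooth_ext openT _ (smooth_coord setT (lshift m2 i))).
by move=> y _; rewrite mxE.
Qed.

Lemma jet_chart_open U : open U -> chart_open jc (jet_point @^-1` U).
Proof.
move=> oU; rewrite /chart_open.
have -> : cdom jc `&` jet_point @^-1` U =
    cdom jc `&` jet_point @^-1` (U `&` tdom t).
  by apply/seteqP; split=> [a [[ca ta] Ua]|a [[ca ta] [Ua _]]].
rewrite jet_chart_image => [|x []//]; apply: lsubmx_preim_open.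
by apply: maximal_chart_open => //; apply: openI => //; exact: trivs_open.
Qed.

Lemma jet_chart_smooth_point (D : set (J1_total L)) U f : chart_open jc D ->
  D `<=` jet_point @^-1` U -> open U -> sm U f -> chart_smooth jc D (f \o jet_point).
Proof.
move=> oD DU oU Sf; apply: (chart_smooth_comp jet_chart_inj (maximal_inj mc) oD _ _ _
  (smooth_on_chart mc oU Sf)).
- by move=> a [].
- move=> i.
  apply: (chart_smooth_ext jet_chart_inj oD (f := fun a => jc a 0 (lshift _ i))).
    by move=> a _ _; rewrite jet_chartE row_mxEl.
  by apply: chart_smooth_coord => //; exact: jet_chart_inj.
- by move=> a _ /DU.
Qed.

End OneJetChart.

Lemma jet_coord_change c t c' t' (g : N -> R) p (a : J1 L p) :
  maximal c -> trivs L t -> cdom c p -> tdom t p ->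
  maximal c' -> trivs L t' -> cdom c' p -> tdom t' p ->
  sm (tdom t `&` tdom t') g ->
  (forall q w, tdom t q -> tdom t' q -> t' q w = g q * t q w) ->
  t' p (jet_val a) = g p * t p (jet_val a) /\
  forall j, jet_partial c' t' a j =
    \sum_i chart_partial c' j (fun x => c x 0 i) p *
      (g p * jet_partial c t a i + t p (jet_val a) * chart_partial c i g p).
Proof.
move=> mc At cp tp mc' At' c'p t'p Sg gE; split; first exact: gE.
move=> j; elim/jet_ind: a => u Su; rewrite (jet_partial_j1 mc' At' c'p t'p) // jet_val_j1 //.
have [V [oV Vp Vt SV]] := smooth_at_triv At tp Su.
have oW : open (V `&` tdom t') by apply: openI => //; exact: trivs_open.
have Sg' : sm (V `&` tdom t') g by apply: smooth_on_subset Sg => x [/Vt].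
have Ss' : sm (V `&` tdom t') (triv_val t u) by apply: smooth_on_subset SV => x [].
have Wp : (V `&` tdom t') p by [].
have SW := smooth_onM oW Sg' Ss'.
rewrite (@chart_partial_ext _ _ _ _ (maximal_inj mc') (V `&` tdom t') _ _
  (fun x => g x * triv_val t u x)) //; first last.
- by move=> x _ [/Vt tx t'x]; rewrite -gE.
- exact: maximal_chart_open.
rewrite (maximal_partial_change j mc' mc oW SW) //; apply: eq_bigr => i _.
rewrite (jet_partial_j1 mc At cp tp) // chart_partialM //; first exact: maximal_inj.
  exact: smooth_on_diff Sg' _ _.
exact: smooth_on_diff Ss' _ _.
Qed.

(** By [jet_coord_change], the new fibre coordinates are linear in the old ones, with coefficients
    that are smooth functions of the base point; [S0] lifts these to the total space. *)
Lemma jet_chart_transition c t c' t' : maximal c -> trivs L t -> maximal c' -> trivs L t' ->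
  transition_smooth (jet_chart c t) (jet_chart c' t').
Proof.
move=> mc At mc' At'; set jc := jet_chart c t; set jc' := jet_chart c' t'.
have ji := jet_chart_inj mc At.
have oU' : open (cdom c' `&` tdom t').
  by apply: openI; [exact: maximal_dom_open|exact: trivs_open].
have oD : chart_open jc (cdom jc') by exact: (jet_chart_open mc At oU').
split; first exact: oD.
have [g Sg gE] := trivs_smooth At At'.
set U := cdom c `&` (cdom c' `&` (tdom t `&` tdom t')).
have ot : open (tdom t `&` tdom t') by apply: openI; exact: trivs_open.
have oU : open U.
  by apply: openI; [|apply: openI => //]; exact: maximal_dom_open.
pose D := cdom jc `&` cdom jc'.
have DE : cdom jc `&` D = cdom jc `&` cdom jc' by rewrite /D setIA setIid.
have oDD : chart_open jc D by rewrite /chart_open DE.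
have DU : D `<=` @jet_point @^-1` U by move=> a [[? ?] [? ?]].
suff H i : chart_smooth jc D (fun a => jc' a 0 i).
  by move=> i; have := H i; rewrite /chart_smooth DE.
have S0 f : sm U f -> chart_smooth jc D (f \o jet_point).
  exact: jet_chart_smooth_point.
have Sg' : sm U g by apply: smooth_on_subset Sg => x [_ []].
have Sc0 i' : chart_smooth jc D (fun a => jc a 0 i') by apply: chart_smooth_coord.
have Sval : chart_smooth jc D (fun a => t _ (jet_val (projT2 a))).
  apply: chart_smooth_ext (Sc0 (rshift n (lshift n 0))) => // a _ _.
  by rewrite jet_chartE row_mxEr jet_coord_val.
have Spar i' : chart_smooth jc D (fun a => jet_partial c t (projT2 a) i').
  apply: chart_smooth_ext (Sc0 (rshift n (rshift 1 i'))) => // a _ _.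
  by rewrite jet_chartE row_mxEr jet_coord_partial.
rewrite -(splitK i); case: (fintype.split i) => j; rewrite [unsplit _]/=.
  apply: chart_smooth_ext (S0 (fun x => c' x 0 j) _) => //.
    by move=> a _ _; rewrite jet_chartE row_mxEl.
  by apply: smooth_on_subset (smooth_on_coord mc' j) => x [_ []].
rewrite -(splitK j); case: (fintype.split j) => j'; rewrite [unsplit _]/=.
  apply: chart_smooth_ext (chart_smoothM ji oDD (S0 g Sg') Sval) => //.
  by move=> a _ [[? ?] [? ?]]; rewrite jet_chartE row_mxEr ord1 jet_coord_val /= -gE.
pose h i' (a : J1_total L) := chart_partial c' j' (fun x => c x 0 i') (jet_point a) *
  (g (jet_point a) * jet_partial c t (projT2 a) i' +
   t _ (jet_val (projT2 a)) * chart_partial c i' g (jet_point a)).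
apply: (chart_smooth_ext ji oDD (f := fun a => \sum_i' h i' a)).
  move=> a _ [[ca ta] [c'a t'a]]; rewrite jet_chartE row_mxEr jet_coord_partial.
  by have [_ ->] := jet_coord_change (projT2 a) mc At ca ta mc' At' c'a t'a Sg gE.
apply: chart_smooth_sum => // i' _; apply: chart_smoothM => //.
  apply: (S0 (chart_partial c' j' (fun x => c x 0 i'))).
  have Sc : sm U (fun x => c x 0 i') by apply: smooth_on_subset (smooth_on_coord mc i') => x [].
  by apply: smooth_on_subset (smooth_on_partial mc' j' oU Sc) => x Ux; split => //; case: Ux => _ [].
apply: chart_smoothD => //; apply: chart_smoothM => //; first exact: (S0 g).
apply: (S0 (chart_partial c i' g)).
by apply: smooth_on_subset (smooth_on_partial mc i' oU Sg') => x Ux; split => //; case: Ux.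
Qed.

Lemma smooth_jet_section_j1 U u : open U -> smooth_sec U u ->
  smooth_jet_section U (fun q => j1 q u).
Proof.
move=> oU Su _ [c [t [Ac At ->]]].
have mc := chart_maximal Ac.
set W := U `&` _; have WE : W = U `&` (cdom c `&` tdom t) by [].
have oW : open W.
  by rewrite WE; apply: openI => //; apply: openI; [exact: charts_open|exact: trivs_open].
split; first exact/atlas_openP.
have SuW : smooth_sec W u by apply: smooth_sec_subset Su => x [].
move=> i; rewrite -(splitK i); case: (fintype.split i) => j /=.
  apply: (smooth_on_ext oW (f := fun x => c x 0 j)) => [x _|].
    by rewrite row_mxEl.
  by apply: smooth_on_subset (smooth_on_coord mc j) => x [_ []].
apply: (smooth_on_ext oW (f := fun x => sec_coord c t u x 0 j)).
  move=> x [Ux [cx tx]]; rewrite row_mxEr -/(jet_coord c t (j1 x u)) jet_coord_j1 //.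
  exact: smooth_sec_at Su.
by apply: sec_coord_smooth => // x [_ []].
Qed.

Lemma smooth_jet_section_preim U (sigma : forall q, J1 L q) O : open U ->
  smooth_jet_section U sigma -> atlas_open (@J1_charts _ _ _ L) O ->
  open (U `&` [set q | O (Jet (sigma q))]).
Proof.
move=> oU Ss oO; apply: open_union_nbhd => q [Uq Oq].
have [c Ac cq] := charts_cover q; have [t At tq] := trivs_cover L q.
have Ab : J1_charts (jet_chart c t) by exists c, t.
have mc := chart_maximal Ac.
have [/atlas_openP oV SV] := Ss _ Ab.
set V := U `&` _ in oV SV.
exists (cdom c `&` (V `&` [set q | O (Jet (sigma q))])); split.
- apply/(charts_homeo Ac (@subIsetl _ _ _)).
  apply: (chart_open_preim (c' := jet_chart c t) (maximal_inj mc) (jet_chart_inj mc At)).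
  + exact: maximal_chart_open.
  + by move=> x _ [].
  + by move=> i; exact: SV.
  + exact: oO.
- by [].
- by move=> x [_ [[Ux _] Ox]].
Qed.

End JetBundle.

(** * A criterion for charts of a maximal atlas *)

Section MaximalCriterion.
Variables (R : realType) (T : Type) (n : nat) (A : set (chart R T n)).
Hypothesis Ai : forall a, A a -> set_inj (cdom a) a.
Hypothesis Ats : forall a b, A a -> A b -> transition_smooth a b.

Lemma atlas_open_chart c0 D : A c0 -> D `<=` cdom c0 -> chart_open c0 D -> atlas_open A D.
Proof.
move=> A0 D0 oD a Aa; have [oa Sa] := Ats Aa A0.
have := @chart_open_preim R _ _ _ _ a c0 (Ai Aa) (Ai A0) id (cdom c0) oa _ Sa D oD.
have -> : cdom c0 `&` id @^-1` D = D by apply/seteqP; split=> [x []|x Dx] //; split => //; exact: D0.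
by apply.
Qed.

(** Transitions between c and any chart of A factor through [c0], so comparing c with [c0] alone is
    enough. *)
Lemma in_maximal_from c0 (c : chart R T n) : A c0 -> set_inj (cdom c) c ->
  cdom c `<=` cdom c0 -> chart_open c0 (cdom c) -> open (c @` cdom c) ->
  (forall i, chart_smooth c0 (cdom c) (fun x => c x 0 i)) ->
  (forall i, chart_smooth c (cdom c) (fun x => c0 x 0 i)) ->
  in_maximal_atlas A c.
Proof.
move=> A0 ci c0D oD oc Sc Sc0; split => // a Aa; split.
  have oaD := atlas_open_chart A0 c0D oD Aa; split=> // i.
  apply: (@chart_smooth_comp R _ _ _ _ a c0 (Ai Aa) (Ai A0) id _ oaD _ _ _ _ _ (Sc i)) => //.
    by move=> x _ /c0D.
  by move=> j; apply: chart_smooth_subset (proj2 (Ats Aa A0) j) => x _ /c0D.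
have [ob S0] := Ats A0 Aa.
have occ : chart_open c (cdom c) by rewrite /chart_open setIid.
have o1 : chart_open c (cdom c `&` id @^-1` cdom a).
  by apply: (@chart_open_preim R _ _ _ _ c c0 ci (Ai A0) id) => // x _ /c0D.
have o2 : chart_open c (cdom a).
  by move: o1; rewrite /chart_open setIA setIid.
split=> // i.
apply: (@chart_smooth_comp R _ _ _ _ c c0 ci (Ai A0) id _ o2 _ _ _ _ _ (S0 i)) => //.
  by move=> x /c0D.
by move=> j; apply: chart_smooth_subset (Sc0 j).
Qed.

End MaximalCriterion.

(** * The exact sequence of the lattice *)

Lemma row_full_surj (R : fieldType) m n (A : 'M[R]_(m, n)) :
  (forall y : 'rV[R]_n, exists x : 'rV[R]_m, x *m A = y) -> row_full A.
Proof.
move=> H; apply/row_fullP; have /choice[X HX] := fun i => H (delta_mx 0 i).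
by exists (\matrix_i X i); apply/row_matrixP => i; rewrite row_mul rowK HX rowE mulmx1.
Qed.

Section LatticeAlgebra.
Variables (R : realType) (k l : nat) (N : manifold R (k + l)).
Variables (F : foliation N) (L : line_bundle N).
Local Notation maximal := (in_maximal_atlas (charts N)).
Local Notation sm := (smooth_on (charts N)).
Implicit Types (p q : N).

Lemma ZcombE q (m : 'rV[int]_l.+1) (b : 'I_l.+1 -> J1 L q) :
  Zcomb m b = \sum_r (m 0 r)%:~R *: b r.
Proof. by apply: eq_bigr => r _; rewrite scaler_int. Qed.

Lemma Zcomb_delta q (b : 'I_l.+1 -> J1 L q) r : Zcomb (delta_mx 0 r) b = b r.
Proof.
rewrite /Zcomb (bigD1 r) //= mxE !eqxx mulr1z big1 ?addr0 // => s /negbTE sr.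
by rewrite mxE sr andbF mulr0z.
Qed.

Lemma Zspan_gen q (b : 'I_l.+1 -> J1 L q) r : Zspan b (b r).
Proof. by exists (delta_mx 0 r) => //; exact: Zcomb_delta. Qed.

Lemma Rspan_Zspan q (b : 'I_l.+1 -> J1 L q) a :
  Rspan (Zspan b) a <-> exists x : 'I_l.+1 -> R, a = \sum_r x r *: b r.
Proof.
split=> [[d [y [e [He ->]]]]|[x ->]]; last first.
  by exists l.+1, x, b; split=> // r; exact: Zspan_gen.
have /choice[m Hm] i : exists m, Zcomb m b = e i by have [m _ mE] := He i; exists m.
exists (fun r => \sum_i y i * (m i 0 r)%:~R).
under eq_bigr => i _ do rewrite -Hm ZcombE scaler_sumr.
rewrite exchange_big; apply: eq_bigr => r _; rewrite scaler_suml.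
by apply: eq_bigr => i _; rewrite scalerA.
Qed.

(* Exactness of the jet sequence at q, for the real span of b. *)
Definition exact_at q (b : 'I_l.+1 -> J1 L q) : Prop :=
  (forall a, (exists x : 'I_l.+1 -> R, a = \sum_r x r *: b r) /\ jet_val a = 0 <->
     conormal_jet F a) /\
  exists r, jet_val (b r) != 0.

Lemma jet_coord0 c t q : maximal c -> trivs L t -> cdom c q -> tdom t q ->
  jet_coord c t (0 : J1 L q) = 0.
Proof.
move=> mc At cq tq; have lin := jet_coord_linear mc At cq tq.
by have := linear_comb [::] (fun=> 0) (fun _ : 'I_1 => 0) lin; rewrite !big_nil.
Qed.

Lemma jet_val_comb q d (x : 'I_d -> R) (b : 'I_d -> J1 L q) t : trivs L t -> tdom t q ->
  t q (jet_val (\sum_r x r *: b r)) = \sum_r x r * t q (jet_val (b r)).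
Proof.
move=> At tq; have [c Ac cq] := charts_cover q.
rewrite -(jet_coord_val c) (jet_coord_comb _ _ (chart_maximal Ac)) // mxE.
by apply: eq_bigr => r _; rewrite [X in X * _]mxE [X in _ * X]mxE jet_coord_val.
Qed.

Lemma jet_partial_comb q d (x : 'I_d -> R) (b : 'I_d -> J1 L q) c t j : maximal c ->
  trivs L t -> cdom c q -> tdom t q ->
  jet_partial c t (\sum_r x r *: b r) j = \sum_r x r * jet_partial c t (b r) j.
Proof.
move=> mc At cq tq; rewrite -jet_coord_partial jet_coord_comb // mxE.
by apply: eq_bigr => r _; rewrite [X in X * _]mxE [X in _ * X]mxE jet_coord_partial.
Qed.

(** L has rank one, so surjectivity onto its fibre amounts to one jet with nonzero value, which can
    then be rescaled. *)
Lemma jet_exactP (S : set (J1_total L)) :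
  (forall p, exists2 b : 'I_l.+1 -> J1 L p, jet_fiber S p = Zspan b & exact_at b) ->
  jet_exact F S.
Proof.
move=> H p; have [b -> [Eb [r br]]] := H p; split=> [a|v].
  by rewrite -Eb Rspan_Zspan.
have [t At tp] := trivs_cover L p.
exists ((t p v / t p (jet_val (b r))) *: b r).
  apply/Rspan_Zspan; exists (fun s => if s == r then t p v / t p (jet_val (b r)) else 0).
  rewrite (bigD1 r) //= eqxx big1 ?addr0 // => s /negbTE ->.
  by rewrite scale0r.
apply: (trivs_inj At tp).
have := @jet_val_comb p 1 (fun=> t p v / t p (jet_val (b r))) (fun=> b r) t At tp.
by rewrite !big_ord1 => ->; rewrite divfK // triv_eq0.
Qed.

Lemma exact_at_fiber (S : set (J1_total L)) p (b : 'I_l.+1 -> J1 L p) :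
  jet_exact F S -> jet_fiber S p = Zspan b -> exact_at b.
Proof.
move=> /(_ p)[E1 E2] Sb; rewrite Sb in E1 E2; split=> [a|].
  by rewrite -E1 Rspan_Zspan.
apply: contrapT => /forallNP H; have [t At tp] := trivs_cover L p.
have [g _ gK] := trivs_bij At tp.
have [a /Rspan_Zspan[x ->]] := E2 (g 1).
move=> /(congr1 (t p)); rewrite gK (jet_val_comb _ _ At tp) => /eqP.
rewrite big1 1?eq_sym ?oner_eq0 // => r _.
by have /negP := H r; rewrite negbK => /eqP ->; rewrite linear0 mulr0.
Qed.

Lemma fchart_maximal c : fcharts F c -> maximal c.
Proof. exact: fcharts_maximal. Qed.

(** A move along a leaf coordinate keeps the transversal coordinates, so the difference quotient is
    eventually 0. *)
Lemma plaque_partial0 c p (f : N -> R) (j : 'I_k) : maximal c -> cdom c p ->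
  (exists2 W, nbhs p W & forall x y, W x -> W y ->
     rsubmx (c x) = rsubmx (c y) -> f x = f y) ->
  chart_partial c (lshift l j) f p = 0.
Proof.
move=> mc cp [W]; rewrite nbhsE => -[V [oV Vp] VW] fW.
have oc := maximal_chart_open mc oV.
apply/cvg_lim => //; apply: cvg_near_cst.
set e : 'rV[R]_(k + l) := delta_mx 0 (lshift l j).
have cve : (fun h : R => h *: e + c p) @ (0 : R)^' --> c p.
  rewrite -[X in _ --> X]add0r -[X in X + _](scale0r e).
  apply: cvgD; last exact: cvg_cst.
  by apply: cvgZr_tmp; apply: cvg_within; exact: cvg_id.
have nb : nbhs (c p) (c @` (cdom c `&` V)).
  by apply: open_nbhs_nbhs; split => //; exists p.
have := cve _ nb; rewrite near_simpl /= => H.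
near=> h; have [x [cx Vx] xE] : (c @` (cdom c `&` V)) (h *: e + c p) by near: h.
rewrite -xE !in_chartE //; try exact: maximal_inj.
rewrite (fW x p) ?subrr ?scaler0 //; try exact: VW.
apply/rowP => i; rewrite xE !mxE [_ == lshift _ _](_ : _ = false) ?andbF ?mulr0 ?add0r //.
by apply/negbTE; rewrite eq_sym eq_lrshift.
Unshelve. all: by end_near. Qed.

(** One foliated chart decides. The value 0 removes the derivative of the transition function of L,
    and the transversal coordinates of c are constant on the plaques of c', so leaf derivatives in
    c' combine leaf derivatives in c only. *)
Lemma conormalP c t p (a : J1 L p) : fcharts F c -> trivs L t -> cdom c p -> tdom t p ->
  conormal_jet F a <->
  jet_val a = 0 /\ forall j : 'I_k, jet_partial c t a (lshift l j) = 0.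
Proof.
move=> Fc At cp tp; split=> [[a0 aF]|[a0 ac]]; first by split=> // j; exact: aF.
split=> // c' t' Fc' At' c'p t'p j.
have [g Sg gE] := trivs_smooth At At'.
have mc := fchart_maximal Fc; have mc' := fchart_maximal Fc'.
have [_ ->] := jet_coord_change a mc At cp tp mc' At' c'p t'p Sg gE.
rewrite big_split_ord /= [X in X + _]big1 => [|i _]; last first.
  by rewrite ac a0 linear0 mulr0 mul0r addr0 mulr0.
rewrite add0r big1 // => i _.
rewrite plaque_partial0 ?mul0r //.
have [W nW WP] := fcharts_plaques Fc' Fc c'p cp.
by exists W => // x y Wx Wy /(WP x y Wx Wy) /rowP/(_ i); rewrite !mxE.
Qed.

(** A dimension count: values and transversal derivatives of combinations of the l + 1 jets b fill
    R^(1+l), so the corresponding square matrix is invertible. *)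
Lemma exact_indep q (b : 'I_l.+1 -> J1 L q) : exact_at b ->
  forall x : 'I_l.+1 -> R, \sum_r x r *: b r = 0 -> forall r, x r = 0.
Proof.
move=> [Eb [r0 br0]].
have [c Fc cq] := fcharts_cover F q; have [t At tq] := trivs_cover L q.
have mc := fchart_maximal Fc.
pose M := \matrix_r jet_coord c t (b r).
(* P drops the k leaf derivatives from the jet coordinates. *)
pose P : 'M[R]_(1 + (k + l), 1 + l) :=
  col_mx (row_mx 1%:M 0 : 'M[R]_(1, 1 + l)) (col_mx 0 (row_mx 0 1%:M : 'M[R]_(l, 1 + l))).
have coordP a : jet_coord c t a *m P =
    row_mx (const_mx (t q (jet_val a))) (\row_j jet_partial c t a (rshift k j)) :> 'rV[R]_(1 + l).
  rewrite /jet_coord /P mul_row_col -[X in X *m col_mx _ _]hsubmxK mul_row_col.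
  rewrite mulmx0 add0r !mul_mx_row !mulmx0 !mulmx1 add_row_mx addr0 add0r.
  by congr row_mx; apply/rowP => j; rewrite !mxE.
have full : row_full (M *m P).
  apply: row_full_surj => y.
  (* The multiple s of [b r0] has the required value; what is still missing is a conormal jet, and
     exactness puts it in the span. *)
  pose v : R := y 0 (lshift l 0); pose s := v / t q (jet_val (b r0)).
  pose xi := \row_j (y 0 (rshift 1 j) - s * jet_partial c t (b r0) (rshift k j)).
  have [a aE] := jet_coord_surj mc At cq tq (row_mx 0 (row_mx 0 xi)).
  have a0 : jet_val a = 0.
    apply: (trivs_inj At tq); rewrite -(jet_coord_val c) aE linear0.
    by rewrite row_mxEl mxE.
  have /Eb[[x xE] _] : conormal_jet F a.
    apply/(conormalP _ Fc At cq tq); split=> // j.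
    by rewrite -jet_coord_partial aE row_mxEr row_mxEl mxE.
  exists (\row_i x i + s *: delta_mx 0 r0).
  rewrite mulmxDl -scalemxAl mulmxA -jet_coord_comb // -xE coordP mulmxA -rowE rowK coordP.
  rewrite a0 linear0; apply/rowP => i; rewrite [LHS]mxE [X in _ + X]mxE.
  rewrite -(splitK i); case: (fintype.split _) => j; rewrite [unsplit _]/=.
    by rewrite !row_mxEl !mxE add0r /s divfK ?triv_eq0 // ord1.
  by rewrite !row_mxEr !mxE -jet_coord_partial aE !row_mxEr !mxE subrK.
have free : row_free (M *m P).
  by move: full; rewrite /row_full /row_free.
move=> x x0 r.
have : (\row_r x r) *m (M *m P) = 0.
  by rewrite mulmxA -jet_coord_comb // x0 jet_coord0 // mul0mx.
by move/eqP; rewrite mulmx_free_eq0 // => /eqP/rowP/(_ r); rewrite !mxE.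
Qed.

End LatticeAlgebra.

Lemma big_ord_lift (V : nmodType) n (i : 'I_n.+1) (G : 'I_n.+1 -> V) :
  \sum_j G j = G i + \sum_j G (lift i j).
Proof. by rewrite (bigD1_ord i). Qed.

(** * Affine coordinates of a frame of sections *)

Section Ratios.
Variables (R : realType) (k l : nat) (N : manifold R (k + l)).
Variables (F : foliation N) (L : line_bundle N).
Local Notation maximal := (in_maximal_atlas (charts N)).
Local Notation sm := (smooth_on (charts N)).
Variables (u : 'I_l.+1 -> section L) (t : trivialization L) (r0 : 'I_l.+1).
Hypothesis At : trivs L t.

Definition ratio s (x : N) : R := triv_val t (u s) x / triv_val t (u r0) x.

Lemma ratio_smooth (U : set N) s : open U -> (forall r, smooth_sec U (u r)) ->
  U `<=` tdom t -> (forall x, U x -> u r0 x != 0) -> sm U (ratio s).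
Proof.
move=> oU Su Ut u0; have SU r : sm U (triv_val t (u r)).
  by apply: smooth_on_subset (smooth_sec_triv oU At (Su r)) => x Ux; split => //; exact: Ut.
apply: smooth_onM => //; apply: smooth_onV => // x Ux.
by rewrite triv_eq0 //; [exact: u0|exact: Ut].
Qed.

Lemma sec_nonzero_open (U : set N) s : open U -> smooth_sec U s ->
  open (U `&` [set x | s x != 0 :> L x]).
Proof.
move=> oU Ss; apply: open_union_nbhd => q [Uq sq].
have [t' At' t'q] := trivs_cover L q.
have oV : open (U `&` tdom t') by apply: openI => //; exact: trivs_open.
have := smooth_on_near_neq0 oV (smooth_sec_triv oU At' Ss) (conj Uq t'q).
rewrite triv_eq0 // => /(_ sq)/near_open[W [oW Wq WP]].
exists ((U `&` tdom t') `&` W); split=> //; first exact: openI.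
by move=> x [[Ux t'x] /WP /=]; rewrite triv_eq0.
Qed.

Section AtPoint.
Variables (U : set N) (q : N) (c : chart R N (k + l)).
Hypotheses (oU : open U) (Su : forall r, smooth_sec U (u r)) (Uq : U q).
Hypotheses (Ut : U `<=` tdom t) (u0 : forall x, U x -> u r0 x != 0).
Hypotheses (mc : maximal c) (cq : cdom c q).
Let tq : tdom t q. Proof. exact: Ut. Qed.
Let te := triv_val t (u r0) q.
Let b r := j1 q (u r).
Let Sq r : smooth_at q (u r). Proof. exact: smooth_sec_at (Su r). Qed.

Let te0 : te != 0. Proof. by rewrite /te triv_eq0 //; exact: u0. Qed.

Lemma jet_partial_ratio s j : jet_partial c t (b s) j =
  ratio s q * jet_partial c t (b r0) j + te * chart_partial c j (ratio s) q.
Proof.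
rewrite !(jet_partial_j1 mc At) //.
have SU r : sm U (triv_val t (u r)).
  by apply: smooth_on_subset (smooth_sec_triv oU At (Su r)) => x Ux; split => //; exact: Ut.
rewrite (@chart_partial_ext _ _ _ _ (maximal_inj mc) U _ _
  (fun x => ratio s x * triv_val t (u r0) x)) //.
- rewrite chart_partialM //; first exact: maximal_inj.
    by apply: (smooth_on_diff mc oU) => //; exact: ratio_smooth.
  exact: (smooth_on_diff mc oU).
- exact: maximal_chart_open.
- by move=> x _ Ux; rewrite /ratio divfK // triv_eq0 //; [exact: u0|exact: Ut].
Qed.

(** Each section is its ratio times [u r0]. Value 0 means that the weighted ratios sum to 0 at q, so
    the terms containing the derivative of [u r0] cancel. *)
Lemma jet_comb_ratio (x : 'I_l.+1 -> R) : jet_val (\sum_r x r *: b r) = 0 ->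
  forall j, jet_partial c t (\sum_r x r *: b r) j =
    te * \sum_i x (lift r0 i) * chart_partial c j (ratio (lift r0 i)) q.
Proof.
move=> a0 j; rewrite jet_partial_comb // (big_ord_lift r0) /=.
have := jet_val_comb x b At tq; rewrite a0 linear0 (big_ord_lift r0) /=.
have valE r : t q (jet_val (b r)) = ratio r q * te.
  by rewrite jet_val_j1 // /ratio divfK.
under eq_bigr => i _ do rewrite valE mulrA.
rewrite -mulr_suml valE mulrA -mulrDl => /esym/eqP; rewrite mulf_eq0 (negbTE te0) orbF.
have -> : ratio r0 q = 1 by rewrite /ratio divff.
rewrite mulr1 addr_eq0 => /eqP ->.
under [in LHS]eq_bigr => i _ do rewrite jet_partial_ratio mulrDr mulrA.
rewrite big_split /= -mulr_suml addrA mulNr addNr add0r mulr_sumr.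
by apply: eq_bigr => i _; rewrite mulrCA.
Qed.

(** Weights y on the sections other than [u r0], completed by the only weight on [u r0] that gives
    the value 0. *)
Let coef (y : 'rV[R]_l) (r : 'I_l.+1) : R :=
  if unlift r0 r is Some i then y 0 i else - \sum_i y 0 i * ratio (lift r0 i) q.

Let coefE y : jet_val (\sum_r coef y r *: b r) = 0 /\
  forall j, jet_partial c t (\sum_r coef y r *: b r) j =
    te * \sum_i y 0 i * chart_partial c j (ratio (lift r0 i)) q.
Proof.
have cl i : coef y (lift r0 i) = y 0 i by rewrite /coef liftK.
have a0 : jet_val (\sum_r coef y r *: b r) = 0.
  apply: (trivs_inj At tq); rewrite linear0 jet_val_comb // (big_ord_lift r0) /=.
  have valE r : t q (jet_val (b r)) = ratio r q * te.
    by rewrite jet_val_j1 // /ratio divfK.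
  rewrite [coef y r0]/coef unlift_none.
  under eq_bigr => i _ do rewrite valE cl mulrA.
  rewrite -mulr_suml mulNr valE [ratio r0 q]divff // mul1r.
  by rewrite -/te addNr.
split=> // j; rewrite jet_comb_ratio //; congr (_ * _).
by apply: eq_bigr => i _; rewrite cl.
Qed.

Definition ratio_mx : 'M[R]_l :=
  \matrix_(i, j) chart_partial c (rshift k j) (ratio (lift r0 i)) q.

(** By [jet_comb_ratio], the jets of value 0 in the span are, up to the nonzero number [te], the
    combinations of the differentials of the ratios. They are all conormal when the leaf derivatives
    vanish, and then exhaust the conormal jets when the transversal Jacobian is invertible. *)
Lemma exact_ratioP : fcharts F c ->
  exact_at F b <-> (forall (j : 'I_k) i, chart_partial c (lshift l j) (ratio (lift r0 i)) q = 0) /\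
    ratio_mx \in unitmx.
Proof.
move=> Fc; have cP a := conormalP a Fc At cq tq.
split=> [[Eb _]|[leaf0 Xu]].
  split=> [j i|].
    have [a0 aE] := coefE (delta_mx 0 i).
    have /Eb/cP[_ /(_ j)] : (exists x, \sum_r coef (delta_mx 0 i) r *: b r = \sum_r x r *: b r) /\
      jet_val (\sum_r coef (delta_mx 0 i) r *: b r) = 0.
      by split=> //; exists (coef (delta_mx 0 i)).
    rewrite aE (bigD1 i) //= big1 => [|i' /negbTE ii']; last by rewrite mxE ii' andbF mul0r.
    by rewrite mxE !eqxx mul1r addr0 => /eqP; rewrite mulf_eq0 (negbTE te0) => /eqP.
  rewrite -row_full_unit; apply: row_full_surj => y.
  have [a aE] := jet_coord_surj mc At cq tq (row_mx 0 (row_mx 0 (te *: y))).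
  have a0 : jet_val a = 0.
    apply: (trivs_inj At tq); rewrite -(jet_coord_val c) aE linear0.
    by rewrite row_mxEl mxE.
  have /Eb[[x xE] _] : conormal_jet F a.
    apply/cP; split=> // j.
    by rewrite -jet_coord_partial aE row_mxEr row_mxEl mxE.
  exists (\row_i x (lift r0 i)); apply/rowP => j; apply: (mulfI te0).
  have := jet_coord_partial c t a (rshift k j); rewrite aE !row_mxEr mxE => ->.
  move: a0; rewrite xE => a0; rewrite jet_comb_ratio //; congr (_ * _).
  by rewrite mxE; apply: eq_bigr => i _; rewrite !mxE.
split; last by exists r0; rewrite jet_val_j1 //; exact: u0.
move=> a; split=> [[[x ->] a0]|/cP[a0 aF]].
  apply/cP; split=> // j; rewrite jet_comb_ratio // big1 ?mulr0 // => i _.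
  by rewrite leaf0 mulr0.
pose y := te^-1 *: (\row_j jet_partial c t a (rshift k j)) *m invmx ratio_mx.
have [b0 bE] := coefE y.
split=> //; exists (coef y); apply: (jet_coord_inj mc At cq tq).
apply/rowP => i; rewrite -(splitK i); case: (fintype.split i) => j; rewrite [unsplit _]/=.
  by rewrite ord1 !jet_coord_val a0 b0.
rewrite !jet_coord_partial bE -(splitK j); case: (fintype.split j) => j'; rewrite [unsplit _]/=.
  by rewrite aF big1 ?mulr0 // => i' _; rewrite leaf0 mulr0.
have : y *m ratio_mx = te^-1 *: (\row_j jet_partial c t a (rshift k j)).
  by rewrite /y -mulmxA mulVmx // mulmx1.
move=> /rowP/(_ j'); rewrite !mxE => E.
rewrite [X in te * X](_ : _ = te^-1 * jet_partial c t a (rshift k j')) ?mulVKf //.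
by rewrite -E; apply: eq_bigr => i' _; rewrite !mxE.
Qed.

End AtPoint.
End Ratios.

(* The injectivity half of the inverse function theorem, in the last l variables. *)
Lemma transversal_injective (R : realType) (k l : nat) (f : 'I_l -> 'rV[R]_(k + l) -> R)
    (O : set 'rV[R]_(k + l)) y0 :
  open O -> O y0 -> (forall i, smooth O (f i)) ->
  (forall y i (j : 'I_k), O y -> partial (lshift l j) (f i) y = 0) ->
  (\matrix_(i, j) partial (rshift k j) (f i) y0) \in unitmx ->
  exists2 B, nbhs y0 B & forall y y', B y -> B y' ->
    (rsubmx y = rsubmx y' <-> forall i, f i y = f i y').
Proof.
move=> oO Oy0 Sf leaf0; set X := \matrix_(i, j) _ => Xu.
have XT : X^T *m invmx X^T = 1%:M by rewrite mulmxV // unitmx_tr.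
have [e e0 He] := row_free_perturb XT.
have nO : nbhs y0 O by exact: open_nbhs_nbhs.
have nP : \forall y \near y0, forall ij : 'I_l * 'I_l,
    `|partial (rshift k ij.2) (f ij.1) y0 - partial (rshift k ij.2) (f ij.1) y| < e.
  apply: (@filter_forall _ _ (fun ij y => `|partial (rshift k ij.2) (f ij.1) y0 -
    partial (rshift k ij.2) (f ij.1) y| < e) (nbhs y0)) => -[i j] /=.
  have := smooth_continuous (smooth_partial (rshift k j) (Sf i)) Oy0.
  by move=> /cvgrPdist_lt/(_ e e0).
have : nbhs y0 (O `&` [set y | forall ij : 'I_l * 'I_l,
    `|partial (rshift k ij.2) (f ij.1) y0 - partial (rshift k ij.2) (f ij.1) y| < e]).
  exact: filterI.
move=> /nbhs_ballP[d /= d0 dP]; exists (ball y0 d); first exact: nbhsx_ballx.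
move=> y y' By By'.
have seg (s : R) : 0 <= s <= 1 -> ball y0 d (y + s *: (y' - y)).
  move=> /andP[s0 s1]; move: By By'; rewrite -!ball_normE /ball_ /= => By By'.
  have -> : y0 - (y + s *: (y' - y)) = (1 - s) *: (y0 - y) + s *: (y0 - y').
    by apply/rowP => i; rewrite !mxE; ring.
  rewrite (le_lt_trans (ler_normD _ _)) // !normrZ (ger0_norm s0) ger0_norm ?subr_ge0 //.
  have -> : d = (1 - s) * d + s * d by ring.
  case: (ltP 0 s) => [s0'|s0'].
    by apply: ler_ltD; [rewrite ler_wpM2l ?subr_ge0 // ltW|rewrite ltr_pM2l].
  have -> : s = 0 by apply/eqP; rewrite eq_le s0 s0'.
  by rewrite !mul0r !addr0 subr0 !mul1r.
have MV i : exists2 z, ball y0 d z & f i y' - f i y =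
    \sum_(j < l) (rsubmx (y' - y)) 0 j * partial (rshift k j) (f i) z.
  have [|s s01 E] := @mean_value R _ (f i) y y'.
    by move=> s /seg /dP[Oz _]; exact: smooth_differentiable (Sf i) Oz.
  exists (y + s *: (y' - y)); first exact: seg.
  rewrite E big_split_ord /= big1 ?add0r => [|j _].
    by apply: eq_bigr => j _; rewrite [in RHS]mxE.
  by rewrite leaf0 ?mulr0 //; have /dP[] := seg s s01.
have /choice[z zP] i : exists z, ball y0 d z /\ f i y' - f i y =
    \sum_(j < l) (rsubmx (y' - y)) 0 j * partial (rshift k j) (f i) z.
  by have [w] := MV i; exists w.
split=> [yy' i|fyy'].
  apply/eqP; rewrite eq_sym -subr_eq0 (proj2 (zP i)) big1 // => j _.
  by rewrite linearB /= yy' subrr mxE mul0r.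
(* The mean value theorem gives a separate point [z i] for each component, so B is not a Jacobian at
   one point; it is still entrywise close to the transpose of X. *)
pose B := \matrix_(j, i) partial (rshift k j) (f i) (z i) : 'M[R]_l.
have AB i j : `|X^T i j - B i j| < e.
  by rewrite !mxE; have [/dP[_ /(_ (j, i))]] := zP j.
have := He B AB (rsubmx (y' - y)).
have -> : rsubmx (y' - y) *m B = 0.
  apply/rowP => i; have [_] := zP i; rewrite fyy' subrr => /esym E.
  rewrite !mxE -[RHS]E.
  by apply: eq_bigr => j _; rewrite [X in _ * X]mxE.
rewrite mul0mx normr0 mulr0 normr_le0 => /eqP.
by rewrite linearB /= => /eqP; rewrite subr_eq0 => /eqP.
Qed.

(** * Projective coordinates *)

Section Lines.
Variables (R : realType) (l : nat).
Implicit Types (w v : 'cV[R]_l.+1) (x y : RP R l).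

Definition line_of w : set 'cV[R]_l.+1 := [set a *: w | a in setT].

Lemma line_ofZ (a : R) w : a != 0 -> line_of (a *: w) = line_of w.
Proof.
move=> a0; apply/seteqP; split=> _ [s _ <-].
  by exists (s * a) => //; rewrite scalerA.
by exists (s / a) => //; rewrite scalerA divfK.
Qed.

Lemma line_of_self w : line_of w w. Proof. by exists 1 => //; rewrite scale1r. Qed.

Lemma line_of_eq v w : line_of v = line_of w -> w != 0 -> exists2 a : R, a != 0 & w = a *: v.
Proof.
move=> E w0; have : line_of v w by rewrite E; exact: line_of_self.
by move=> [a _ aE]; exists a => //; apply: contra_neq w0 => a0; rewrite -aE a0 scale0r.
Qed.

Lemma proj_line_of (A : 'M[int]_l.+1) x w : line x = line_of w ->
  proj_act A x = line_of (map_mx intr A *m w).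
Proof.
rewrite /proj_act => ->; apply/seteqP; split=> [_ [_ [a _ <-] <-]|_ [a _ <-]].
  by exists a => //; rewrite scalemxAr.
by exists (a *: w); [exists a|rewrite scalemxAr].
Qed.

Lemma rp_vecP x : rp_vec x != 0 /\ line x = line_of (rp_vec x).
Proof. by rewrite /rp_vec; case: cid2. Qed.

Lemma line_of_neq0 x w : line x = line_of w -> w != 0.
Proof.
have [v0 ->] := rp_vecP x => E; apply: contra_neq v0 => w0.
have : line_of w (rp_vec x) by rewrite -E; exact: line_of_self.
by move=> [a _ <-]; rewrite w0 scaler0.
Qed.

Lemma rp_eq x y : line x = line y -> x = y.
Proof.
case: x y => [A hA] [B hB] /= AB; subst B; congr MkRP; exact: Prop_irrelevance.
Qed.

(** [rp_vec] is an arbitrary nonzero vector of the line; the chart domains and the affine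
    coordinates, being homogeneous of degree 0, can be computed from any other. *)
Lemma rp_chart_line x w : line x = line_of w ->
  (forall r, (rp_vec x r 0 != 0) = (w r 0 != 0)) /\
  forall r i, rp_chart R r x 0 i = w (lift r i) 0 / w r 0.
Proof.
move=> xw; have [v0 xv] := rp_vecP x.
have [a a0 vE] : exists2 a : R, a != 0 & rp_vec x = a *: w.
  by apply: line_of_eq => //; rewrite -xw.
split=> [r|r i]; first by rewrite vE mxE mulf_eq0 (negbTE a0).
by rewrite mxE vE !mxE -mulf_div divff // mul1r.
Qed.

Lemma rp_lineP w : w != 0 -> exists2 v, v != 0 & line_of w = line_of v.
Proof. by move=> w0; exists w. Qed.

Lemma rp0P : exists2 v : 'cV[R]_l.+1, v != 0 & line_of (delta_mx 0 0) = line_of v.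
Proof.
apply: rp_lineP; apply/eqP => /matrixP/(_ 0 0); rewrite !mxE !eqxx => /eqP.
by rewrite oner_eq0.
Qed.

Definition rp_of w : RP R l :=
  if pselect (w != 0) is left w0 then MkRP (rp_lineP w0) else MkRP rp0P.

Lemma rp_ofE w : w != 0 -> line (rp_of w) = line_of w.
Proof. by rewrite /rp_of; case: pselect. Qed.

End Lines.

Section Gradient.
Variables (R : realType) (n : nat) (N : manifold R n) (l : nat).
Local Notation maximal := (in_maximal_atlas (charts N)).

Definition grad_mx (c : chart R N n) (f : 'I_l -> N -> R) p : 'M[R]_(n, l) :=
  \matrix_(j, i) chart_partial c j (f i) p.

(** By the chain rule one gradient is a Jacobian times the other. Applied in both directions, this
    makes the rank independent of the chart. *)
Lemma grad_mx_rank (a c : chart R N n) f (U : set N) p : maximal a -> maximal c ->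
  open U -> U p -> cdom a p -> cdom c p -> (forall i, smooth_on (charts N) U (f i)) ->
  (\rank (grad_mx a f p) <= \rank (grad_mx c f p))%N.
Proof.
move=> ma mc oU Up ap cp Sf.
have -> : grad_mx a f p =
    \matrix_(j, i) chart_partial a j (fun x => c x 0 i) p *m grad_mx c f p.
  apply/matrixP => j i; rewrite !mxE (maximal_partial_change j ma mc oU (Sf i)) //.
  by apply: eq_bigr => h _; rewrite !mxE.
exact: mxrankM_maxr.
Qed.

Lemma maximal_continuous (c : chart R N n) p : maximal c -> cdom c p ->
  {for p, continuous c}.
Proof.
move=> mc cp; have [a Aa ap] := charts_cover p.
have ai := charts_inj Aa.
pose G y : 'rV[R]_n := \row_i in_chart a (fun x => c x 0 i) y.
have GE x : cdom a x -> G (a x) = c x.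
  by move=> ax; apply/rowP => i; rewrite mxE in_chartE.
have cG : {for p, continuous (G \o a)}.
  apply: continuous_comp; first exact: chart_continuous.
  apply: (@smooth_continuous_row _ _ _ (a @` (cdom a `&` cdom c))); last by exists p.
  move=> i; have oc := image_chart_open Aa (maximal_dom_open mc).
  by apply: (smooth_ext oc _ (smooth_on_coord mc i Aa)) => y _; rewrite mxE.
move: cG; rewrite /prop_for /continuous_at /= GE //.
apply: cvg_trans; apply: near_eq_cvg.
apply: filterS (open_nbhs_nbhs (conj (charts_open Aa) ap)) => x ax.
by rewrite /= GE.
Qed.

End Gradient.

(** * Maps to projective space given by frames *)

Section FrameMaps.
Variables (R : realType) (k l : nat) (N : manifold R (k + l)).
Variables (F : foliation N) (L : line_bundle N).
Local Notation maximal := (in_maximal_atlas (charts N)).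
Local Notation sm := (smooth_on (charts N)).
Implicit Types (u : 'I_l.+1 -> section L).

Definition frame_vec (t : trivialization L) u q : 'cV[R]_l.+1 :=
  \col_r triv_val t (u r) q.

Definition triv_at (q : N) : trivialization L := projT1 (cid2 (trivs_cover L q)).

Lemma triv_atP q : trivs L (triv_at q) /\ tdom (triv_at q) q.
Proof. by rewrite /triv_at; case: cid2. Qed.

(** The line with homogeneous coordinates the [u r q]; by [frame_lineE] the chosen trivialization
    does not matter. It is kept as a set, so that it makes sense before the sections are known to
    have no common zero. *)
Definition frame_line u q := line_of (frame_vec (triv_at q) u q).

Lemma frame_vec_change t t' u q : trivs L t -> trivs L t' -> tdom t q -> tdom t' q ->
  exists2 a : R, a != 0 & frame_vec t' u q = a *: frame_vec t u q.
Proof.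
move=> At At' tq t'q; have [g _ gE] := trivs_smooth At At'.
exists (g q).
  have [h _ hK] := trivs_bij At' t'q.
  apply/eqP => g0; have := gE q (h 1) tq t'q; rewrite hK g0 mul0r => /eqP.
  by rewrite oner_eq0.
by apply/colP => r; rewrite !mxE /triv_val gE.
Qed.

Lemma frame_lineE t u q : trivs L t -> tdom t q -> frame_line u q = line_of (frame_vec t u q).
Proof.
move=> At tq; have [At' t'q] := triv_atP q.
by have [a a0 E] := frame_vec_change u At At' tq t'q; rewrite /frame_line E line_ofZ.
Qed.

Section Chi.
Variables (U : set N) (u : 'I_l.+1 -> section L) (chi : N -> RP R l).
Hypotheses (oU : open U) (Su : forall r, smooth_sec U (u r)).
Hypothesis chiE : forall q, U q -> line (chi q) = frame_line u q.

Let chi_vec t q : trivs L t -> tdom t q -> U q -> line (chi q) = line_of (frame_vec t u q).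
Proof. by move=> At tq Uq; rewrite chiE // (frame_lineE u At). Qed.

Lemma frame_neq0 q : U q -> exists r, u r q != 0.
Proof.
move=> Uq; have [At tq] := triv_atP q.
apply: contrapT => /forallNP H; have /negP[] := line_of_neq0 (chi_vec At tq Uq).
apply/eqP/colP => r; have /negP := H r; rewrite negbK !mxE => /eqP E.
by rewrite /triv_val E linear0.
Qed.

Lemma chi_chart_dom r q : U q -> (rp_vec (chi q) r 0 != 0) = (u r q != 0).
Proof.
move=> Uq; have [At tq] := triv_atP q.
have [-> _] := rp_chart_line (chi_vec At tq Uq).
by rewrite mxE /triv_val triv_eq0.
Qed.

Lemma chi_chart_ratio t r i q : trivs L t -> tdom t q -> U q ->
  rp_chart R r (chi q) 0 i = ratio u t r (lift r i) q.
Proof.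
move=> At tq Uq; have [_ ->] := rp_chart_line (chi_vec At tq Uq).
by rewrite !mxE.
Qed.

Lemma chi_eq_ratio t r x y : trivs L t -> tdom t x -> tdom t y -> U x -> U y ->
  u r x != 0 -> u r y != 0 ->
  chi x = chi y <-> forall i, ratio u t r (lift r i) x = ratio u t r (lift r i) y.
Proof.
move=> At tx ty Ux Uy ux uy; split=> [E i|E].
  by rewrite -!(chi_chart_ratio _ _ At) // E.
apply: rp_eq; rewrite (chi_vec At tx Ux) (chi_vec At ty Uy).
have tux : triv_val t (u r) x != 0 by rewrite /triv_val triv_eq0.
have tuy : triv_val t (u r) y != 0 by rewrite /triv_val triv_eq0.
suff -> : frame_vec t u x =
    (triv_val t (u r) x / triv_val t (u r) y) *: frame_vec t u y.
  by rewrite line_ofZ // mulf_neq0 // invr_neq0.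
apply/colP => s; rewrite !mxE; case: (unliftP r s) => [i ->|->]; last by rewrite divfK.
have := E i; rewrite /ratio => /(congr1 (fun z => z * triv_val t (u r) x)).
by rewrite divfK // => ->; field.
Qed.

Let nbr (t : trivialization L) r := U `&` tdom t `&` [set x | u r x != 0].

Let nbr_open t r : trivs L t -> open (nbr t r).
Proof.
move=> At; have oV : open (U `&` tdom t) by apply: openI => //; exact: trivs_open.
have -> : nbr t r = (U `&` tdom t) `&` (U `&` [set x | u r x != 0]).
  by apply/seteqP; split=> [x [[? ?] ?]|x [[? ?] [? ?]]].
by apply: openI => //; exact: sec_nonzero_open.
Qed.

Let Snbr (t : trivialization L) r s : smooth_sec (nbr t r) (u s).
Proof. by apply: smooth_sec_subset (Su s) => x [[]]. Qed.

Let nbr_ratio t r s : trivs L t -> sm (nbr t r) (ratio u t r s).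
Proof.
by move=> At; apply: ratio_smooth => //; [exact: nbr_open|move=> x [[]]|move=> x []].
Qed.

Let nbr_exactP t r c q : trivs L t -> fcharts F c -> cdom c q -> nbr t r q ->
  exact_at F (fun s => j1 q (u s)) <->
  (forall (j : 'I_k) i, chart_partial c (lshift l j) (ratio u t r (lift r i)) q = 0) /\
    ratio_mx u t r q c \in unitmx.
Proof.
move=> At Fc cq nq; apply: (exact_ratioP At (nbr_open r At) (@Snbr t r) nq) => //.
- by move=> x [[]].
- by move=> x [].
- exact: fchart_maximal Fc.
Qed.

Lemma grad_ratio_mx t r c q :
  (forall (j : 'I_k) i, chart_partial c (lshift l j) (ratio u t r (lift r i)) q = 0) ->
  \rank (grad_mx c (fun i => ratio u t r (lift r i)) q) = \rank (ratio_mx u t r q c).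
Proof.
move=> leaf0; have -> : grad_mx c (fun i => ratio u t r (lift r i)) q =
    col_mx 0 (ratio_mx u t r q c)^T.
  apply/matrixP => j i; rewrite mxE -(splitK j).
  case: (fintype.split j) => j'; rewrite [unsplit _]/= ?col_mxEu ?col_mxEd.
    by rewrite leaf0 mxE.
  by rewrite !mxE.
by rewrite rank_col_0mx mxrank_tr.
Qed.

Lemma chi_grad t r q a : trivs L t -> nbr t r q -> maximal a -> cdom a q ->
  \matrix_(j < k + l, i < l) partial j (in_chart a (fun x => rp_chart R r (chi x) 0 i)) (a q) =
  grad_mx a (fun i => ratio u t r (lift r i)) q.
Proof.
move=> At nq ma aq; apply/matrixP => j i; rewrite !mxE.
apply: (@chart_partial_ext _ _ _ _ (maximal_inj ma) (nbr t r)) => //.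
  by apply: maximal_chart_open => //; exact: nbr_open.
by move=> x _ [[Ux tx] _]; rewrite (chi_chart_ratio _ _ At).
Qed.

(** The rank l is read in a foliated chart, where only the invertible transversal block is nonzero,
    and carried to the atlas chart by two rank inequalities. *)
Lemma exact_submersion : (forall q, U q -> exact_at F (fun s => j1 q (u s))) ->
  submersion_on (charts N) U (@rp_charts R l) chi.
Proof.
move=> ex; split=> [_ [r _ <-]|q a _ Uq Aa [r _ <-] aq].
  set V := _ `&` _; have VE : V = U `&` [set x | u r x != 0].
    by apply/seteqP; split=> x [Ux ux]; split=> //=; [rewrite -chi_chart_dom|
      rewrite chi_chart_dom].
  have oV : open V by rewrite VE; exact: sec_nonzero_open.
  split=> [|i]; first exact/atlas_openP.
  apply: smooth_on_local => p; rewrite VE => -[Up up].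
  have [t At tp] := trivs_cover L p; exists (nbr t r) => //.
  apply: (smooth_on_ext (nbr_open r At) (f := ratio u t r (lift r i))) => [x|].
    by move=> [[Ux tx] _]; rewrite (chi_chart_ratio _ _ At).
  exact: nbr_ratio.
rewrite /= chi_chart_dom // => uq.
have [t At tq] := trivs_cover L q; have nq : nbr t r q by [].
have ma := chart_maximal Aa; rewrite (chi_grad At nq ma aq).
have [c Fc cq] := fcharts_cover F q; have mc := fchart_maximal Fc.
have [leaf0 Xu] := (nbr_exactP At Fc cq nq).1 (ex q Uq).
have rk := grad_ratio_mx leaf0; rewrite mxrank_unit // in rk.
have on := nbr_open r At; have Sr i := nbr_ratio r (lift r i) At.
have le1 := grad_mx_rank ma mc on nq aq cq Sr.
have le2 := grad_mx_rank mc ma on nq cq aq Sr.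
by apply/eqP; rewrite eqn_leq (leq_trans le1) ?rk //= (leq_trans _ le2) ?rk.
Qed.

Lemma exact_locally_defines : (forall q, U q -> exact_at F (fun s => j1 q (u s))) ->
  locally_defines F U chi.
Proof.
move=> ex p c Up Fc cp; have mc := fchart_maximal Fc.
have [r up] := frame_neq0 Up; have [t At tp] := trivs_cover L p.
have np : nbr t r p by []. have on := nbr_open r At.
have [|||||B nB BP] := @transversal_injective R k l
  (fun i => in_chart c (ratio u t r (lift r i))) (c @` (cdom c `&` nbr t r)) (c p).
- exact: maximal_chart_open.
- by exists p.
- by move=> i; apply: smooth_on_chart => //; exact: nbr_ratio.
- move=> _ i j [x [cx nx] <-].
  by have [leaf0 _] := (nbr_exactP At Fc cx nx).1 (ex x nx.1.1); exact: leaf0.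
- by have [_] := (nbr_exactP At Fc cp np).1 (ex p Up).
exists (nbr t r `&` cdom c `&` [set x | B (c x)]).
  apply: filterI; last exact: maximal_continuous.
  by apply: open_nbhs_nbhs; split => //; apply: openI => //; exact: maximal_dom_open.
move=> x y [[[[Ux tx] ux] cx] Bx] [[[[Uy ty] uy] cy] By].
rewrite BP // (chi_eq_ratio At tx ty Ux Uy ux uy).
by split=> H i; have := H i; rewrite !in_chartE //; exact: maximal_inj.
Qed.

(** The ratios are constant on plaques, which kills their leaf derivatives; the rank l of the full
    gradient is then that of its square transversal block. *)
Lemma submersion_exact (U' : set N) : U `<=` U' ->
  submersion_on (charts N) U' (@rp_charts R l) chi -> locally_defines F U' chi ->
  forall q, U q -> exact_at F (fun s => j1 q (u s)).
Proof.
move=> UU' [_ rk] ld q Uq.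
have [c Fc cq] := fcharts_cover F q; have mc := fchart_maximal Fc.
have [r uq] := frame_neq0 Uq; have [t At tq] := trivs_cover L q.
have nq : nbr t r q by []. have on := nbr_open r At.
apply/(nbr_exactP At Fc cq nq).
have leaf0 (j : 'I_k) i : chart_partial c (lshift l j) (ratio u t r (lift r i)) q = 0.
  apply: plaque_partial0 => //; have [W nW WP] := ld q c (UU' _ Uq) Fc cq.
  exists (W `&` nbr t r); first by apply: filterI => //; exact: open_nbhs_nbhs.
  move=> x y [Wx [[Ux tx] ux]] [Wy [[Uy ty] uy]] /(WP x y Wx Wy).
  by move/(chi_eq_ratio At tx ty Ux Uy ux uy).
split=> //; have [a Aa aq] := charts_cover q; have ma := chart_maximal Aa.
have /rk := UU' _ Uq; move=> /(_ a (rp_chart R r) Aa _ aq) H.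
have {}H : \rank (grad_mx a (fun i => ratio u t r (lift r i)) q) = l.
  by rewrite -(chi_grad At nq ma aq) H //; [exists r|rewrite /= chi_chart_dom].
rewrite -row_full_unit /row_full eqn_leq rank_leq_row -(grad_ratio_mx leaf0).
have Sr i := nbr_ratio r (lift r i) At.
by have := grad_mx_rank ma mc on nq aq cq Sr; rewrite H.
Qed.

End Chi.
End FrameMaps.

(** * Sheets of the lattice in the total space of J^1 L *)

Section Sheets.
Variables (R : realType) (k l : nat) (N : manifold R (k + l)).
Variables (F : foliation N) (L : line_bundle N).
Local Notation maximal := (in_maximal_atlas (charts N)).
Local Notation sm := (smooth_on (charts N)).
Local Notation pt := (@jet_point R (k + l) N L).
Implicit Types (S : set (J1_total L)) (m : 'rV[int]_l.+1).

Definition lattice_frame S (W : set N) (u : 'I_l.+1 -> section L) : Prop :=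
  [/\ open W, forall r, smooth_sec W (u r),
      forall q, W q -> jet_fiber S q = Zspan (fun r => j1 q (u r))
    & forall q, W q -> exact_at F (fun r => j1 q (u r))].

Section Tubes.
Variables (u : 'I_l.+1 -> section L) (c : chart R N (k + l)) (t : trivialization L).
Hypotheses (Ac : charts N c) (At : trivs L t).
Let mc := chart_maximal Ac.
Local Notation jc := (jet_chart c t).
Let ji : set_inj (cdom jc) jc. Proof. exact: jet_chart_inj. Qed.

Definition frame_mx q : 'M[R]_(l.+1, 1 + (k + l)) := \matrix_r sec_coord c t (u r) q.

Lemma frame_mx_smooth U r j : open U -> U `<=` cdom c -> U `<=` tdom t ->
  smooth_sec U (u r) -> sm U (fun q => frame_mx q r j).
Proof.
move=> oU Uc Ut Su; apply: (smooth_on_ext oU (f := fun q => sec_coord c t (u r) q 0 j)).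
  by move=> x _; rewrite [in RHS]mxE.
exact: sec_coord_smooth.
Qed.

Lemma jet_coord_frame q d (x : 'I_l.+1 -> R) : cdom c q -> tdom t q ->
  (forall r, smooth_at q (u r)) -> d = \row_r x r ->
  jet_coord c t (\sum_r x r *: j1 q (u r)) = d *m frame_mx q.
Proof.
move=> cq tq Su ->; rewrite (jet_coord_comb _ _ mc At cq tq); congr (_ *m _).
by apply/row_matrixP => r; rewrite !rowK jet_coord_j1.
Qed.

Lemma frame_mx_free p : (forall r, smooth_at p (u r)) ->
  exact_at F (fun r => j1 p (u r)) -> cdom c p -> tdom t p -> row_free (frame_mx p).
Proof.
move=> Sp ex cp tp.
rewrite -kermx_eq0; apply/eqP/row_matrixP => i; rewrite row0.
set v := row i _; have v0 : v *m frame_mx p = 0 by rewrite /v -row_mul mulmx_ker row0.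
apply/rowP => r; rewrite [RHS]mxE; apply: (exact_indep ex (x := fun r => v 0 r)).
apply: (jet_coord_inj mc At cp tp).
rewrite (jet_coord_frame (d := v)) ?v0 ?jet_coord0 //.
by apply/rowP => s; rewrite mxE.
Qed.

(** G is a right inverse of the frame matrix at p only, but the inequality survives on a
    neighbourhood. For integer rows v it keeps distinct lattice points over q apart, uniformly in
    q. *)
Lemma frame_mx_perturb W p : open W -> W p -> (forall r, smooth_sec W (u r)) ->
  exact_at F (fun r => j1 p (u r)) -> cdom c p -> tdom t p ->
  exists U (G : 'M[R]_(1 + (k + l), l.+1)),
    [/\ open U, U p, U `<=` W `&` (cdom c `&` tdom t)
      & forall q, U q -> forall v : 'rV[R]_l.+1, `|v| <= 2 * `|v *m frame_mx q *m G|].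
Proof.
move=> oW Wp Su ex cp tp.
have Sp r : smooth_at p (u r) by exact: smooth_sec_at (Su r).
have free : row_free (frame_mx p) by apply: frame_mx_free.
have [G MG] := row_freeP free; have [e e0 He] := row_free_perturb MG.
pose V := W `&` (cdom c `&` tdom t).
have oV : open V.
  by apply: openI => //; apply: openI; [exact: charts_open|exact: trivs_open].
have Vp : V p by [].
have SV r j : sm V (fun q => frame_mx q r j).
  apply: frame_mx_smooth => //; try by move=> x [_ []].
  by apply: smooth_sec_subset (Su r) => x [].
have nP : nbhs p [set q | forall ij, `|frame_mx p ij.1 ij.2 - frame_mx q ij.1 ij.2| < e].
  apply: (@filter_forall _ _ (fun ij q => `|frame_mx p ij.1 ij.2 - frame_mx q ij.1 ij.2| < e)
    (nbhs p)) => -[i j] /=.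
  by have /cvgrPdist_lt/(_ e e0) := smooth_on_continuous oV (SV i j) Vp.
have [U [oU Up UP]] := near_open (filterI (open_nbhs_nbhs (conj oV Vp)) nP).
exists U, G; split=> // [q /UP[]|q /UP[_ Pq]] //.
by apply: He => i j; exact: (Pq (i, j)).
Qed.

Variables (U : set N) (G : 'M[R]_(1 + (k + l), l.+1)).
Hypotheses (oU : open U) (Uc : U `<=` cdom c) (Ut : U `<=` tdom t).
Hypothesis Su : forall r, smooth_sec U (u r).
Hypothesis UG : forall q, U q -> forall v : 'rV[R]_l.+1, `|v| <= 2 * `|v *m frame_mx q *m G|.

Let Sq q r : U q -> smooth_at q (u r).
Proof. by move=> Uq; exact: smooth_sec_at (Su r). Qed.

Lemma jet_coord_Zcomb q m : U q ->
  jet_coord c t (Zcomb m (fun r => j1 q (u r))) = map_mx intr m *m frame_mx q.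
Proof.
move=> Uq; rewrite ZcombE; apply: jet_coord_frame.
- exact: Uc.
- exact: Ut.
- by move=> r; exact: Sq.
- by apply/rowP => r; rewrite !mxE.
Qed.

Definition jet_offset m (a : J1_total L) : 'rV[R]_(1 + (k + l)) :=
  jet_coord c t (projT2 a) - map_mx intr m *m frame_mx (pt a).

Lemma jet_offsetE m a j : jet_offset m a 0 j =
  jet_coord c t (projT2 a) 0 j - (map_mx intr m *m frame_mx (pt a)) 0 j.
Proof. by rewrite /jet_offset [LHS]mxE [X in _ + X]mxE. Qed.

(** A neighbourhood of the sheet m, with the deviation measured through G. Radius 1/4 isolates it:
    another lattice point in the tube would differ by an integer row of norm at most 2 * 1/4 < 1. *)
Definition tube m : set (J1_total L) :=
  [set a | U (pt a) /\ `|jet_offset m a *m G| < 4^-1].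

Lemma tube_dom m : tube m `<=` cdom jc.
Proof. by move=> a [Ua _]; split; [exact: Uc|exact: Ut]. Qed.

Let sheet_coord_smooth m j : sm U (fun q => (map_mx intr m *m frame_mx q : 'rV[R]_(1 + (k + l))) 0 j).
Proof.
apply: (smooth_on_ext oU (f := fun q => \sum_r (m 0 r)%:~R * frame_mx q r j)).
  by move=> q _; rewrite [in RHS]mxE; apply: eq_bigr => r _; rewrite [map_mx _ _ _ _]mxE.
apply: smooth_on_sum => // r _; apply: smooth_onM => //; first exact: smooth_on_cst.
exact: frame_mx_smooth.
Qed.

Let D0 := pt @^-1` U.
Let oD0 : chart_open jc D0. Proof. exact: jet_chart_open. Qed.

Let offset_smooth m j : chart_smooth jc D0 (fun a => jet_offset m a 0 j).
Proof.
pose f (a : J1_total L) := jc a 0 (rshift (k + l) j) +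
  - ((fun q => (map_mx intr m *m frame_mx q : 'rV[R]_(1 + (k + l))) 0 j) \o pt) a.
apply: (chart_smooth_ext ji oD0 (f := f)).
  by move=> a _ _; rewrite /f jet_chartE row_mxEr jet_offsetE.
apply: chart_smoothD => //; first exact: chart_smooth_coord.
by apply: chart_smoothN => //; exact: (jet_chart_smooth_point mc At oD0 _ oU (sheet_coord_smooth m j)).
Qed.

Lemma tube_open m : chart_open jc (tube m).
Proof.
(* The identity chart of R^(l+1) lets [chart_open_preim] pull back a ball. *)
pose idc : chart R 'rV[R]_l.+1 l.+1 := Chart setT id.
have idi : set_inj (cdom idc) idc by [].
pose V : set 'rV[R]_l.+1 := [set y | `|y| < 4^-1].
have oV : chart_open idc V.
  rewrite /chart_open setTI image_id.
  have -> : V = ball 0 4^-1.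
    by apply/seteqP; split=> y; rewrite -ball_normE /= /ball_ /= sub0r normrN.
  exact: ball_open.
have := @chart_open_preim R _ _ _ _ jc idc ji idi (fun a => jet_offset m a *m G) D0 oD0 _ _ V oV.
apply=> // i.
apply: (chart_smooth_ext ji oD0 (f := fun a => \sum_j jet_offset m a 0 j * G j i)).
  by move=> a _ _; rewrite /= [in RHS]mxE.
apply: chart_smooth_sum => // j _; apply: chart_smoothM => //.
exact: chart_smooth_cst.
Qed.

Lemma jet_atlas_inj (a : chart R (J1_total L) _) : J1_charts a -> set_inj (cdom a) a.
Proof. by move=> [c' [t' [Ac' At' ->]]]; exact: jet_chart_inj (chart_maximal Ac') At'. Qed.

Lemma jet_atlas_transition (a b : chart R (J1_total L) _) : J1_charts a -> J1_charts b ->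
  transition_smooth a b.
Proof.
move=> [c1 [t1 [Ac1 At1 ->]]] [c2 [t2 [Ac2 At2 ->]]].
by apply: jet_chart_transition => //; exact: chart_maximal.
Qed.

Let Ajc : J1_charts jc. Proof. by exists c, t. Qed.

Lemma tube_atlas_open m : atlas_open (@J1_charts _ _ _ L) (tube m).
Proof.
apply: (atlas_open_chart jet_atlas_inj jet_atlas_transition Ajc); first exact: tube_dom.
exact: tube_open.
Qed.

Variable S : set (J1_total L).
Hypothesis SU : forall q, U q -> jet_fiber S q = Zspan (fun r => j1 q (u r)).

Lemma tube_lattice m q (a : J1 L q) :
  (tube m `&` S) (Jet a) <-> U q /\ a = Zcomb m (fun r => j1 q (u r)).
Proof.
split=> [[[/= Uq am] Sa]|[Uq ->]]; last first.
  split; last by have := SU Uq => E; rewrite -[S _]/(jet_fiber S q _) E; exists m.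
  split=> //; rewrite /jet_offset /= jet_coord_Zcomb // subrr mul0mx normr0.
  by rewrite invr_gt0.
split=> //; have : jet_fiber S q a by [].
rewrite SU // => -[m' _ aE]; rewrite -aE; congr Zcomb.
move: am; rewrite /jet_offset /= -aE jet_coord_Zcomb // -mulmxBl.
set v := _ - _ => vs; have := UG Uq v => Hv.
have v2 : `|v| <= 2^-1 by lra.
apply/rowP => i; apply/eqP; rewrite -subr_eq0 -normr_eq0; apply/eqP.
have : `|v 0 i| <= 2^-1 by apply: le_trans v2; exact: rV_coord_le.
rewrite !mxE -rmorphB /= -intr_norm => H.
have {H} : `|m' 0 i - m 0 i|%:~R < (1 : R) by lra.
rewrite -[1]/(1%:~R) ltr_int => H; apply/eqP; rewrite eq_le normr_ge0 andbT.
by rewrite -ltzD1 add0r.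
Qed.

(** Subtracting the sheet straightens it: in the coordinates (base point, offset from the sheet),
    the lattice inside the tube is given by offset 0. The change from the jet chart translates the
    fibre by a smooth function of the base point. *)
Lemma tube_chart m : exists c' : chart R (J1_total L) (k + l + (1 + (k + l))),
  [/\ in_maximal_atlas (@J1_charts _ _ _ L) c', cdom c' = tube m &
      c' @` (cdom c' `&` S) = c' @` cdom c' `&`
      [set y | forall i : 'I_(k + l + (1 + (k + l))), (k + l <= i)%N -> y 0 i = 0]].
Proof.
pose phi (a : J1_total L) : 'rV[R]_(k + l + (1 + (k + l))) :=
  row_mx (c (pt a)) (jet_offset m a).
pose c' := Chart (tube m) phi; exists c'.
have ci' : set_inj (cdom c') c'.
  move=> a b /set_mem[Ua _] /set_mem[Ub _] /eq_row_mx[pq xy].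
  have {}pq : pt a = pt b := maximal_inj mc (mem_set (Uc Ua)) (mem_set (Uc Ub)) pq.
  move: a b Ua Ub pq xy => [p x] [q y]; rewrite /jet_point /jet_offset /= => Up Uq pq xy.
  subst q; congr existT; apply: (jet_coord_inj mc At (Uc Up) (Ut Up)).
  exact: addIr xy.
have img : c' @` cdom c' = [set y | (c @` (cdom c `&` U)) (lsubmx y)] `&`
    [set y | `|rsubmx y *m G| < 4^-1].
  apply/seteqP; split=> [_ [a [Ua am] <-]|y [[q [cq Uq] qy] ym]] /=.
    rewrite row_mxKl row_mxKr; split=> //; exists (pt a) => //.
    by split=> //; exact: Uc.
  have [a aE] := jet_coord_surj mc At cq (Ut Uq) (rsubmx y + map_mx intr m *m frame_mx q).
  have yE : phi (Jet a) = y.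
    by rewrite /phi /jet_offset /= aE addrK qy hsubmxK.
  exists (Jet a); last exact: yE.
  by split=> //=; move: ym; rewrite -yE /= row_mxKr.
have oimg : open (c' @` cdom c').
  rewrite img; apply: openI.
    by apply: lsubmx_preim_open; exact: image_chart_open.
  have := @open_preim R l.+1 _ setT (ball 0 4^-1)
    (fun y : 'rV[R]_(k + l + (1 + (k + l))) => rsubmx y *m G) openT.
  rewrite setTI => H.
  have -> : [set y : 'rV[R]_(k + l + (1 + (k + l))) | `|rsubmx y *m G| < 4^-1] =
      (fun y => rsubmx y *m G) @^-1` (ball 0 4^-1).
    by apply/seteqP; split=> y; rewrite -ball_normE /= /ball_ /= sub0r normrN.
  apply: H => [i|]; last exact: ball_open.
  apply: (smooth_ext openT (f := fun y => \sum_j y 0 (rshift _ j) * G j i)).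
    by move=> y _; rewrite mxE; apply: eq_bigr => j _; rewrite mxE.
  apply: smooth_sum => [|j _]; first exact: openT.
  by apply: smoothM; [exact: openT|exact: smooth_coord|exact: smooth_cst].
split=> //.
  apply: (in_maximal_from jet_atlas_inj jet_atlas_transition Ajc ci').
  - exact: tube_dom.
  - exact: tube_open.
  - exact: oimg.
  - move=> i; change (chart_smooth jc (tube m) (fun a => phi a 0 i)).
    rewrite -(splitK i); case: (fintype.split i) => j; rewrite [unsplit _]/=.
      apply: (chart_smooth_ext ji (@tube_open m) (f := fun a => jc a 0 (lshift _ j))).
        by move=> a _ _; rewrite jet_chartE /phi !row_mxEl.
      exact: (chart_smooth_coord ji (lshift (1 + (k + l)) j) (@tube_open m)).
    apply: (chart_smooth_ext ji (@tube_open m) (f := fun a => jet_offset m a 0 j)).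
      by move=> a _ _; rewrite /phi row_mxEr.
    by apply: chart_smooth_subset (offset_smooth m j) => a _ [].
  - have oc' : chart_open c' (cdom c') by rewrite /chart_open setIid.
    move=> i; rewrite -(splitK i); case: (fintype.split i) => j; rewrite [unsplit _]/=.
      apply: (chart_smooth_ext ci' oc' (f := fun a => c' a 0 (lshift _ j))).
        by move=> a _ _; rewrite /= !row_mxEl.
      exact: (chart_smooth_coord ci' _ oc').
    have Sp : chart_smooth c' (cdom c')
        ((fun q => (map_mx intr m *m frame_mx q : 'rV[R]_(1 + (k + l))) 0 j) \o pt).
      apply: (chart_smooth_comp ci' (maximal_inj mc) oc' _ _ _
        (smooth_on_chart mc oU (sheet_coord_smooth m j))).
      + by move=> a _ [/Uc].
      + move=> i'; apply: (chart_smooth_ext ci' oc' (f := fun a => c' a 0 (lshift _ i'))).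
          by move=> a _ _; rewrite /= row_mxEl.
        exact: (chart_smooth_coord ci' _ oc').
      + by move=> a _ [].
    pose f (a : J1_total L) := c' a 0 (rshift _ j) +
      ((fun q => (map_mx intr m *m frame_mx q : 'rV[R]_(1 + (k + l))) 0 j) \o pt) a.
    apply: (chart_smooth_ext ci' oc' (f := f)).
      by move=> a _ _; rewrite /f /= !row_mxEr jet_offsetE subrK.
    by apply: chart_smoothD => //; exact: (chart_smooth_coord ci' _ oc').
apply/seteqP; split=> [_ [a [am Sa] <-]|_ [[a am <-] a0]].
  split; first by exists a.
  move: a am Sa => [q a] am Sa i; rewrite -(splitK i).
  have [Uq aE] := (tube_lattice m a).1 (conj am Sa).
  case: (fintype.split i) => j; rewrite [unsplit _]/=.
    by rewrite /= leqNgt ltn_ord.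
  by rewrite /= row_mxEr /jet_offset /= aE jet_coord_Zcomb // subrr mxE.
exists a => //; split=> //; move: a am a0 => [q a] am a0.
have Uq : U q by case: am.
suff : (tube m `&` S) (Jet a) by case.
apply/tube_lattice; split=> //; apply: (jet_coord_inj mc At (Uc Uq) (Ut Uq)).
rewrite jet_coord_Zcomb //; apply/rowP => j; apply/eqP; rewrite -subr_eq0.
by have := a0 (rshift _ j) (leq_addr _ _); rewrite /= row_mxEr jet_offsetE /= => ->.
Qed.

End Tubes.
End Sheets.

(** * Frames of a lattice and their integral changes *)

Section Frames.
Variables (R : realType) (k l : nat) (N : manifold R (k + l)).
Variables (F : foliation N) (L : line_bundle N).
Local Notation maximal := (in_maximal_atlas (charts N)).
Local Notation sm := (smooth_on (charts N)).
Implicit Types (S : set (J1_total L)) (m : 'rV[int]_l.+1) (B : 'M[int]_l.+1).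
Implicit Types (u v : 'I_l.+1 -> section L).

Definition jets u q : 'I_l.+1 -> J1 L q := fun r => j1 q (u r).

Definition Zact q B (b : 'I_l.+1 -> J1 L q) : 'I_l.+1 -> J1 L q :=
  fun r => Zcomb (row r B) b.

Lemma Zcomb_Zact q m B (b : 'I_l.+1 -> J1 L q) : Zcomb m (Zact B b) = Zcomb (m *m B) b.
Proof.
rewrite !ZcombE /Zact; under eq_bigr => r _ do rewrite ZcombE scaler_sumr.
rewrite exchange_big; apply: eq_bigr => s _ /=.
rewrite mxE rmorph_sum scaler_suml; apply: eq_bigr => r _.
by rewrite scalerA rmorphM mxE.
Qed.

Lemma Zact1 q (b : 'I_l.+1 -> J1 L q) : Zact 1%:M b = b.
Proof. by apply/funext => r; rewrite /Zact row1 Zcomb_delta. Qed.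

Lemma Zact_mul q B C (b : 'I_l.+1 -> J1 L q) : Zact B (Zact C b) = Zact (B *m C) b.
Proof. by apply/funext => r; rewrite {1}/Zact Zcomb_Zact /Zact row_mul. Qed.

Lemma Zspan_Zact q B (b : 'I_l.+1 -> J1 L q) : B \in unitmx -> Zspan (Zact B b) = Zspan b.
Proof.
move=> uB; apply/seteqP; split=> _ [m _ <-]; first by rewrite Zcomb_Zact; exists (m *m B).
by exists (m *m invmx B) => //; rewrite Zcomb_Zact mulmxKV.
Qed.

Lemma Zspan_sub q (b b' : 'I_l.+1 -> J1 L q) : (forall r, Zspan b (b' r)) ->
  exists B, b' = Zact B b.
Proof.
move=> H; have /choice[f Hf] r : exists m, Zcomb m b = b' r by have [m _ mE] := H r; exists m.
by exists (\matrix_r f r); apply/funext => r; rewrite /Zact rowK Hf.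
Qed.

Lemma Zcomb_inj q (b : 'I_l.+1 -> J1 L q) : exact_at F b -> injective (fun m => Zcomb m b).
Proof.
move=> ex m m' /= E; apply/rowP => r; apply/eqP; rewrite -subr_eq0 -(intr_eq0 R).
apply/eqP; apply: (exact_indep ex (x := fun r => (m 0 r - m' 0 r)%:~R)).
under eq_bigr => s _ do rewrite rmorphB scalerBl.
by rewrite sumrB -!ZcombE E subrr.
Qed.

Lemma Zact_inj q (b : 'I_l.+1 -> J1 L q) : exact_at F b -> injective (fun B => Zact B b).
Proof.
move=> ex B C E; apply/row_matrixP => r; apply: (Zcomb_inj ex).
exact: (congr1 (@^~ r) E).
Qed.

(** Equality of spans also gives a matrix C from b' back to b; as b is free, C B = 1. *)
Lemma Zspan_unit q (b b' : 'I_l.+1 -> J1 L q) B : exact_at F b ->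
  Zspan b' = Zspan b -> b' = Zact B b -> B \in unitmx.
Proof.
move=> ex E b'E; have [C CE] : exists C, b = Zact C b'.
  by apply: Zspan_sub => r; rewrite E; exact: Zspan_gen.
have /mulmx1_unit[] // : C *m B = 1%:M.
by apply: (Zact_inj ex) => /=; rewrite -Zact_mul -b'E -CE Zact1.
Qed.

Lemma Zcomb_val q m u : (forall r, smooth_at q (u r)) ->
  Zcomb m (jets u q) = j1 q (fun x => \sum_r (m 0 r)%:~R *: u r x) /\
  jet_val (Zcomb m (jets u q)) = \sum_r (m 0 r)%:~R *: u r q.
Proof.
move=> Su; have [Sc E] := j1_comb (fun r => (m 0 r)%:~R) Su.
by rewrite ZcombE E jet_val_j1.
Qed.

Lemma Zact_frame_vec t q B u v : trivs L t -> tdom t q ->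
  (forall r, smooth_at q (u r)) -> (forall r, smooth_at q (v r)) ->
  jets v q = Zact B (jets u q) ->
  frame_vec t v q = map_mx intr B *m frame_vec t u q.
Proof.
move=> At tq Su Sv E; apply/colP => r; rewrite mxE /triv_val -(jet_val_j1 (Sv r)).
have -> : j1 q (v r) = Zcomb (row r B) (jets u q) by have := congr1 (@^~ r) E.
have [_ ->] := Zcomb_val (row r B) Su; rewrite linear_sum [in RHS]mxE.
by apply: eq_bigr => s _; rewrite linearZ !mxE.
Qed.

(** A frame whose sheets are isolated in S by open sets of the total space. This topological form is
    what makes coefficients of sections locally constant. *)
Definition sheeted S (U : set N) u : Prop :=
  lattice_frame F S U u /\
  forall m, exists2 O, atlas_open (@J1_charts _ _ _ L) O &
    forall q (a : J1 L q), (O `&` S) (Jet a) <-> U q /\ a = Zcomb m (jets u q).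

Lemma lattice_frame_subset S (W U : set N) u : open U -> U `<=` W ->
  lattice_frame F S W u -> lattice_frame F S U u.
Proof.
move=> oU UW [_ Su SW ex]; split=> // [r|q /UW|q /UW]; [|exact: SW|exact: ex].
exact: smooth_sec_subset UW (Su r).
Qed.

Lemma sheeted_exists S (W : set N) u p : lattice_frame F S W u -> W p ->
  exists2 U, U p & sheeted S U u.
Proof.
move=> LW Wp; have [oW Su SW ex] := LW.
have [c Ac cp] := charts_cover p; have [t At tp] := trivs_cover L p.
have [U [G [oU Up UW UG]]] := frame_mx_perturb Ac At oW Wp Su (ex p Wp) cp tp.
have LU : lattice_frame F S U u by apply: lattice_frame_subset LW => // x /UW[].
have Uc : U `<=` cdom c by move=> x /UW[_ []].
have Ut : U `<=` tdom t by move=> x /UW[_ []].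
have [_ SuU SU _] := LU; exists U => //; split=> // m.
exists (tube u c t U G m).
  by move=> a Ja; apply: (tube_atlas_open Ac At oU Uc Ut SuU Ja).
by move=> q a; exact: (tube_lattice Ac At oU Uc Ut SuU UG SU).
Qed.

(** The open set isolating the sheet through [sigma q0] pulls back along sigma to a neighbourhood of
    [q0], on which the coefficients keep the value m. *)
Lemma sheeted_section S (U V : set N) u (sigma : forall q, J1 L q) q0 :
  sheeted S U u -> open V -> smooth_jet_section V sigma ->
  (forall q, V q -> S (Jet (sigma q))) -> U q0 -> V q0 ->
  exists m V', [/\ open V', V' q0, V' `<=` U `&` V &
    forall q, V' q -> sigma q = Zcomb m (jets u q)].
Proof.
move=> [[oU Su SU ex] sh] oV Ss SV Uq0 Vq0.
have [m _ mE] : Zspan (jets u q0) (sigma q0) by rewrite -SU //; exact: SV.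
have [D oD OS] := sh m.
exists m, (V `&` [set q | D (Jet (sigma q))]); split.
- exact: smooth_jet_section_preim.
- by split=> //; have [] := (OS q0 (sigma q0)).2 (conj Uq0 (esym mE)).
- by move=> q [Vq Oq]; have [] := (OS q (sigma q)).1 (conj Oq (SV q Vq)).
- by move=> q [Vq Oq]; have [] := (OS q (sigma q)).1 (conj Oq (SV q Vq)).
Qed.

Lemma sheeted_compare S (U V : set N) u v q0 : sheeted S U u -> open V ->
  (forall r, smooth_sec V (v r)) ->
  (forall q, V q -> jet_fiber S q = Zspan (jets v q)) -> U q0 -> V q0 ->
  exists B V', [/\ B \in unitmx, open V', V' q0, V' `<=` U `&` V &
    forall q, V' q -> jets v q = Zact B (jets u q)].
Proof.
move=> sh oV Sv SV Uq0 Vq0.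
have /choice[f Hf] r : exists mV : 'rV[int]_l.+1 * set N, [/\ open mV.2, mV.2 q0,
    mV.2 `<=` U `&` V & forall q, mV.2 q -> j1 q (v r) = Zcomb mV.1 (jets u q)].
  have [m [V' H]] := @sheeted_section S U V u (fun q => j1 q (v r)) q0 sh oV
    (smooth_jet_section_j1 oV (Sv r))
    (fun q Vq => eq_ind_r (fun A : set _ => A (j1 q (v r))) (Zspan_gen (jets v q) r) (SV q Vq)) Uq0 Vq0.
  by exists (m, V').
pose B := \matrix_r (f r).1.
have HB q : (forall r, (f r).2 q) -> jets v q = Zact B (jets u q).
  move=> fq; apply/funext => r; rewrite /Zact rowK.
  by have [_ _ _] := Hf r; apply.
have nP : nbhs q0 [set q | forall r, (f r).2 q].
  apply: (@filter_forall _ _ (fun r => (f r).2) (nbhs q0)) => r.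
  by apply: open_nbhs_nbhs; have [] := Hf r.
have [V' [oV' V'q V'P]] := near_open nP.
exists B, V'; split=> //.
- have [[_ _ SU ex] _] := sh; apply: (Zspan_unit (ex q0 Uq0)).
    by rewrite -(SU q0 Uq0) (SV q0 Vq0).
  by apply: HB; exact: V'P.
- by move=> q /V'P/(_ 0); have [_ _ + _] := Hf 0; apply.
- by move=> q /V'P; exact: HB.
Qed.

(** The lattice conditions can be checked near each point, where tubes around the sheets of a frame
    supply the charts of the submanifold and the local triviality. *)
Lemma frames_lattice S : (forall p, exists2 W, W p & exists u, lattice_frame F S W u) ->
  exists Z : Zlattice F L, lattice_set Z = S.
Proof.
move=> H; have sh p : exists2 U, U p & exists u, sheeted S U u.
  have [W Wp [u LW]] := H p; have [U Up sU] := sheeted_exists LW Wp.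
  by exists U => //; exists u.
have emb : embedded_submanifold (@J1_charts _ _ _ L) S.
  exists (k + l)%N => -[p a] Sa; have [W Wp [u LW]] := H p; have [oW Su SW ex] := LW.
  have [c Ac cp] := charts_cover p; have [t At tp] := trivs_cover L p.
  have [U [G [oU Up UW UG]]] := frame_mx_perturb Ac At oW Wp Su (ex p Wp) cp tp.
  have [_ SuU SU _] : lattice_frame F S U u by apply: lattice_frame_subset LW => // x /UW[].
  have Uc : U `<=` cdom c by move=> x /UW[_ []].
  have Ut : U `<=` tdom t by move=> x /UW[_ []].
  have [m _ mE] : Zspan (jets u p) a by rewrite -SU.
  have [c' [mc' c'D c'E]] := tube_chart Ac At oU Uc Ut SuU UG SU m.
  exists c'; split=> //; rewrite c'D.
  by have [] := (tube_lattice Ac At oU Uc Ut SuU UG SU m a).2 (conj Up (esym mE)).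
have bun : Zbundle S.
  move=> p; have [U Up [u sU]] := sh p; have [[oU Su SU ex] sheet] := sU.
  exists U, (fun r q => j1 q (u r)); split=> //.
  - by move=> r; exact: smooth_jet_section_j1.
  - move=> q Uq; split; first exact: SU.
    move=> m; rewrite -[RHS](_ : Zcomb 0 (jets u q) = 0); first exact: (Zcomb_inj (ex q Uq)).
    by apply: big1 => r _; rewrite mxE mulr0z.
  - move=> m; have [D oD OS] := sheet m; exists D => //.
    apply/seteqP; split=> [_ [q Uq <-]|[q a] Oa]; first exact/OS.
    by have [Uq ->] := (OS q a).1 Oa; exists q.
have exa : jet_exact F S.
  apply: jet_exactP => p; have [W Wp [u [_ _ SW ex]]] := H p.
  by exists (jets u p); [exact: SW|exact: ex].
have hol : holonomic S.
  (* The section can only be the value of sigma. Since sigma is locally a combination of jets with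
     constant coefficients, it is the jet of the same combination of the sections. *)
  move=> U sigma oU Ss SU; exists (fun p => jet_val (sigma p)).
    apply: smooth_sec_local => p Up; have [W Wp [u sW]] := sh p.
    have [m [V [oV Vp VW VE]]] := sheeted_section sW oU Ss SU Wp Up.
    exists V => //; have [[oW Su _ _] _] := sW.
    have SuV r : smooth_sec V (u r) by apply: smooth_sec_subset (Su r) => x /VW[].
    apply: (smooth_sec_ext oV _ (smooth_sec_comb (fun r => (m 0 r)%:~R) oV SuV)) => x Vx.
    by rewrite VE //; have [_ ->] := Zcomb_val m (fun r => smooth_sec_at oV Vx (SuV r)).
  move=> p Up; have [W Wp [u sW]] := sh p.
  have [m [V [oV Vp VW VE]]] := sheeted_section sW oU Ss SU Wp Up.
  have [[oW Su _ _] _] := sW.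
  have SuV r : smooth_sec V (u r) by apply: smooth_sec_subset (Su r) => x /VW[].
  have Sx x : V x -> forall r, smooth_at x (u r) by move=> Vx r; exact: smooth_sec_at (SuV r).
  rewrite VE //; have [-> _] := Zcomb_val m (Sx p Vp).
  apply: (j1_eq_on oV Vp); first by have [] := j1_comb (fun r => (m 0 r)%:~R) (Sx p Vp).
  by move=> x Vx; rewrite VE //; have [_ ->] := Zcomb_val m (Sx x Vx).
by exists (MkZlattice emb bun exa hol).
Qed.

(** [lattice_T3] turns the local Z-basis from [lattice_T1] into jets of sections, and [lattice_T2]
    makes this frame exact. *)
Lemma Zlattice_frame (Z : Zlattice F L) p : exists2 U, U p & exists u, sheeted Z U u.
Proof.
have [U [sigma [oU Up Ss SU _]]] := lattice_T1 Z p.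
have /choice[u Hu] r : exists u : section L, smooth_sec U u /\
    forall p, U p -> sigma r p = j1 p u.
  have [|u Su Eu] := @lattice_T3 _ _ _ _ F L Z U (sigma r) oU (Ss r); last by exists u.
  move=> q Uq; have [E _] := SU q Uq; suff : jet_fiber Z q (sigma r q) by [].
  by rewrite E; exact: (Zspan_gen (sigma^~ q)).
have sE q : U q -> sigma^~ q = jets u q.
  by move=> Uq; apply/funext => r; have [_ /(_ q Uq)] := Hu r.
have fE q : U q -> jet_fiber Z q = Zspan (jets u q).
  by move=> Uq; have [-> _] := SU q Uq; rewrite sE.
have LU : lattice_frame F Z U u.
  split=> // [r|q Uq]; first by have [] := Hu r.
  by apply: exact_at_fiber; [exact: lattice_T2|exact: fE].
by have [W Wp sW] := sheeted_exists LU Up; exists W => //; exists u.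
Qed.

End Frames.

(** Two factorizations of the block matrix D with rows (1, -y) and (x, a): eliminating x by rows
    leaves a + x y, while eliminating it by columns leaves a, because y x = 0. *)
Lemma det_scalar_rank1 (K : fieldType) n (a : K) (x : 'cV[K]_n) (y : 'rV[K]_n) :
  a != 0 -> y *m x = 0 -> \det (a%:M + x *m y) = a ^+ n.
Proof.
move=> a0 yx.
pose D := block_mx (1%:M : 'M[K]_1) (- y) x (a%:M).
have D1 : D = block_mx 1%:M 0 x 1%:M *m block_mx 1%:M (- y) 0 (a%:M + x *m y).
  by rewrite mulmx_block !mul1mx !mulmx1 !mul0mx !addr0 mulmxN [- _ + _]addrC addrK.
have D2 : D = block_mx 1%:M (- y) 0 a%:M *m block_mx 1%:M 0 (a^-1 *: x) 1%:M.
  rewrite mulmx_block !mul1mx !mulmx1 !mulmx0 !add0r -scalemxAr mulNmx yx oppr0 scaler0 addr0.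
  by rewrite mul_scalar_mx scalerA mulfV // scale1r.
have := congr1 determinant D1; rewrite D2 !det_mulmx !det_lblock !det_ublock !det1.
by rewrite !mul1r !mulr1 det_scalar.
Qed.

Lemma det_intr_unit (R : realType) n (C : 'M[int]_n) : C \in unitmx ->
  `|\det (map_mx intr C : 'M[R]_n)| = 1.
Proof.
rewrite unitmxE det_map_mx /= => uC.
have : `|\det C| = 1.
  by apply/eqP; move: uC; rewrite qualifE /= /intUnitRing.unitz => /orP[]/eqP->.
by rewrite -intr_norm => ->.
Qed.

(** * Rescaling L *)

Section Scaling.
Variables (R : realType) (k l : nat) (N : manifold R (k + l)).
Variables (F : foliation N) (L : line_bundle N).
Local Notation maximal := (in_maximal_atlas (charts N)).
Local Notation sm := (smooth_on (charts N)).
Implicit Types (u v : 'I_l.+1 -> section L) (w s : section L) (g h : N -> R).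

Definition scale_sec g s : section L := fun x => g x *: s x.

Definition smooth_fun_at q g := exists U, [/\ open U, U q & sm U g].

Lemma smooth_at_scale_sec q g s : smooth_fun_at q g -> smooth_at q s -> smooth_at q (scale_sec g s).
Proof.
move=> [U [oU Uq Sg]] [V [oV Vq Ss]]; have oW : open (U `&` V) by exact: openI.
exists (U `&` V); split=> //; apply: smooth_secZ => //.
  by apply: smooth_on_subset Sg => x [].
by apply: smooth_sec_subset Ss => x [].
Qed.

(* Matrix of the action of g on 1-jets at q, in jet coordinates. *)
Definition scale_mx (c : chart R N (k + l)) g q : 'M[R]_(1 + (k + l)) :=
  (g q)%:M + delta_mx (lshift _ 0) 0 *m row_mx (0 : 'M[R]_1) (\row_j chart_partial c j g q).

Lemma sec_coord_scale c t q g s : charts N c -> trivs L t -> cdom c q -> tdom t q ->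
  smooth_fun_at q g -> smooth_at q s ->
  sec_coord c t (scale_sec g s) q = sec_coord c t s q *m scale_mx c g q.
Proof.
move=> Ac At cq tq [U [oU Uq Sg]] Ss; have mc := chart_maximal Ac.
rewrite mulmxDr mul_mx_scalar mulmxA.
have -> : sec_coord c t s q *m delta_mx (lshift _ 0) 0 = (triv_val t s q)%:M.
  rewrite -colE; apply/matrixP => i j; rewrite !ord1 [LHS]mxE row_mxEl !mxE eqxx.
  by rewrite mulr1n.
rewrite mul_scalar_mx [sec_coord c t s q]/sec_coord !scale_row_mx scaler0.
rewrite add_row_mx addr0; congr row_mx.
  by apply/rowP => i; rewrite !mxE /triv_val /scale_sec linearZ.
apply/rowP => j; rewrite !mxE.
have -> : triv_val t (scale_sec g s) = fun x => g x * triv_val t s x.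
  by apply/funext => x; rewrite /triv_val /scale_sec linearZ.
rewrite chart_partialM //; first exact: maximal_inj.
  exact: smooth_on_diff Sg _ _.
exact: smooth_at_diff.
Qed.

(** In jet coordinates, multiplication by g is the matrix [scale_mx], so it is well defined on
    jets. *)
Lemma j1_scale q g s s' : smooth_fun_at q g -> smooth_at q s -> smooth_at q s' ->
  j1 q s = j1 q s' -> j1 q (scale_sec g s) = j1 q (scale_sec g s').
Proof.
move=> Sg Ss Ss' E; have [c Ac cq] := charts_cover q; have [t At tq] := trivs_cover L q.
have mc := chart_maximal Ac.
apply: (jet_coord_inj mc At cq tq); rewrite !jet_coord_j1 //; try exact: smooth_at_scale_sec.
rewrite (sec_coord_scale Ac At cq tq Sg Ss) (sec_coord_scale Ac At cq tq Sg Ss'); congr (_ *m _).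
by have := congr1 (@jet_coord _ _ _ L c t q) E; rewrite !(jet_coord_j1 mc At cq tq).
Qed.

Lemma smooth_fun_atV q g : smooth_fun_at q g -> g q != 0 -> smooth_fun_at q (fun x => (g x)^-1).
Proof.
move=> [U [oU Uq Sg]] g0.
have [V [oV Vq VP]] := near_open (smooth_on_near_neq0 oU Sg Uq g0).
exists (U `&` V); split=> //; first exact: openI.
apply: smooth_onV; [exact: openI|by move=> x [_ /VP]|].
by apply: smooth_on_subset Sg => x [].
Qed.

Lemma smooth_fun_atM q g h : smooth_fun_at q g -> smooth_fun_at q h ->
  smooth_fun_at q (fun x => g x * h x).
Proof.
move=> [U [oU Uq Sg]] [V [oV Vq Sh]]; have oW : open (U `&` V) by exact: openI.
exists (U `&` V); split=> //; apply: smooth_onM => //.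
  by apply: smooth_on_subset Sg => x [].
by apply: smooth_on_subset Sh => x [].
Qed.

Lemma j1_scaleVK q g s : smooth_fun_at q g -> g q != 0 -> smooth_at q s ->
  j1 q (scale_sec (fun x => (g x)^-1) (scale_sec g s)) = j1 q s.
Proof.
move=> Sg g0 Ss; have [U [oU Uq SU]] := Sg.
have [V [oV Vq VP]] := near_open (smooth_on_near_neq0 oU SU Uq g0).
apply/esym; apply: (j1_eq_on oV Vq Ss) => x /VP gx.
by rewrite /scale_sec scalerA mulVf // scale1r.
Qed.

Lemma j1_scaleKV q g s : smooth_fun_at q g -> g q != 0 -> smooth_at q s ->
  j1 q (scale_sec g (scale_sec (fun x => (g x)^-1) s)) = j1 q s.
Proof.
move=> Sg g0 Ss; have := j1_scaleVK (smooth_fun_atV Sg g0) _ Ss.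
rewrite invr_eq0 => /(_ g0) <-; congr j1.
by apply: functional_extensionality_dep => x; rewrite /scale_sec invrK.
Qed.

Lemma j1_scale_Zcomb q g (m : 'rV[int]_l.+1) u : smooth_fun_at q g -> (forall r, smooth_at q (u r)) ->
  j1 q (scale_sec g (fun x => \sum_r (m 0 r)%:~R *: u r x)) =
  Zcomb m (jets (fun r => scale_sec g (u r)) q).
Proof.
move=> Sg Su; have Sgu r := smooth_at_scale_sec Sg (Su r).
have [-> _] := Zcomb_val m Sgu; congr j1.
apply: functional_extensionality_dep => x; rewrite /scale_sec scaler_sumr.
by apply: eq_bigr => r _; rewrite !scalerA mulrC.
Qed.

(** The condition of [lattice_iso] at one point, for a factor g that need only be smooth near it;
    this allows local factors to be compared and glued. *)
Definition scales g q (S S' : set (J1_total L)) : Prop :=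
  forall s, smooth_at q s -> (S (Jet (j1 q s)) <-> S' (Jet (j1 q (scale_sec g s)))).

Lemma scalesV g q S S' : smooth_fun_at q g -> g q != 0 -> scales g q S S' ->
  scales (fun x => (g x)^-1) q S' S.
Proof.
move=> Sg g0 H s Ss; have Sg' := smooth_fun_atV Sg g0.
by rewrite H ?j1_scaleKV //; exact: smooth_at_scale_sec.
Qed.

Lemma scales_span g q S S' u : smooth_fun_at q g -> g q != 0 ->
  (forall r, smooth_at q (u r)) -> scales g q S S' ->
  jet_fiber S q = Zspan (jets u q) ->
  jet_fiber S' q = Zspan (jets (fun r => scale_sec g (u r)) q).
Proof.
move=> Sg g0 Su H Sq; have Sgu r := smooth_at_scale_sec Sg (Su r).
have Sc (m : 'rV[int]_l.+1) : smooth_at q (fun x => \sum_r (m 0 r)%:~R *: u r x).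
  by have [] := j1_comb (fun r => (m 0 r)%:~R) Su.
apply/seteqP; split=> a.
  rewrite -(jet_reprK a); set s := jet_repr a; have Ss : smooth_at q s by exact: jet_repr_smooth.
  have Sg' := smooth_fun_atV Sg g0; have Sgs := smooth_at_scale_sec Sg' Ss.
  move=> /(proj1 (scalesV Sg g0 H Ss)) S's.
  have : jet_fiber S q (j1 q (scale_sec (fun x => (g x)^-1) s)) by [].
  rewrite Sq => -[m _ E]; exists m => //.
  rewrite -(j1_scale_Zcomb _ Sg Su) -(j1_scaleKV Sg g0 Ss); apply: j1_scale => //.
  by rewrite -E; have [-> _] := Zcomb_val m Su.
move=> [m _ <-]; rewrite -(j1_scale_Zcomb _ Sg Su); apply: (proj1 (H _ (Sc m))).
suff : jet_fiber S q (j1 q (fun x => \sum_r (m 0 r)%:~R *: u r x)) by [].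
by rewrite Sq; have [<- _] := Zcomb_val m Su; exists m.
Qed.

Lemma span_scales g q S S' u : smooth_fun_at q g -> g q != 0 ->
  (forall r, smooth_at q (u r)) -> jet_fiber S q = Zspan (jets u q) ->
  jet_fiber S' q = Zspan (jets (fun r => scale_sec g (u r)) q) -> scales g q S S'.
Proof.
move=> Sg g0 Su Sq Sq' s Ss; have Sgs := smooth_at_scale_sec Sg Ss.
have Sc (m : 'rV[int]_l.+1) : smooth_at q (fun x => \sum_r (m 0 r)%:~R *: u r x).
  by have [] := j1_comb (fun r => (m 0 r)%:~R) Su.
rewrite -[S _]/(jet_fiber S q _) -[S' _]/(jet_fiber S' q _) Sq Sq'.
split=> -[m _ E]; exists m => //.
  rewrite -(j1_scale_Zcomb _ Sg Su); apply: j1_scale => //.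
  by rewrite -E; have [-> _] := Zcomb_val m Su.
have [-> _] := Zcomb_val m Su; rewrite -(j1_scaleVK Sg g0 (Sc m)) -[RHS](j1_scaleVK Sg g0 Ss).
apply: j1_scale => //; [exact: smooth_fun_atV|exact: smooth_at_scale_sec|].
by rewrite j1_scale_Zcomb.
Qed.

(* [C = h + x y] with [y x = 0] has determinant [h ^ (l + 1)], which is 1 up to sign. *)
Lemma self_scale_eq1 h q u C : smooth_fun_at q h -> 0 < h q ->
  (forall r, smooth_at q (u r)) -> exact_at F (jets u q) -> C \in unitmx ->
  jets (fun r => scale_sec h (u r)) q = Zact C (jets u q) -> h q = 1.
Proof.
move=> Sh h0 Su ex uC E.
have [c Ac cq] := charts_cover q; have [t At tq] := trivs_cover L q.
have mc := chart_maximal Ac.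
pose M := frame_mx u c t q.
have [G MG] : exists G, M *m G = 1%:M by apply/row_freeP; exact: (frame_mx_free (F := F)).
have hn0 : h q != 0 by rewrite gt_eqF.
pose e0 : 'cV[R]_(1 + (k + l)) := delta_mx (lshift _ 0) 0.
pose eta := row_mx (0 : 'M[R]_1) (\row_j chart_partial c j h q).
(* The action of h on the frame, computed in jet coordinates on the left and by the integral matrix
   C on the right. *)
have MT : M *m scale_mx c h q = map_mx intr C *m M.
  apply/row_matrixP => r; rewrite !row_mul !rowK -sec_coord_scale //.
  rewrite -(jet_coord_j1 mc) //; last exact: smooth_at_scale_sec.
  have -> : j1 q (scale_sec h (u r)) = Zcomb (row r C) (jets u q) by have := congr1 (@^~ r) E.
  rewrite ZcombE (jet_coord_frame Ac At cq tq Su (erefl _)); congr (_ *m _).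
  by apply/rowP => i; rewrite !mxE.
rewrite mulmxDr mul_mx_scalar mulmxA -/e0 -/eta in MT.
have CE : map_mx intr C = (h q)%:M + (M *m e0) *m (eta *m G).
  transitivity (map_mx intr C *m M *m G); first by rewrite -mulmxA MG mulmx1.
  by rewrite -MT mulmxDl -scalemxAl MG scalemx1 mulmxA.
have eta0 : eta *m e0 = 0.
  rewrite -colE; apply/matrixP => i j; rewrite mxE !ord1 row_mxEl.
  by rewrite !mxE.
have Me0 : M *m e0 != 0.
  have [_ [r ur]] := ex; apply: contra_neq ur => M0.
  apply: (trivs_inj At tq); rewrite linear0 jet_val_j1 //.
  by have /colP/(_ r) := M0; rewrite -colE mxE [M _ _]mxE row_mxEl !mxE.
(* G is only a right inverse of M, so [eta *m e0 = 0] does not give this directly. Instead x =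
   [M *m e0] is an eigenvector of C for h q, hence x (y x) = 0, and x is nonzero because some
   section of the frame is. *)
have yx : eta *m G *m (M *m e0) = 0.
  have : map_mx intr C *m (M *m e0) = h q *: (M *m e0).
    by rewrite mulmxA -MT mulmxDl -scalemxAl -[X in _ + X]mulmxA eta0 mulmx0 addr0.
  rewrite CE mulmxDl mul_scalar_mx => /(canRL (addKr _)).
  rewrite addNr -[X in X = _](mulmxA (M *m e0) (eta *m G) (M *m e0)) => /eqP.
  have [z ->] : exists z, eta *m G *m (M *m e0) = z%:M.
    by exists ((eta *m G *m (M *m e0)) 0 0); exact: mx11_scalar.
  by rewrite mul_mx_scalar scaler_eq0 (negbTE Me0) orbF => /eqP ->; exact: raddf0.
have := det_intr_unit R uC; rewrite CE det_scalar_rank1 // normrX gtr0_norm //.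
move=> /eqP; rewrite -[X in _ == X](expr1n _ l.+1) eqrXn2 ?ltW //.
by move=> /eqP.
Qed.

(** The quotient f = h / g preserves S, so it acts on the frame by a matrix of GL(l+1;Z), and
    [self_scale_eq1] gives f q = 1. *)
Lemma scales_unique g h q S S' u : smooth_fun_at q g -> smooth_fun_at q h ->
  0 < g q -> 0 < h q -> (forall r, smooth_at q (u r)) -> exact_at F (jets u q) ->
  jet_fiber S q = Zspan (jets u q) -> scales g q S S' -> scales h q S S' -> g q = h q.
Proof.
move=> Sg Sh g0 h0 Su ex Sq Hg Hh.
have gn0 : g q != 0 by rewrite gt_eqF.
have hn0 : h q != 0 by rewrite gt_eqF.
have Sg' := smooth_fun_atV Sg gn0.
pose f x := (g x)^-1 * h x; have Sf : smooth_fun_at q f by exact: smooth_fun_atM.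
have fu0 : f q != 0 by rewrite mulf_neq0 // invr_neq0.
have Shu r := smooth_at_scale_sec Sh (Su r).
have fu : jet_fiber S q = Zspan (jets (fun r => scale_sec f (u r)) q).
  have S'q := scales_span Sh hn0 Su Hh Sq.
  have gi0 : (g q)^-1 != 0 by rewrite invr_eq0.
  rewrite (scales_span Sg' gi0 Shu (scalesV Sg gn0 Hg) S'q).
  congr Zspan; apply/funext => r; congr j1.
  by apply: functional_extensionality_dep => x; rewrite /scale_sec scalerA.
have [C CE] : exists C, jets (fun r => scale_sec f (u r)) q = Zact C (jets u q).
  by apply: Zspan_sub => r; rewrite -Sq fu; exact: Zspan_gen.
have uC : C \in unitmx by apply: (Zspan_unit ex _ CE); rewrite -fu.
have f0 : 0 < f q by rewrite mulr_gt0 ?invr_gt0.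
have E := self_scale_eq1 Sf f0 Su ex uC CE; rewrite /f in E.
by rewrite -[RHS]mul1r -(mulfV gn0) -mulrA E mulr1.
Qed.

End Scaling.

(** * The correspondence *)

Section Correspondence.
Variables (R : realType) (k l : nat) (N : manifold R (k + l)).
Variables (F : foliation N) (L : line_bundle N).
Local Notation maximal := (in_maximal_atlas (charts N)).
Local Notation sm := (smooth_on (charts N)).
Implicit Types (u v : 'I_l.+1 -> section L).

Lemma exact_frame_neq0 t u q : trivs L t -> tdom t q -> (forall r, smooth_at q (u r)) ->
  exact_at F (jets u q) -> frame_vec t u q != 0.
Proof.
move=> At tq Su [_ [r]]; rewrite jet_val_j1 //; apply: contra_neq => /colP/(_ r).
by rewrite !mxE => /eqP; rewrite triv_eq0 // => /eqP.
Qed.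

Lemma Zact_cocycle q (b b' b'' : 'I_l.+1 -> J1 L q) B C D : exact_at F b ->
  b' = Zact B b -> b'' = Zact C b' -> b'' = Zact D b -> D = C *m B.
Proof. by move=> ex -> ->; rewrite Zact_mul => /(Zact_inj ex). Qed.

(** The correspondence as a relation: each chart of P is the map to projective space given by a
    frame of S on the whole chart domain. *)
Definition adapted (S : Zlattice F L) (P : Zprojective F) : Prop :=
  forall i : ix P, exists2 u, sheeted F S (udom i) u &
    forall q, udom i q -> line (umap i q) = frame_line u q.

Lemma adapted_exists (S : Zlattice F L) : exists P, adapted S P.
Proof.
(* The atlas is indexed by the points of N, with one frame chosen around each. *)
have /choice[D HD] p : exists Uu : set N * ('I_l.+1 -> section L),
    Uu.1 p /\ sheeted F S Uu.1 Uu.2.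
  by have [U Up [u sU]] := Zlattice_frame S p; exists (U, u).
pose U p := (D p).1; pose u p := (D p).2.
have Up p : U p p by case: (HD p).
have sU p : sheeted F S (U p) (u p) by case: (HD p).
have oU p : open (U p) by case: (sU p) => [[]].
have Su p r : smooth_sec (U p) (u p r) by case: (sU p) => [[]].
have SU p q : U p q -> jet_fiber S q = Zspan (jets (u p) q) by case: (sU p) => -[_ _ + _] _; exact.
have ex p q : U p q -> exact_at F (jets (u p) q) by case: (sU p) => -[_ _ _ +] _; exact.
have Sq p q : U p q -> forall r, smooth_at q (u p r).
  by move=> Uq r; exact: smooth_sec_at (Su p r).
pose chi p q := rp_of (frame_vec (triv_at L q) (u p) q).
have chiE p q : U p q -> line (chi p q) = frame_line (u p) q.
  move=> Uq; rewrite /chi rp_ofE //; have [At tq] := triv_atP L q.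
  by apply: exact_frame_neq0 => //; [exact: Sq|exact: ex].
have cov p : exists i, U i p by exists p.
have sub p : submersion_on (charts N) (U p) (@rp_charts R l) (chi p).
  by apply: (exact_submersion (F := F) (oU p) (Su p) (chiE p)); exact: ex.
have ld p : locally_defines F (U p) (chi p).
  by apply: (exact_locally_defines (oU p) (Su p) (chiE p)); exact: ex.
(* The matrix is read from jets, not from lines. Lines would fix it only up to sign, whereas
   freeness of the jets fixes it completely, and the cocycle condition follows. *)
pose A i j q : 'M[int]_l.+1 := xget 0 [set B | jets (u j) q = Zact B (jets (u i) q)].
have AE i j q : U i q -> U j q -> jets (u j) q = Zact (A i j q) (jets (u i) q).
  move=> Ui Uj; rewrite /A; case: xgetP => [B -> //|H].
  have [|B BE] := @Zspan_sub R k l N L q (jets (u i) q) (jets (u j) q); last by case: (H B).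
  by move=> r; rewrite -(SU i) // (SU j) //; exact: Zspan_gen.
have cocycle : exists A : N -> N -> N -> 'M[int]_l.+1,
    [/\ forall i j, smooth_GLZ (U i `&` U j) (A i j),
        forall i j p, U i p -> U j p -> line (chi j p) = proj_act (A i j p) (chi i p)
      & forall i j h p, U i p -> U j p -> U h p -> A i h p = A j h p *m A i j p].
  exists A; split.
  - move=> i j p [Ui Uj].
    have [B [V [uB oV Vp VU VB]]] := sheeted_compare (sU i) (oU j) (Su j) (SU j) Ui Uj.
    have AB q : V q -> A i j q = B.
      by move=> Vq; have [Uiq Ujq] := VU q Vq; apply: (Zact_inj (ex i q Uiq)); rewrite -AE ?VB.
    rewrite AB //; split=> //; apply: filterS (open_nbhs_nbhs (conj oV Vp)) => q.
    exact: AB.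
  - move=> i j p Ui Uj; have [At tp] := triv_atP L p.
    rewrite (proj_line_of _ (chiE i p Ui)) chiE // /frame_line.
    by rewrite -(Zact_frame_vec At tp (Sq i p Ui) (Sq j p Uj) (AE i j p Ui Uj)).
  - move=> i j h p Ui Uj Uh.
    exact: (Zact_cocycle (ex i p Ui) (AE i j p Ui Uj) (AE j h p Uj Uh) (AE i h p Ui Uh)).
by exists (MkZprojective oU cov sub ld cocycle) => i; exists (u i); [exact: sU|exact: chiE].
Qed.

(** Q enters only through local lifts of its charts to frames of S. This covers both frames rescaled
    from another lattice and the charts of a structure realized by S. *)
Lemma adapted_same (S : Zlattice F L) (P Q : Zprojective F) : adapted S P ->
  (forall (j : ix Q) p, udom j p -> exists V v,
    [/\ open V, V p, forall r, smooth_sec V (v r),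
        forall q, V q -> jet_fiber S q = Zspan (jets v q)
      & forall q, V q -> line (umap j q) = frame_line v q]) ->
  same_structure P Q.
Proof.
move=> aP HQ i j p Pi Qj; have [u sU uE] := aP i.
have [V [v [oV Vp Sv SV vE]]] := HQ j p Qj.
have [B [W [uB oW Wp WU WB]]] := sheeted_compare sU oV Sv SV Pi Vp.
exists B => //; apply: filterS (open_nbhs_nbhs (conj oW Wp)) => q Wq.
have [Uq Vq] := WU q Wq; have [[oU Su _ _] _] := sU.
have [At tq] := triv_atP L q.
have Suq r : smooth_at q (u r) by exact: smooth_sec_at (Su r).
have Svq r : smooth_at q (v r) by exact: smooth_sec_at (Sv r).
rewrite (proj_line_of _ (uE q Uq)) vE // /frame_line.
by rewrite -(Zact_frame_vec At tq Suq Svq (WB q Wq)).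
Qed.

Lemma frame_line_scale u g q : g q != 0 ->
  frame_line (fun r => scale_sec g (u r)) q = frame_line u q.
Proof.
move=> g0; rewrite /frame_line -[RHS](line_ofZ _ g0); congr line_of.
by apply/colP => r; rewrite !mxE /triv_val linearZ.
Qed.

(** Frames of S' divided by f are frames of S with the same lines. *)
Lemma iso_same (S S' : Zlattice F L) P P' : adapted S P -> adapted S' P' ->
  lattice_iso S S' -> same_structure P P'.
Proof.
move=> aP aP' [f [Sf f0 Hf]]; apply: (adapted_same aP) => j p Qj.
have [v sV vE] := aP' j; have [[oV Sv SV _] _] := sV.
have Sfq q : smooth_fun_at q f by exists setT; split=> //; exact: openT.
pose g x := (f x)^-1.
have Sg : sm setT g by apply: smooth_onV => //; exact: openT.
have g0 q : g q != 0 by rewrite invr_eq0.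
exists (udom j), (fun r => scale_sec g (v r)); split; [exact: oV|exact: Qj|..].
- move=> r; apply: (smooth_secZ oV); last exact: Sv.
  exact: smooth_on_subset Sg.
- move=> q Vq; have Svq r : smooth_at q (v r) by exact: smooth_sec_at (Sv r).
  have sc : scales f q S S' by move=> s Ss; exact: Hf.
  have Sgq := smooth_fun_atV (Sfq q) (f0 q).
  exact: (scales_span Sgq (g0 q) Svq (scalesV (Sfq q) (f0 q) sc) (SV q Vq)).
- by move=> q Vq; rewrite frame_line_scale // vE.
Qed.

Lemma frame_line_Zcomb q (B : 'M[int]_l.+1) u t :
  frame_vec t (fun r x => \sum_s (B r s)%:~R *: u s x) q = map_mx intr B *m frame_vec t u q.
Proof.
apply/colP => r; rewrite !mxE /triv_val linear_sum; apply: eq_bigr => s _.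
by rewrite !mxE linearZ.
Qed.

Lemma jets_Zcomb q (B : 'M[int]_l.+1) u : (forall r, smooth_at q (u r)) ->
  jets (fun r x => \sum_s (B r s)%:~R *: u s x) q = Zact B (jets u q).
Proof.
move=> Su; apply/funext => r; rewrite /Zact; have [-> _] := Zcomb_val (row r B) Su.
congr j1; apply: functional_extensionality_dep => x.
by apply: eq_bigr => s _; rewrite mxE.
Qed.

(** The two families are proportional by a nowhere vanishing smooth function, the quotient of
    components that do not vanish at p. Its sign is constant near p and is split off as e. *)
Lemma frame_line_quotient (W : set N) u v p : open W -> W p ->
  (forall r, smooth_sec W (u r)) -> (forall r, smooth_sec W (v r)) ->
  (forall q, W q -> frame_line u q = frame_line v q) ->
  (forall q t, W q -> trivs L t -> tdom t q -> frame_vec t v q != 0) ->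
  exists V g (e : bool), [/\ open V, V p, V `<=` W, sm V g & forall q, V q -> 0 < g q /\
    forall r, v r q = (-1) ^+ e *: (g q *: u r q)].
Proof.
move=> oW Wp Su Sv uv v0.
have [t At tp] := trivs_cover L p.
have u0 q t' : W q -> trivs L t' -> tdom t' q -> exists2 a : R, a != 0 &
    frame_vec t' v q = a *: frame_vec t' u q.
  move=> Wq At' t'q; apply: line_of_eq; last exact: v0.
  by rewrite -!(frame_lineE _ At') // uv.
have [r ur] : exists r, u r p != 0.
  apply: contrapT => /forallNP H; have /negP[] := v0 p t Wp At tp.
  have [a _ ->] := u0 p t Wp At tp; rewrite scaler_eq0; apply/orP; right.
  apply/eqP/colP => r; have /negP := H r; rewrite negbK !mxE /triv_val => /eqP ->.
  exact: linear0.
pose W1 := W `&` [set x | u r x != 0] `&` tdom t.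
have oW1 : open W1.
  apply: openI; last exact: trivs_open.
  exact: sec_nonzero_open.
have ST s : smooth_sec W s -> sm W1 (triv_val t s).
  move=> Ss; apply: smooth_on_subset (smooth_sec_triv oW At Ss) => x [[Wx _] tx].
  by [].
have tu q : W1 q -> triv_val t (u r) q != 0.
  by move=> [[Wq uq] tq]; rewrite /triv_val triv_eq0.
pose c q := triv_val t (v r) q / triv_val t (u r) q.
have Sc : sm W1 c by apply: smooth_onM => //; [exact: ST|apply: smooth_onV => //; exact: ST].
have cE q : W1 q -> c q != 0 /\ forall s, v s q = c q *: u s q.
  move=> W1q; have [[Wq uq] tq] := W1q.
  have [a a0 aE] := u0 q t Wq At tq.
  have -> : c q = a.
    by move/colP/(_ r): aE; rewrite !mxE /c => ->; rewrite mulfK // tu.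
  split=> // s; apply: (trivs_inj At tq); rewrite linearZ.
  by move/colP/(_ s): aE; rewrite !mxE.
have W1p : W1 p by [].
have [c0 _] := cE p W1p.
have [e e0] : exists e : bool, 0 < (-1) ^+ e * c p.
  case: (ltgtP 0 (c p)) c0 => [cp _|cp _|//].
    by exists false; rewrite expr0 mul1r.
  by exists true; rewrite expr1 mulN1r oppr_gt0.
have Sg : sm W1 (fun q => (-1) ^+ e * c q).
  by apply: smooth_onM => //; exact: smooth_on_cst.
have [V [oV Vp VP]] := near_open (smooth_on_near_gt0 oW1 Sg W1p e0).
exists (W1 `&` V), (fun q => (-1) ^+ e * c q), e; split=> //; first exact: openI.
- by move=> q [[[]]].
- by apply: smooth_on_subset Sg => x [].
- move=> q [/cE[_ vE] /VP gq]; split=> // s.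
  by rewrite vE !scalerA mulrA -expr2 sqrr_sign mul1r.
Qed.

Lemma Zspan_sign q (e : bool) (b : 'I_l.+1 -> J1 L q) :
  Zspan (fun r => (-1 : R) ^+ e *: b r) = Zspan b.
Proof.
have Zs m (b' : 'I_l.+1 -> J1 L q) :
    Zcomb m (fun r => (-1 : R) ^+ e *: b' r) = Zcomb ((-1) ^+ e *: m) b'.
  rewrite !ZcombE; apply: eq_bigr => r _; rewrite scalerA !mxE rmorphM rmorph_sign mulrC.
  by [].
apply/seteqP; split=> _ [m _ <-]; first by rewrite Zs; exists ((-1) ^+ e *: m).
exists ((-1) ^+ e *: m) => //.
by rewrite Zs scalerA -expr2 sqrr_sign scale1r.
Qed.

Lemma local_scales (S S' : Zlattice F L) P P' p : adapted S P -> adapted S' P' ->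
  same_structure P P' ->
  exists V g, [/\ open V, V p, sm V g, forall q, V q -> 0 < g q &
    forall q, V q -> scales g q S S'].
Proof.
move=> aP aP' PP'; have [i Pi] := udom_cover P p; have [j Pj] := udom_cover P' p.
have [u sU uE] := aP i; have [u' sU' u'E] := aP' j.
have [[oU Su SU ex] _] := sU; have [[oU' Su' SU' ex'] _] := sU'.
have [B uB /near_open[D [oD Dp DB]]] := PP' i j p Pi Pj.
pose v r x := \sum_s (B r s)%:~R *: u s x : L x.
pose W := udom i `&` udom j `&` D.
have oW : open W by apply: openI => //; exact: openI.
have SuW r : smooth_sec W (u r) by apply: smooth_sec_subset (Su r) => x [[]].
have Su'W r : smooth_sec W (u' r) by apply: smooth_sec_subset (Su' r) => x [[]].
have SvW r : smooth_sec W (v r) by exact: smooth_sec_comb.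
have vu' q : W q -> frame_line v q = frame_line u' q.
  move=> [[Uq U'q] Dq]; rewrite -u'E // (DB q Dq) (proj_line_of _ (uE q Uq)).
  by rewrite /frame_line frame_line_Zcomb.
have nz q t : W q -> trivs L t -> tdom t q -> frame_vec t u' q != 0.
  move=> [[Uq U'q] Dq] At tq; apply: exact_frame_neq0 => //; last exact: ex'.
  by move=> r; exact: smooth_sec_at (Su' r).
have Wp : W p by [].
have [V [g [e [oV Vp VW Sg gE]]]] := frame_line_quotient oW Wp SvW Su'W vu' nz.
exists V, g; split=> // q Vq; first by case: (gE q Vq).
have [g0 _] := gE q Vq; have Wq := VW q Vq; have [[Uq U'q] Dq] := Wq.
have Suq r : smooth_at q (u r) by exact: smooth_sec_at (Su r).
have Svq r : smooth_at q (v r) by exact: smooth_sec_at (SvW r).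
have Sgq : smooth_fun_at q g by exists V.
have gn0 : g q != 0 by rewrite gt_eqF.
apply: (span_scales Sgq gn0 Svq).
  by rewrite jets_Zcomb // Zspan_Zact // SU.
apply: etrans (SU' q U'q) _; apply: etrans (Zspan_sign e (jets (fun r => scale_sec g (v r)) q)).
congr Zspan; apply/funext => r.
have Sgv := smooth_at_scale_sec Sgq (Svq r).
have -> : (-1 : R) ^+ e *: jets (fun r => scale_sec g (v r)) q r =
    j1 q (fun x => (-1 : R) ^+ e *: scale_sec g (v r) x) by exact: jet_scaleE.
apply: (j1_eq_on oV Vq); first exact: smooth_sec_at (Su' r).
by move=> x Vx; have [_ ->] := gE x Vx.
Qed.

Lemma same_iso (S S' : Zlattice F L) P P' : adapted S P -> adapted S' P' ->
  same_structure P P' -> lattice_iso S S'.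
Proof.
move=> aP aP' PP'.
pose val p (y : R) := exists V g, [/\ open V, V p, sm V g, forall q, V q -> 0 < g q &
    forall q, V q -> scales g q S S'] /\ g p = y.
(* Chosen at each point among the values of local factors; by [scales_unique] it agrees with every
   local factor, hence is smooth. *)
pose f p := xget 0 [set y | val p y].
have fE V g : open V -> sm V g -> (forall q, V q -> 0 < g q) ->
    (forall q, V q -> scales g q S S') -> forall q, V q -> f q = g q.
  move=> oV Sg g0 sg q Vq; rewrite /f; case: xgetP => [y -> [V' [g' [[oV' V'q Sg' g0' sg'] <-]]]|].
    have [i Pi] := udom_cover P q; have [u sU _] := aP i; have [[oU Su SU ex] _] := sU.
    have Suq r : smooth_at q (u r) by exact: smooth_sec_at (Su r).
    apply: (scales_unique _ _ _ _ Suq (ex q Pi) (SU q Pi) (sg' q V'q) (sg q Vq)).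
    - by exists V'.
    - by exists V.
    - exact: g0'.
    - exact: g0.
  by move=> /(_ (g q)); case; exists V, g.
exists f; split.
- apply: smooth_on_local => p _; have [V [g [oV Vp Sg g0 sg]]] := local_scales p aP aP' PP'.
  exists V => //; apply: (smooth_on_ext oV _ Sg) => x Vx.
  by rewrite (fE V g).
- move=> p; have [V [g [oV Vp Sg g0 sg]]] := local_scales p aP aP' PP'.
  by rewrite (fE V g) // gt_eqF // g0.
- move=> p s Ss; have [V [g [oV Vp Sg g0 sg]]] := local_scales p aP aP' PP'.
  rewrite (sg p Vp s Ss).
  suff -> : j1 p (scale_sec g s) = j1 p (fun x => f x *: s x) by [].
  apply: (j1_eq_on oV Vp); first by apply: smooth_at_scale_sec => //; exists V.
  by move=> x Vx; rewrite /scale_sec (fE V g).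
Qed.

Lemma adapted_generated (S : Zlattice F L) P Q : adapted S P -> same_structure P Q ->
  locally_generated S Q.
Proof.
move=> aP PQ j p Qj; have [i Pi] := udom_cover P p.
have [u sU uE] := aP i; have [[oU Su SU ex] _] := sU.
have [B uB /near_open[D [oD Dp DB]]] := PQ i j p Pi Qj.
pose x r y := \sum_s (B r s)%:~R *: u s y : L y.
pose W := udom i `&` udom j `&` D.
have oW : open W by apply: openI => //; apply: openI; exact: udom_open.
have SuW r : smooth_sec W (u r) by apply: smooth_sec_subset (Su r) => y [[]].
have SxW r : smooth_sec W (x r) by exact: smooth_sec_comb.
exists W, x; split=> //; first by move=> q [[]].
  pose w q := frame_vec (triv_at L q) x q.
  have wE q : W q -> line (umap j q) = line_of (w q).
    move=> [[Uq Vq] Dq]; rewrite (DB q Dq) (proj_line_of _ (uE q Uq)).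
    by rewrite /w frame_line_Zcomb.
  have /choice[r0 r0P] q : exists r, W q -> w q r 0 != 0.
    case: (pselect (W q)) => [Wq|nW]; last by exists 0.
    have := line_of_neq0 (wE q Wq) => w0; apply: contrapT => /forallNP H.
    move/negP: w0; apply; apply/eqP/colP => r; rewrite [RHS]mxE; apply/eqP.
    by apply: contrapT => wr; apply: (H r) => _; exact/negP.
  (* On the line spanned by [w q], the quotient is the number a with y = a w. The index [r0 q] of a
     nonzero coordinate may vary wildly with q; smoothness is required of the sections x only. *)
  exists (fun q (v : L q) y => triv_at L q q v * (y (r0 q) 0 / w q (r0 q) 0)); split=> // q Wq.
  have wn := r0P q Wq; have [At tq] := triv_atP L q; split.
  - by move=> a v v' y _; rewrite linearP mulrDl -mulrA.
  - move=> a v y y' _ _; have -> : (a *: y + y') (r0 q) 0 = a * y (r0 q) 0 + y' (r0 q) 0.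
      by rewrite !mxE.
    by ring.
  - move=> v y v0; rewrite wE // => -[a _ <-] aw; rewrite mxE mulfK //.
    rewrite mulf_neq0 ?triv_eq0 //; apply: contra_neq aw => ->.
    by rewrite scale0r.
  - move=> r y; rewrite wE // => -[a _ <-].
    have aE s : (a *: w q) s 0 = a * w q s 0 by rewrite mxE.
    by rewrite !aE mulfK // mulrC; congr (_ * _); rewrite mxE.
move=> q [[Uq _] _]; have Suq r : smooth_at q (u r) by exact: smooth_sec_at (Su r).
by rewrite -/(jets x q) jets_Zcomb // Zspan_Zact // SU.
Qed.

End Correspondence.

(** * The lattice of a projective structure *)

Section Realization.
Variables (R : realType) (k l : nat) (N : manifold R (k + l)).
Variables (F : foliation N) (L : line_bundle N).
Local Notation sm := (smooth_on (charts N)).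
Implicit Types (u v : 'I_l.+1 -> section L).

(** In a trivialization of L, the coordinate [r0], nonzero at p, is normalized to 1; the other
    components are then affine coordinates of the chart, which are smooth. *)
Lemma projective_lift (P : Zprojective F) (i : ix P) p : udom i p -> exists W v,
  [/\ open W, W p, W `<=` udom i, forall r, smooth_sec W (v r) &
    forall q, W q -> line (umap i q) = frame_line v q].
Proof.
move=> Pi; have [v0 _] := rp_vecP (umap i p).
have [r0 r0P] : exists r, rp_vec (umap i p) r 0 != 0.
  apply: contrapT => /forallNP H; move/negP: v0; apply; apply/eqP/colP => r.
  by rewrite [RHS]mxE; apply/eqP; apply: contrapT => wr; apply: (H r); exact/negP.
have [t At tp] := trivs_cover L p.
have [sub _] := @umap_submersion _ _ _ _ _ P i.
have [/atlas_openP oV SV] := sub (rp_chart R r0) (ex_intro2 _ _ r0 I erefl).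
set V := udom i `&` _ in oV SV.
have oW : open (V `&` tdom t) by apply: openI => //; exact: trivs_open.
pose f r q := rp_vec (umap i q) r 0 / rp_vec (umap i q) r0 0.
have Sf r : sm (V `&` tdom t) (f r).
  case: (unliftP r0 r) => [s ->|->].
    apply: (smooth_on_ext oW (f := fun q => rp_chart R r0 (umap i q) 0 s)).
      by move=> q _; rewrite mxE.
    by apply: smooth_on_subset (SV s) => x [].
  apply: (smooth_on_ext oW (f := fun=> 1)); last exact: smooth_on_cst.
  by move=> q [[_ q0] _]; rewrite /f divff.
exists (V `&` tdom t), (fun r => sec_of t (f r)); split=> //.
- by move=> q [[]].
- by move=> r; apply: sec_of_smooth => // q [].
- move=> q [[Uq q0] tq]; have [_ ->] := rp_vecP (umap i q); rewrite (frame_lineE _ At tq).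
  rewrite -(line_ofZ (a := (rp_vec (umap i q) r0 0)^-1) (rp_vec (umap i q))) ?invr_neq0 //.
  by congr line_of; apply/colP => r; rewrite !mxE /triv_val sec_ofE // mulrC.
Qed.

Section Normalization.
Variable P : Zprojective F.
Variables (ip : N -> ix P) (W : N -> set N) (v : N -> 'I_l.+1 -> section L).
Variable A : ix P -> ix P -> N -> 'M[int]_l.+1.
Hypotheses (oW : forall p, open (W p)) (Wp : forall p, W p p).
Hypotheses (WU : forall p, W p `<=` udom (ip p)) (Sv : forall p r, smooth_sec (W p) (v p r)).
Hypothesis vE : forall p q, W p q -> line (umap (ip p) q) = frame_line (v p) q.
Hypothesis sA : forall i j, smooth_GLZ (udom i `&` udom j) (A i j).
Hypothesis hA : forall i j p, udom i p -> udom j p ->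
  line (umap j p) = proj_act (A i j p) (umap i p).
Hypothesis cA : forall i j h p, udom i p -> udom j p -> udom h p ->
  A i h p = A j h p *m A i j p.

Let vec p q := frame_vec (triv_at L q) (v p) q.
Let AR p p' q : 'M[R]_l.+1 := map_mx intr (A (ip p) (ip p') q).

Let rel p p' q (a : R) := vec p' q = a *: (AR p p' q *m vec p q).

Let vec0 p q : W p q -> vec p q != 0.
Proof. by move=> Wq; apply: line_of_neq0 (vE Wq). Qed.

Let rel_exists p p' q : W p q -> W p' q -> exists2 a, a != 0 & rel p p' q a.
Proof.
move=> Wq W'q; apply: line_of_eq; last exact: vec0.
rewrite -(proj_line_of _ (vE Wq)) -hA; [exact: vE|exact: WU|exact: WU].
Qed.

Let rel_unique p p' q a b : W p' q -> rel p p' q a -> rel p p' q b -> a = b.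
Proof.
move=> W'q; rewrite /rel => Ea Eb; have := vec0 W'q; rewrite Ea.
rewrite scaler_eq0 negb_or => /andP[_ X0].
apply/eqP; rewrite -subr_eq0; have : (a - b) *: (AR p p' q *m vec p q) = 0.
  by rewrite scalerBl -Ea -Eb subrr.
by move/eqP; rewrite scaler_eq0 (negbTE X0) orbF.
Qed.

(** The factor between two lifts, once the matrix A is accounted for. Its absolute value inherits
    the cocycle identity from A and is positive, as [positive_cocycle] requires; the sign will not
    affect spans. *)
Let coc p p' q := `|xget 0 [set a | rel p p' q a]|.

Let cocP p p' q a : W p' q -> rel p p' q a -> coc p p' q = `|a|.
Proof.
move=> W'q ra; rewrite /coc; case: xgetP => [b -> rb|/(_ a) //].
by rewrite (rel_unique W'q ra rb).
Qed.

Let coc_gt0 p p' q : W p q -> W p' q -> 0 < coc p p' q.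
Proof.
by move=> Wq W'q; have [a a0 ra] := rel_exists Wq W'q; rewrite (cocP W'q ra) normr_gt0.
Qed.

Let cocM p p' p'' q : W p q -> W p' q -> W p'' q ->
  coc p p'' q = coc p p' q * coc p' p'' q.
Proof.
move=> Wq W'q W''q; have [a _ ra] := rel_exists Wq W'q; have [b _ rb] := rel_exists W'q W''q.
rewrite (cocP W'q ra) (cocP W''q rb) -normrM; apply: cocP => //.
rewrite /rel rb ra -scalemxAr scalerA mulmxA [b * a]mulrC; congr (_ *: (_ *m _)).
by rewrite /AR -map_mxM -cA //; exact: WU.
Qed.

(** Near [q0] both A and the sign of the factor are constant, so the absolute value [coc] is the
    only variable part of the change of lifts. *)
Let transition p p' q0 : W p q0 -> W p' q0 -> exists V (B : 'M[int]_l.+1) (e : bool),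
  [/\ open V, V q0, V `<=` W p `&` W p', B \in unitmx & sm V (coc p p') /\
    forall q, V q -> forall r, v p' r q = (-1) ^+ e *:
      (coc p p' q *: (\sum_s (B r s)%:~R *: v p s q))].
Proof.
move=> Wq0 W'q0; have [uB /near_open[D [oD Dq DB]]] := sA (conj (WU Wq0) (WU W'q0)).
set B := A (ip p) (ip p') q0 in uB DB.
pose W1 := W p `&` W p' `&` D.
have oW1 : open W1 by apply: openI => //; exact: openI.
pose u r x := \sum_s (B r s)%:~R *: v p s x : L x.
have Sv1 r : smooth_sec W1 (v p r) by apply: smooth_sec_subset (@Sv p r) => x [[]].
have Sv1' r : smooth_sec W1 (v p' r) by apply: smooth_sec_subset (@Sv p' r) => x [[]].
have Su r : smooth_sec W1 (u r) by exact: smooth_sec_comb.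
have lineE q : W1 q -> frame_line u q = frame_line (v p') q.
  move=> [[Wq W'q] Dq']; rewrite -vE // (hA (WU Wq) (WU W'q)) DB //.
  by rewrite (proj_line_of _ (vE Wq)) /frame_line frame_line_Zcomb.
have nz q t : W1 q -> trivs L t -> tdom t q -> frame_vec t (v p') q != 0.
  move=> [[Wq W'q] _] At tq; apply: (line_of_neq0 (x := umap (ip p') q)).
  by rewrite vE // (frame_lineE _ At tq).
have Wq1 : W1 q0 by [].
have [V [g [e [oV Vq VW Sg gE]]]] := frame_line_quotient oW1 Wq1 Su Sv1' lineE nz.
have cg q : V q -> coc p p' q = g q.
  move=> Vq'; have [[Wq W'q] Dq'] := VW q Vq'; have [g0 vg] := gE q Vq'.
  rewrite (@cocP p p' q ((-1) ^+ e * g q)) //.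
    by rewrite normrM normrX normrN normr1 expr1n mul1r gtr0_norm.
  rewrite /rel /AR DB // -frame_line_Zcomb; apply/colP => r.
  by rewrite !mxE /triv_val vg !scalarZ mulrA.
exists V, B, e; split=> //; first by move=> x /VW[].
split; last by move=> q Vq'; rewrite cg //; have [] := gE q Vq'.
by apply: (smooth_on_ext oV _ Sg) => x Vx; rewrite cg.
Qed.

Let coc_smooth p p' : sm (W p `&` W p') (coc p p').
Proof.
apply: smooth_on_local => q [Wq W'q].
have [V [B [e [oV Vq VW _ [SV _]]]]] := transition Wq W'q.
by exists V.
Qed.

Lemma normalized_lattice : exists (Z : Zlattice F L) (w : N -> 'I_l.+1 -> section L),
  forall p, [/\ forall r, smooth_sec (W p) (w p r),
    forall q, W p q -> jet_fiber Z q = Zspan (jets (w p) q) &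
    forall q, W p q -> line (umap (ip p) q) = frame_line (w p) q].
Proof.
have cov p : exists i, W i p by exists p.
have [h [Sh h0 hE]] := positive_cocycle oW cov coc_smooth coc_gt0 cocM.
pose w p r : section L := scale_sec (h p) (v p r).
have Sw p r : smooth_sec (W p) (w p r) by apply: smooth_secZ => //; exact: Sh.
have wE p q : W p q -> line (umap (ip p) q) = frame_line (w p) q.
  by move=> Wq; rewrite frame_line_scale ?vE // gt_eqF // h0.
have spanE p p' q : W p q -> W p' q -> Zspan (jets (w p') q) = Zspan (jets (w p) q).
  move=> Wq W'q; have [V [B [e [oV Vq VW uB [_ vB]]]]] := transition Wq W'q.
  have Swq p1 : W p1 q -> forall r, smooth_at q (w p1 r).
    by move=> W1q r; exact: smooth_sec_at (Sw p1 r).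
  rewrite -(Zspan_Zact (jets (w p) q) uB) -jets_Zcomb; last exact: Swq.
  apply: etrans (Zspan_sign e _); congr Zspan; apply/funext => r.
  pose x y := \sum_s (B r s)%:~R *: w p s y : L y.
  have Sx : smooth_at q x by have [] := j1_comb (fun s => (B r s)%:~R) (Swq p Wq).
  apply: etrans (esym (jet_scaleE ((-1) ^+ e) Sx)).
  apply: (j1_eq_on oV Vq); first exact: Swq.
  move=> y Vy; have [Wy W'y] := VW y Vy.
  rewrite /w /x /scale_sec vB // scalerA mulrC -scalerA; congr (_ *: _).
  (* The relation h p = coc p p' * h p' absorbs the only nonconstant factor. *)
  rewrite scalerA mulrC -hE // scaler_sumr; apply: eq_bigr => s _.
  by rewrite !scalerA mulrC.
pose S : set (J1_total L) := [set z | exists p, W p (projT1 z) /\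
  Zspan (jets (w p) (projT1 z)) (projT2 z)].
have SE p q : W p q -> jet_fiber S q = Zspan (jets (w p) q).
  move=> Wq; apply/seteqP; split=> a; last by exists p.
  by move=> [p' [/= W'q]]; rewrite (spanE p).
have [|Z ZS] := @frames_lattice R k l N F L S.
  move=> p; exists (W p) => //; exists (w p); split=> //; first exact: SE.
  apply: (submersion_exact (oW p) (Sw p) (@wE p) (@WU p)).
    exact: umap_submersion.
  exact: umap_defines.
exists Z, w => p; split; [exact: Sw| |exact: wE].
by rewrite ZS; exact: SE.
Qed.

End Normalization.

(** Stated for every Q adapted to Z, hence for whichever structure is chosen as the image of Z. *)
Lemma realization (P : Zprojective F) : exists Z : Zlattice F L,
  forall Q : Zprojective F, adapted Z Q -> same_structure Q P.
Proof.
have /choice[ip ipP] := @udom_cover _ _ _ _ _ P.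
have /choice[D HD] p : exists D : set N * ('I_l.+1 -> section L),
    [/\ open D.1, D.1 p, D.1 `<=` udom (ip p), forall r, smooth_sec D.1 (D.2 r) &
    forall q, D.1 q -> line (umap (ip p) q) = frame_line D.2 q].
  by have [W [v H]] := projective_lift (ipP p); exists (W, v).
have [A [sA hA cA]] := umap_cocycle P.
have oW p : open (D p).1 by case: (HD p).
have Wp p : (D p).1 p by case: (HD p).
have WU p : (D p).1 `<=` udom (ip p) by case: (HD p).
have Sv p r : smooth_sec (D p).1 ((D p).2 r) by case: (HD p).
have vE p q : (D p).1 q -> line (umap (ip p) q) = frame_line (D p).2 q.
  by case: (HD p) => _ _ _ _; exact.
have [Z [w wP]] := normalized_lattice oW Wp WU Sv vE sA hA cA.
exists Z => Q aQ; apply: (adapted_same aQ) => j p Pj.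
have [Sw Zw wE] := wP p.
have [uB /near_open[E [oE Ep EB]]] := sA _ _ _ (conj (WU p p (Wp p)) Pj).
set B := A (ip p) j p in uB EB.
have oV : open ((D p).1 `&` E `&` udom j).
  by apply: openI; [exact: openI|exact: udom_open].
have SwV r : smooth_sec ((D p).1 `&` E `&` udom j) (w p r).
  by apply: smooth_sec_subset (Sw r) => x [[]].
exists ((D p).1 `&` E `&` udom j), (fun r x => \sum_s (B r s)%:~R *: w p s x); split.
- exact: oV.
- by [].
- by move=> r; exact: smooth_sec_comb.
- move=> q [[Wq _] _]; rewrite jets_Zcomb; last by move=> r; exact: smooth_sec_at (Sw r).
  by rewrite Zspan_Zact // Zw.
- move=> q [[Wq Eq] Uq]; rewrite (hA _ _ _ (WU p q Wq) Uq) EB //.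
  by rewrite (proj_line_of _ (wE q Wq)) /frame_line frame_line_Zcomb.
Qed.

End Realization.

Theorem proposition4p14 (R : realType) (k l : nat) (N : manifold R (k + l))
    (F : foliation N) (L : line_bundle N) :
  exists Phi : Zlattice F L -> Zprojective F,
    [/\ forall S S' : Zlattice F L,
          lattice_iso S S' <-> same_structure (Phi S) (Phi S'),
        forall P : Zprojective F, exists S : Zlattice F L,
          same_structure (Phi S) P
      & forall (S : Zlattice F L) (P : Zprojective F),
          same_structure (Phi S) P -> locally_generated S P].
Proof.
have /choice[Phi PhiP] := @adapted_exists R k l N F L.
exists Phi; split=> [S S'|P|S P].
- by split; [exact: iso_same|exact: same_iso].
- by have [Z HZ] := realization L P; exists Z; exact: HZ.
- exact: adapted_generated.
Qed.
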